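(* There is an absolute constant $C>0$ such that the following holds. Let $d \geq 2$ and $x_0\geq 3$, let $f \in \mathcal{M}(x_0;d)$, let $1 \leq x \leq x_0$ and set $$\Sigma := \min\Big\{P^-(d),\ 2 + \sum_{\substack{p \leq x \\ f(p) \neq 0,1}} \frac1p\Big\}.$$ Then $$\frac{1}{d}\sum_{0 \leq \ell \leq d-1} \Big|\sum_{1\le n \leq x} f^\ell(n)\Big|^2 \leq C\, x^2 \frac{(\log \Sigma)^2}{\Sigma^{1/11}}.$$
   Context: Sums over $p$ are over primes; $P^-(d)$ is the smallest prime factor of $d$; $\mu_d$ is the set of complex $d$-th roots of unity. For $d\in\mathbb{N}$ and $x_0\ge1$, $\mathcal{M}(x_0;d)$ is the set of completely multiplicative functions $f:\mathbb{N}\to\mu_d\cup\{0\}$ such that for every $x\ge x_0$, $\max_{\alpha\in\mu_d}|\{n\le x: f(n)=\alpha\}|\le \frac{100x}{d}\prod_{p\le x,\ f(p)=0}(1-\frac1p)$. For $\ell\ge1$, $f^\ell(n)=f(n)^\ell$; $f^0$ denotes the function equal to $1$ at $n$ with $f(n)\ne0$ and $0$ at $n$ with $f(n)=0$ (as for the principal character). *)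

(* Defs.v *)
From HB Require Import structures.
From mathcomp Require Import all_boot all_order all_algebra.
From mathcomp Require Import all_classical all_reals.
From mathcomp Require Import exp.
From mathcomp Require Import complex.
Set Implicit Arguments. Unset Strict Implicit. Unset Printing Implicit Defensive.
Import Order.TTheory GRing.Theory Num.Theory.
Local Open Scope ring_scope.

Section Defs.
Variable R : realType.

Definition completely_multiplicative (f : nat -> R[i]) :=
  f 1%N = 1 /\ forall m n : nat, (0 < m)%N -> (0 < n)%N -> f (m * n)%N = f m * f n.

Definition values_in_mu0 (d : nat) (f : nat -> R[i]) :=
  forall n : nat, (0 < n)%N -> f n = 0 \/ f n ^+ d = 1.

Definition upto (x : R) : seq nat := iota 1 (Num.truncn x).

Definition classM (x0 : R) (d : nat) (f : nat -> R[i]) :=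
  [/\ completely_multiplicative f, values_in_mu0 d f &
   forall x : R, x0 <= x -> forall a : R[i], a ^+ d = 1 ->
     (count (fun n => f n == a) (upto x))%:R
       <= 100 * x / d%:R *
          \prod_(p <- upto x | prime p && (f p == 0)) (1 - (p%:R)^-1)].

(* f^l, with f^0 the principal-character-like indicator of f(n) <> 0 *)
Definition fpow (f : nat -> R[i]) (l : nat) (n : nat) : R[i] :=
  if l == 0%N then (if f n == 0 then 0 else 1) else f n ^+ l.

Definition Sigma (d : nat) (f : nat -> R[i]) (x : R) : R :=
  Num.min ((pdiv d)%:R)
    (2 + \sum_(p <- upto x | prime p && (f p != 0) && (f p != 1)) (p%:R)^-1).
End Defs.

(* Main.v *)
(* The left-hand side is x^2 D, where D averages over l the square of the mean m_l of f^l up to x.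
   Put 2 eta^2 = D; then at least eta^2 d of the l have |m_l| >= eta. For such an l write
   M(t) for the mean of f^l up to e^t. The dual Turan-Kubilius inequality gives
   M(t) ~ f^l(p) M(t - log p) for most primes p, and Plancherel on a window of length U where M is
   large yields tau_l with sum_p |1 - f^l(p) p^(i tau_l)|^2 / p << eta^(-3). A set of at least
   eta^2 d residues generates Z/d by differences in O(eta^(-2)) steps, as proper subgroups have index
   at least P^-(d) (if P^-(d) <= eta^(-2) there is nothing to prove); so every l has such a tau_l.
   Since sum_(p <= y) (1 - cos (t log p)) / p is at least loglog y minus the log of a bound for
   zeta(1 + 1/log y + it), l |-> tau_l is an almost additive bounded function on Z/d, hence almost
   zero, so that sum_p |1 - f^l(p)|^2 / p is bounded for all l. Averaging over l, the sum of 1/p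
   over f(p) <> 0, 1 is << eta^(-8), which is more than the exponent 1/11 requires. *)
Require Import Defs.
From HB Require Import structures.
From mathcomp Require Import all_boot all_order all_algebra fingroup.
From mathcomp Require Import all_classical all_reals.
From mathcomp Require Import topology normedtype sequences derive exp trigo.
From mathcomp Require Import complex.
From mathcomp Require Import ring lra zify.
(* fingroup has a [classM] of its own. *)
Import Defs.
Import Order.TTheory GRing.Theory Num.Theory numFieldNormedType.Exports.
Set Implicit Arguments. Unset Strict Implicit. Unset Printing Implicit Defensive.
Local Open Scope ring_scope.

(** * The Turán-Kubilius inequality *)

(** All analysis is kept finite. The window is sampled at N points and Plancherel becomes Parseval
    on Z/N, at the price of the wrap-around of the shifts; zeta is replaced by an Euler product
    truncated in primes and exponents, of which only the modulus is used, so that no complex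
    logarithm is taken. Closeness to 1 is measured by sum_p |1 - z(p)|^2 / p. Its square root obeys
    a triangle inequality under products, so n factors cost n^2 and not 2^n: the O(eta^(-2))
    differences turn eta^(-3) into eta^(-7). The additivity defect of tau_l is exponential in this,
    but enters only through its logarithm. Two further losses occur. The window is found among
    O(eta^(-2)) dyadic scales, so tau_l controls only the primes with log p <= (log x) / W, where
    log W = O(eta^(-2)); the primes beyond carry mass O(1 + log W). And the logarithm of the bound
    for tau_l is estimated crudely by a power, which is where the 8 comes from. Finally 2 eta^2 = D
    turns Sigma eta^22 = O(1) into the exponent 1/11. *)

Lemma mem_upto (R : realType) (z : R) (n : nat) :
  (n \in upto z) = (0 < n)%N && (n%:R <= z).
Proof.
rewrite /upto mem_iota add1n ltnS; case: n => [//|n] /=.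
case: (leP 0 z) => hz; first by rewrite truncn_ge_nat.
rewrite (_ : Num.truncn z = 0%N); last by apply/truncn0Pn; rewrite -ltNge; lra.
by rewrite ltn0; apply/esym/negbTE; rewrite -ltNge (lt_le_trans hz).
Qed.

Lemma uniq_upto (R : realType) (z : R) : uniq (upto z).
Proof. exact: iota_uniq. Qed.

Lemma sum_upto_sub (R : realType) (V : nmodType) (w z : R) (P : pred nat) (F : nat -> V) :
  w <= z ->
  \sum_(n <- upto w | P n) F n = \sum_(n <- upto z | P n && (n%:R <= w)) F n.
Proof.
move=> wz; rewrite -[LHS]big_filter -[RHS]big_filter; apply: perm_big.
apply: uniq_perm; rewrite ?filter_uniq ?uniq_upto // => n.
rewrite !mem_filter !mem_upto; case: (P n) => //=.
have [h|] := boolP (n%:R <= w); last by rewrite andbF.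
by rewrite (le_trans h wz) andbT.
Qed.

Lemma sum_upto_split (R : realType) (V : nmodType) (w z : R) (P : pred nat) (F : nat -> V) :
  w <= z ->
  \sum_(n <- upto z | P n) F n =
  \sum_(n <- upto w | P n) F n + \sum_(n <- upto z | P n && (w < n%:R)) F n.
Proof.
move=> wz; rewrite (bigID (fun n => n%:R <= w)) /= (sum_upto_sub _ _ wz).
by congr (_ + _); apply: eq_bigl => n; rewrite -ltNge.
Qed.

Lemma ler_sum_upto (R : realType) (w z : R) (P Q : pred nat) (F : nat -> R) :
  w <= z -> (forall n, Q n -> 0 <= F n) -> (forall n, P n -> Q n) ->
  \sum_(n <- upto w | P n) F n <= \sum_(n <- upto z | Q n) F n.
Proof.
move=> wz F0 PQ; rewrite (sum_upto_sub _ _ wz).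
rewrite [leRHS](bigID (fun n => P n && (n%:R <= w))) /=.
rewrite -[leLHS]addr0; apply: lerD.
  rewrite le_eqVlt; apply/orP; left; apply/eqP; apply: eq_bigl => n.
  by case hP: (P n); rewrite ?andbF // PQ.
by apply: sumr_ge0 => n /andP[/F0].
Qed.

Lemma count_upto_dvd (R : realType) (z : R) (d : nat) : (0 < d)%N -> 0 <= z ->
  z / d%:R - 1 <= \sum_(n <- upto z) ((d %| n)%:R : R) <= z / d%:R.
Proof.
move=> d0 z0.
have -> : \sum_(n <- upto z) ((d %| n)%:R : R) = (Num.truncn z %/ d)%:R.
  rewrite /upto; elim: (Num.truncn z) => [|n IH]; first by rewrite div0n big_nil.
  rewrite -(addn1 n) iotaD big_cat /= IH big_seq1 add1n addn1 -natrD.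
  by rewrite divnS // addnC.
have /andP[h1 h2] := truncn_itv z0.
have d0R : (0 : R) < d%:R by rewrite ltr0n.
apply/andP; split.
  rewrite lerBlDr ler_pdivrMr //; apply: ltW; apply: lt_le_trans h2 _.
  rewrite natr1 -natrM ler_nat.
  exact: ltn_ceil.
rewrite ler_pdivlMr // -natrM; apply: le_trans h1; rewrite ler_nat.
exact: leq_trunc_div.
Qed.

Lemma count_upto (R : realType) (z : R) : 0 <= z ->
  z - 1 <= \sum_(n <- upto z) (1 : R) <= z.
Proof.
move=> z0; have := count_upto_dvd (d := 1) isT z0.
rewrite divr1; under eq_bigr do rewrite dvd1n.
by [].
Qed.

Lemma sum_upto_multiples (R : realType) (V : nmodType) (z : R) (p : nat) (F : nat -> V) :
  (0 < p)%N ->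
  \sum_(n <- upto z | (p %| n)%N) F n = \sum_(m <- upto (z / p%:R)) F (p * m)%N.
Proof.
move=> p0; rewrite -big_filter -(big_map (fun m => (p * m)%N) xpredT F).
apply: perm_big; apply: uniq_perm; rewrite ?filter_uniq ?uniq_upto //.
  by rewrite map_inj_uniq ?uniq_upto // => a b /eqP; rewrite eqn_pmul2l // => /eqP.
move=> n; rewrite mem_filter mem_upto; apply/idP/mapP.
  move=> /and3P[/dvdnP[m ->] h1 h2]; exists m; last by rewrite mulnC.
  rewrite mem_upto ler_pdivlMr ?ltr0n // -natrM h2 andbT.
  by move: h1; rewrite muln_gt0 => /andP[].
move=> [m]; rewrite mem_upto ler_pdivlMr ?ltr0n // => /andP[h1 h2] ->.
by rewrite dvdn_mulr // muln_gt0 p0 h1 mulnC natrM.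
Qed.

(** For distinct p and q the main terms z / (p q) of the four counts cancel and only rounding errors
    remain; for p = q a variance of at most z / p survives. *)
Lemma turan_kubilius_corr (R : realType) (z : R) (p q : nat) : 0 <= z ->
  prime p -> prime q ->
  \sum_(n <- upto z) ((p %| n)%N%:R - (p%:R)^-1) * ((q %| n)%N%:R - (q%:R)^-1)
    <= (if p == q then z / p%:R else 0) + 2 /\
  - ((if p == q then z / p%:R else 0) + 2) <=
  \sum_(n <- upto z) ((p %| n)%N%:R - (p%:R)^-1) * ((q %| n)%N%:R - (q%:R)^-1).
Proof.
move=> z0 pp pq.
have p2 : (2 : R) <= p%:R by rewrite ler_nat prime_gt1.
have q2 : (2 : R) <= q%:R by rewrite ler_nat prime_gt1.
have -> : \sum_(n <- upto z) ((p %| n)%N%:R - (p%:R)^-1) * ((q %| n)%N%:R - (q%:R)^-1) =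
  \sum_(n <- upto z) ((p %| n) && (q %| n))%N%:R
  - (q%:R)^-1 * \sum_(n <- upto z) (p %| n)%N%:R
  - (p%:R)^-1 * \sum_(n <- upto z) (q %| n)%N%:R
  + (p%:R)^-1 * (q%:R)^-1 * \sum_(n <- upto z) 1 :> R.
  rewrite !mulr_sumr -!sumrB -big_split /=; apply: eq_bigr => n _.
  rewrite -mulnb natrM; ring.
have /andP[lp up] := count_upto_dvd (prime_gt0 pp) z0.
have /andP[lq uq] := count_upto_dvd (prime_gt0 pq) z0.
have /andP[l1 u1] := count_upto z0.
set cp := \sum_(n <- upto z) (p %| n)%N%:R in lp up *.
set cq := \sum_(n <- upto z) (q %| n)%N%:R in lq uq *.
set c1 := \sum_(n <- upto z) 1 in l1 u1 *.
set cpq := (X in X - _ - _ + _).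
have ip : 0 < ((p%:R)^-1 : R) <= 2^-1.
  by rewrite invr_gt0 lef_pV2 ?posrE ?p2 ?andbT; lra.
have iq : 0 < ((q%:R)^-1 : R) <= 2^-1.
  by rewrite invr_gt0 lef_pV2 ?posrE ?q2 ?andbT; lra.
set ip' := (p%:R)^-1 in ip lp up *; set iq' := (q%:R)^-1 in iq lq uq *.
have [h h'] : cpq <= (if p == q then z * ip' else z * ip' * iq') /\
              (if p == q then z * ip' else z * ip' * iq') - 1 <= cpq.
  case: eqP => [e|/eqP ne].
    rewrite /cpq -e; under eq_bigr do rewrite andbb.
    by [].
  have := count_upto_dvd (d := (p * q)%N) _ z0.
  rewrite muln_gt0 !prime_gt0 // => /(_ isT) /andP[].
  rewrite natrM invfM mulrA -/ip' -/iq' /cpq.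
  have cpq' : coprime p q by rewrite prime_coprime // dvdn_prime2.
  by under eq_bigr => n _ do rewrite (Gauss_dvd _ cpq').
have A' : iq' * cp <= iq' * (z * ip') by rewrite ler_wpM2l //; lra.
have B' : ip' * cq <= ip' * (z * iq') by rewrite ler_wpM2l //; lra.
have A : iq' * cp >= iq' * (z * ip' - 1) by rewrite ler_wpM2l //; lra.
have B : ip' * cq >= ip' * (z * iq' - 1) by rewrite ler_wpM2l //; lra.
have C' : ip' * iq' * c1 >= ip' * iq' * (z - 1) by rewrite ler_wpM2l ?mulr_ge0 //; lra.
have C : ip' * iq' * c1 <= ip' * iq' * z by rewrite ler_wpM2l ?mulr_ge0 //; lra.
have D1 : 0 <= z * ip' * iq' by rewrite !mulr_ge0 //; lra.
have D2 : ip' * iq' <= 1 by rewrite mulr_ile1 //; lra.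
have D3 : 0 <= z * ip' * (1 - iq') by rewrite !mulr_ge0 //; lra.
by case: ifP h h' => _ h h'; split; lra.
Qed.

(** Duality: the sum A is the inner product of [u] with the vector [b] obtained by transposing the
    map, and the correlation bounds give [b] a squared norm of at most 3 z A. The hypothesis on the
    sum of the primes absorbs the off-diagonal errors. *)
Lemma turan_kubilius_dual (R : realType) (z : R) (ps : seq nat) (u : nat -> R) : 0 < z ->
  uniq ps -> all prime ps -> \sum_(p <- ps) (p%:R : R) <= z ->
  (forall n, `|u n| <= 1) ->
  \sum_(p <- ps) p%:R * (\sum_(n <- upto z) u n * ((p %| n)%N%:R - (p%:R)^-1)) ^+ 2
   <= 3 * z ^+ 2.
Proof.
move=> z0 ups pps sps u1.
pose e p n : R := (p %| n)%N%:R - (p%:R)^-1.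
pose a p := \sum_(n <- upto z) u n * e p n.
rewrite -/(\sum_(p <- ps) p%:R * a p ^+ 2).
set A := \sum_(p <- ps) _.
pose b n := \sum_(p <- ps) p%:R * a p * e p n.
have A0 : 0 <= A by apply: sumr_ge0 => p _; rewrite mulr_ge0 ?sqr_ge0 ?ler0n.
have EA : A = \sum_(n <- upto z) u n * b n.
  rewrite /A /b; under [RHS]eq_bigr do rewrite mulr_sumr.
  rewrite [RHS]exchange_big /=. apply eq_bigr; move=> p _.
  rewrite expr2 {1}/a mulr_suml mulr_sumr; apply: eq_bigr => n _; ring.
have B : \sum_(n <- upto z) b n ^+ 2 <= 3 * z * A.
  have -> : \sum_(n <- upto z) b n ^+ 2 = \sum_(p <- ps) \sum_(q <- ps)
      (p%:R * a p) * (q%:R * a q) * \sum_(n <- upto z) e p n * e q n.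
    under eq_bigr => n _ do rewrite expr2 {1}/b mulr_suml.
    rewrite [LHS]exchange_big /=; apply: eq_bigr => p _.
    under eq_bigr => n _ do rewrite /b mulr_sumr.
    rewrite [LHS]exchange_big /=; apply: eq_bigr => q _.
    rewrite [RHS]mulr_sumr; apply: eq_bigr => n _; ring.
  have le1 p q : p \in ps -> q \in ps ->
     (p%:R * a p) * (q%:R * a q) * \sum_(n <- upto z) e p n * e q n <=
     (if p == q then z * (p%:R * a p ^+ 2) else 0) +
       (q%:R * (p%:R * a p ^+ 2) + p%:R * (q%:R * a q ^+ 2)).
    move=> hp hq; have pp := allP pps _ hp; have pq := allP pps _ hq.
    have [up lo] := turan_kubilius_corr (ltW z0) pp pq.
    have p0 : (0:R) < p%:R by rewrite ltr0n prime_gt0.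
    have q0 : (0:R) < q%:R by rewrite ltr0n prime_gt0.
    set S := \sum_(n <- upto z) _; rewrite -/S in up lo.
    case: (eqVneq p q) up lo => [<-|_] up lo.
      have : (p%:R * a p) * (p%:R * a p) * S <= (p%:R * a p) * (p%:R * a p) * (z / p%:R + 2).
        by rewrite ler_wpM2l // -expr2 sqr_ge0.
      move/le_trans; apply; rewrite le_eqVlt; apply/orP; left; apply/eqP.
      by field; lra.
    rewrite !add0r in up lo *.
    have : (p%:R * a p) * (q%:R * a q) * S <= `|(p%:R * a p) * (q%:R * a q)| * 2.
      apply: le_trans (ler_norm _) _; rewrite normrM ler_wpM2l // ler_norml.
      by apply/andP; split.
    move/le_trans; apply.
    have -> : `|p%:R * a p * (q%:R * a q)| = p%:R * q%:R * (`|a p| * `|a q|).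
      by rewrite !normrM (ger0_norm (ltW p0)) (ger0_norm (ltW q0)); ring.
    have : 2 * (`|a p| * `|a q|) <= `|a p| ^+ 2 + `|a q| ^+ 2.
      by have := sqr_ge0 (`|a p| - `|a q|); nra.
    rewrite !real_normK ?num_real // => h.
    have := ler_wpM2l (mulr_ge0 (ltW p0) (ltW q0)) h; nra.
  apply: le_trans (_ : \sum_(p <- ps) \sum_(q <- ps) ((if p == q then z * (p%:R * a p ^+ 2) else 0) +
       (q%:R * (p%:R * a p ^+ 2) + p%:R * (q%:R * a q ^+ 2))) <= _).
    by rewrite big_seq [leRHS]big_seq; apply: ler_sum => p hp;
       rewrite big_seq [leRHS]big_seq; apply: ler_sum => q hq; exact: le1.
  have -> : \sum_(p <- ps) \sum_(q <- ps) ((if p == q then z * (p%:R * a p ^+ 2) else 0) +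
       (q%:R * (p%:R * a p ^+ 2) + p%:R * (q%:R * a q ^+ 2))) =
    z * A + (\sum_(p <- ps) p%:R) * A + (\sum_(p <- ps) p%:R) * A.
    under eq_bigr do rewrite big_split /= big_split /=.
    rewrite !big_split /= -addrA; congr (_ + (_ + _)).
    - rewrite mulr_sumr [LHS]big_seq [RHS]big_seq; apply: eq_bigr => p hp.
      by rewrite -big_mkcond /= -big_filter (eq_filter (a2 := pred1 p)) ?filter_pred1_uniq ?big_seq1 // => q /=.
    - by rewrite mulr_sumr; apply: eq_bigr => p _; rewrite mulr_suml.
    - by rewrite mulr_suml; apply: eq_bigr => p _; rewrite mulr_sumr.
  nra.
have D : \sum_(n <- upto z) u n ^+ 2 <= z.
  have /andP[_] := count_upto (ltW z0); apply: le_trans; apply: ler_sum => n _.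
  by rewrite -real_normK ?num_real // expr_le1.
(* Cauchy-Schwarz for [u] and [b], in the form of a single square with the multiplier 3 z. *)
have : 0 <= \sum_(n <- upto z) (3 * z * u n - b n) ^+ 2 by apply: sumr_ge0 => n _; apply: sqr_ge0.
have -> : \sum_(n <- upto z) (3 * z * u n - b n) ^+ 2 =
  9 * z ^+ 2 * \sum_(n <- upto z) u n ^+ 2 - 6 * z * A + \sum_(n <- upto z) b n ^+ 2.
  by rewrite EA !mulr_sumr -sumrB -big_split; apply: eq_bigr => n _ /=; ring.
move=> h.
have : 3 * z * A <= 3 * z * (3 * z ^+ 2) by nra.
by rewrite ler_pM2l //; lra.
Qed.

(** The squared modulus as a real polynomial: the norm of [R[i]] takes its values in [R[i]], and
    [normc] involves a square root. *)
Definition nsq (R : realType) (z : R[i]) : R := complex.Re z ^+ 2 + complex.Im z ^+ 2.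

Definition cis (R : realType) (t : R) : R[i] := Complex (cos t) (sin t).

Lemma nsq_ge0 (R : realType) (z : R[i]) : 0 <= nsq z.
Proof. by rewrite addr_ge0 ?sqr_ge0. Qed.

Lemma nsqM (R : realType) (a b : R[i]) : nsq (a * b) = nsq a * nsq b.
Proof. by case: a => a1 a2; case: b => b1 b2; rewrite /nsq /=; ring. Qed.

Lemma nsq1 (R : realType) : nsq (1 : R[i]) = 1.
Proof. by rewrite /nsq /=; ring. Qed.

Lemma nsq0 (R : realType) : nsq (0 : R[i]) = 0.
Proof. by rewrite /nsq /=; ring. Qed.

Lemma nsqN (R : realType) (a : R[i]) : nsq (- a) = nsq a.
Proof. by case: a => a1 a2; rewrite /nsq /=; ring. Qed.

Lemma nsq_real (R : realType) (a : R) : nsq (a%:C)%C = a ^+ 2.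
Proof. by rewrite /nsq /=; ring. Qed.

Lemma nsqX (R : realType) (a : R[i]) n : nsq (a ^+ n) = nsq a ^+ n.
Proof. by elim: n => [|n IH]; rewrite ?expr0 ?nsq1 // !exprS nsqM IH. Qed.

Lemma nsq_conj (R : realType) (a : R[i]) : nsq (a^*)%C = nsq a.
Proof. by case: a => a1 a2; rewrite /nsq /=; ring. Qed.

Lemma mul_conj_nsq (R : realType) (a : R[i]) : a * (a^*)%C = ((nsq a)%:C)%C.
Proof. by case: a => a1 a2; rewrite /nsq /=; simpc; congr (Complex _ _); ring. Qed.

Lemma normc_sqr (R : realType) (a : R[i]) : ComplexField.Normc.normc a ^+ 2 = nsq a.
Proof. by case: a => a1 a2; rewrite /nsq /= sqr_sqrtr // addr_ge0 ?sqr_ge0. Qed.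

Lemma nsqD_le (R : realType) (a b : R[i]) : nsq (a + b) <= 2 * nsq a + 2 * nsq b.
Proof.
case: a b => a1 a2 [b1 b2]; rewrite /nsq /=.
have := sqr_ge0 (a1 - b1); have := sqr_ge0 (a2 - b2); nra.
Qed.

Lemma nsqB_le (R : realType) (a b : R[i]) : nsq (a - b) <= 2 * nsq a + 2 * nsq b.
Proof. by rewrite -[nsq b]nsqN; exact: nsqD_le. Qed.

Lemma nsq_cis (R : realType) (t : R) : nsq (cis t) = 1.
Proof. by rewrite /nsq /= cos2Dsin2. Qed.

Lemma cisD (R : realType) (s t : R) : cis (s + t) = cis s * cis t.
Proof. by rewrite /cis cosD sinD; simpc; congr (Complex _ _); ring. Qed.

Lemma cis0 (R : realType) : cis (0 : R) = 1.
Proof. by rewrite /cis cos0 sin0. Qed.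

Lemma cisN (R : realType) (t : R) : cis (- t) = ((cis t)^*)%C.
Proof. by rewrite /cis cosN sinN. Qed.

Lemma cis_natmul (R : realType) (t : R) n : cis (n%:R * t) = cis t ^+ n.
Proof.
elim: n => [|n IH]; first by rewrite mul0r cis0.
by rewrite exprS -IH -cisD -natr1; congr cis; ring.
Qed.

Lemma Re_sum (R : realType) (I : Type) (r : seq I) (P : pred I) (F : I -> R[i]) :
  complex.Re (\sum_(i <- r | P i) F i) = \sum_(i <- r | P i) complex.Re (F i).
Proof. by apply: big_morph => // -[a b] [c d]. Qed.

Lemma Im_sum (R : realType) (I : Type) (r : seq I) (P : pred I) (F : I -> R[i]) :
  complex.Im (\sum_(i <- r | P i) F i) = \sum_(i <- r | P i) complex.Im (F i).
Proof. by apply: big_morph => // -[a b] [c d]. Qed.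

Lemma norm_Re_le1 (R : realType) (a : R[i]) : nsq a <= 1 -> `|complex.Re a| <= 1.
Proof.
move=> h; rewrite -(expr_le1 (n := 2)) // real_normK ?num_real //.
by apply: le_trans h; rewrite lerDl sqr_ge0.
Qed.

Lemma norm_Im_le1 (R : realType) (a : R[i]) : nsq a <= 1 -> `|complex.Im a| <= 1.
Proof.
move=> h; rewrite -(expr_le1 (n := 2)) // real_normK ?num_real //.
by apply: le_trans h; rewrite lerDr sqr_ge0.
Qed.

Definition mean (R : realType) (g : nat -> R[i]) (z : R) : R[i] :=
  ((z^-1)%:C)%C * \sum_(n <- upto z) g n.

Lemma nsq_sum_le (R : realType) (g : nat -> R[i]) (s : seq nat) :
  (forall n, nsq (g n) <= 1) -> nsq (\sum_(n <- s) g n) <= (size s)%:R ^+ 2.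
Proof.
move=> g1; elim: s => [|n s IH]; first by rewrite big_nil nsq0 sqr_ge0.
rewrite big_cons /=; move: IH (g1 n); set S := \sum_(_ <- _) _.
case: (g n) => a b; case: S => c d; rewrite /nsq /= -natr1.
set m : R := (size s)%:R => h1 h2.
have m0 : 0 <= m by rewrite ler0n.
suff : a * c + b * d <= m by nra.
have : (a * c + b * d) ^+ 2 <= m ^+ 2.
  have -> : (a * c + b * d) ^+ 2 = (a ^+ 2 + b ^+ 2) * (c ^+ 2 + d ^+ 2) - (a * d - b * c) ^+ 2 by ring.
  have := sqr_ge0 (a * d - b * c).
  have : (a ^+ 2 + b ^+ 2) * (c ^+ 2 + d ^+ 2) <= 1 * m ^+ 2.
    by apply: ler_pM => //; rewrite addr_ge0 ?sqr_ge0.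
  by lra.
by move=> h; rewrite leNgt; apply/negP => lt; nra.
Qed.

Lemma nsq_mean_le1 (R : realType) (g : nat -> R[i]) (z : R) : 0 < z ->
  (forall n, nsq (g n) <= 1) -> nsq (mean g z) <= 1.
Proof.
move=> z0 g1; rewrite nsqM nsq_real -[leRHS](@mulVf _ (z ^+ 2)) ?expf_neq0 ?gt_eqF //.
rewrite exprVn ler_pM2l ?invr_gt0 ?exprn_gt0 //.
apply: le_trans (nsq_sum_le _ g1) _; rewrite ler_sqr ?nnegrE ?ler0n ?(ltW z0) //.
by rewrite /upto size_iota truncn_le ltW.
Qed.

(** Complete multiplicativity turns the sum of g over the multiples of p into g(p) times the sum up
    to z / p. Real and imaginary parts are treated separately, whence 6 = 3 + 3. *)
Lemma turan_kubilius_mean (R : realType) (z : R) (ps : seq nat) (g : nat -> R[i]) : 0 < z ->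
  uniq ps -> all prime ps -> \sum_(p <- ps) (p%:R : R) <= z ->
  completely_multiplicative g -> (forall n, nsq (g n) <= 1) ->
  \sum_(p <- ps) (p%:R)^-1 * nsq (g p * mean g (z / p%:R) - mean g z) <= 6.
Proof.
move=> z0 ups pps sps [_ gM] g1.
have h1 := turan_kubilius_dual z0 ups pps sps (fun n => norm_Re_le1 (g1 n)).
have h2 := turan_kubilius_dual z0 ups pps sps (fun n => norm_Im_le1 (g1 n)).
have z2 : 0 < z ^+ 2 by rewrite exprn_gt0.
rewrite -(ler_pM2l z2) mulr_sumr.
apply: le_trans (_ : 3 * z ^+ 2 + 3 * z ^+ 2 <= _); last by lra.
apply: le_trans (lerD h1 h2); rewrite -big_split /=.
rewrite big_seq [leRHS]big_seq; apply: ler_sum => p hp.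
have pp := allP pps _ hp; have p0 := prime_gt0 pp.
have pR : (0 : R) < p%:R by rewrite ltr0n.
have E : g p * \sum_(m <- upto (z / p%:R)) g m - ((p%:R)^-1%:C)%C * \sum_(n <- upto z) g n
   = \sum_(n <- upto z) g n * ((((p %| n)%N%:R - (p%:R)^-1) : R)%:C)%C.
  have -> : g p * \sum_(m <- upto (z / p%:R)) g m = \sum_(n <- upto z | (p %| n)%N) g n.
    rewrite sum_upto_multiples // mulr_sumr [LHS]big_seq [RHS]big_seq.
    by apply: eq_bigr => m; rewrite mem_upto => /andP[m0 _]; rewrite gM.
  rewrite big_mkcond mulr_sumr -sumrB; apply: eq_bigr => n _.
  by case: ifP => _; rewrite rmorphB /=; ring.
have -> : g p * mean g (z / p%:R) - mean g z = ((p%:R * z^-1)%:C)%C *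
     \sum_(n <- upto z) g n * ((((p %| n)%N%:R - (p%:R)^-1) : R)%:C)%C.
  rewrite -E /mean mulrBr invfM invrK (mulrC z^-1).
  congr (_ - _); first by rewrite mulrCA.
  by rewrite mulrA -rmorphM /= mulrAC mulfV ?mul1r // gt_eqF.
rewrite nsqM nsq_real /nsq Re_sum Im_sum.
have -> : \sum_(n <- upto z) complex.Re (g n * ((((p %| n)%N%:R - (p%:R)^-1) : R)%:C)%C) =
  \sum_(n <- upto z) complex.Re (g n) * ((p %| n)%N%:R - (p%:R)^-1).
  by apply: eq_bigr => n _; case: (g n) => a b /=; ring.
have -> : \sum_(n <- upto z) complex.Im (g n * ((((p %| n)%N%:R - (p%:R)^-1) : R)%:C)%C) =
  \sum_(n <- upto z) complex.Im (g n) * ((p %| n)%N%:R - (p%:R)^-1).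
  by apply: eq_bigr => n _; case: (g n) => a b /=; ring.
rewrite le_eqVlt; apply/orP; left; apply/eqP; field.
by rewrite !gt_eqF.
Qed.

(** * Mertens estimates *)

Lemma sum_iotaS (V : nmodType) (n : nat) (P : pred nat) (F : nat -> V) :
  \sum_(i <- iota 1 n.+1 | P i) F i =
  \sum_(i <- iota 1 n | P i) F i + (if P n.+1 then F n.+1 else 0).
Proof.
rewrite -(addn1 n) iotaD big_cat; congr (_ + _).
by rewrite big_cons big_nil add1n addn1; case: (P n.+1) => //; exact: addr0.
Qed.

Lemma ln_prime_sum (R : realType) (m N : nat) : (0 < m)%N ->
  (forall p, prime p -> (p %| m)%N -> (p <= N)%N) ->
  ln (m%:R : R) = \sum_(p <- iota 1 N | prime p) (logn p m)%:R * ln p%:R.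
Proof.
move=> m0 hN; have h := widen_partn predT (leqnn m); rewrite partnT // in h.
have {}h : m = (\prod_(p <- primes m) p ^ logn p m)%N.
  by rewrite {1}(prod_prime_decomp m0) prime_decompE big_map.
rewrite {1}h natr_prod.
have -> : ln (\prod_(p <- primes m) (p ^ logn p m)%N%:R) =
  \sum_(p <- primes m) (logn p m)%:R * ln (p%:R : R).
  have : all prime (primes m) by apply/allP => p; rewrite mem_primes => /and3P[].
  elim: (primes m) => [|p s IH]; first by rewrite !big_nil ln1.
  move=> /= /andP[pp ps]; rewrite !big_cons lnM ?posrE.
  - by rewrite IH // natrX lnXn ?ltr0n ?prime_gt0 // mulr_natl.
  - by rewrite ltr0n expn_gt0 prime_gt0.
  - rewrite big_seq prodr_gt0 // => q hq.
    by rewrite ltr0n expn_gt0 prime_gt0 // (allP ps).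
rewrite [RHS](bigID (fun p => p \in primes m)) /= [X in _ = _ + X]big1 ?addr0; last first.
  move=> p /andP[pp]; rewrite mem_primes pp m0 /= => hp.
  by rewrite lognE pp m0 /= (negbTE hp) mul0r.
rewrite -[RHS]big_filter; apply: perm_big; apply: uniq_perm.
- exact: primes_uniq.
- by rewrite filter_uniq // iota_uniq.
move=> p; rewrite mem_filter mem_iota add1n ltnS mem_primes m0 /=.
case pp : (prime p) => //=; case hp: (p %| m)%N => //=.
by rewrite prime_gt0 // hN.
Qed.

Lemma prime_dvd_fact_le (p n : nat) : prime p -> (p %| n`!)%N = (p <= n)%N.
Proof.
move=> pp; apply/idP/idP; last by move=> h; rewrite dvdn_fact // prime_gt0.
elim: n => [|n IH]; first by rewrite fact0 dvdn1; case: eqP pp => // ->.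
rewrite factS Euclid_dvdM // => /orP[/dvdn_leq->//|/IH h]; exact: leqW.
Qed.

Lemma ln_fact_sum (R : realType) (n : nat) :
  ln (n`!%:R : R) = \sum_(p <- iota 1 n | prime p) (logn p n`!)%:R * ln p%:R.
Proof. by apply: ln_prime_sum; rewrite ?fact_gt0 // => p pp; rewrite prime_dvd_fact_le. Qed.

Lemma ln_nat_ge0 (R : realType) (n : nat) : 0 <= ln (n%:R : R).
Proof.
case: n => [|n]; first by rewrite ln0.
by rewrite ln_ge0 // ler1n.
Qed.

Lemma ln_fact_ge (R : realType) (n : nat) : n%:R * ln n%:R - n%:R <= ln (n`!%:R : R).
Proof.
elim: n => [|n IH]; first by rewrite mul0r subr0 fact0 ln1.
rewrite factS natrM lnM ?posrE ?ltr0n ?fact_gt0 // -natr1.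
case: n IH => [|n] IH; first by rewrite add0r fact0 ln1; lra.
set m : R := n.+1%:R in IH *.
have m0 : 0 < m by rewrite ltr0n.
have : ln (m + 1) <= ln m + m^-1.
  have -> : m + 1 = m * (1 + m^-1) by field; lra.
  rewrite lnM ?posrE // ?lerD2l ?le_ln1Dx //; first by rewrite (lt_trans _ (_ : 0 < m^-1)) ?invr_gt0 //; lra.
  by rewrite addr_gt0 ?invr_gt0.
move/(ler_wpM2l (ltW m0)); rewrite mulrDr mulfV ?gt_eqF // => h; nra.
Qed.

Lemma ln_fact_le (R : realType) (n : nat) : ln (n`!%:R : R) <= n%:R * ln n%:R.
Proof.
elim: n => [|n IH]; first by rewrite mul0r fact0 ln1.
rewrite factS natrM lnM ?posrE ?ltr0n ?fact_gt0 //.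
have : ln (n%:R : R) <= ln n.+1%:R.
  case: n {IH} => [|n]; first by rewrite ln0 // ln_nat_ge0.
  by rewrite ler_ln ?posrE ?ltr0n // ler_nat.
move/(ler_wpM2l (ler0n _ n)); rewrite -natr1; lra.
Qed.

Lemma logn_fact_le (R : realType) (p n : nat) : prime p ->
  (logn p n`!)%:R <= n%:R / (p%:R - 1) :> R.
Proof.
move=> pp; have p2 : (2 : R) <= p%:R by rewrite ler_nat prime_gt1.
rewrite logn_fact // natr_sum.
apply: le_trans (_ : \sum_(1 <= k < n.+1) n%:R * (p%:R ^+ k)^-1 <= _).
  apply: ler_sum => k _; rewrite ler_pdivlMr ?exprn_gt0 ?ltr0n ?prime_gt0 //.
  by rewrite -natrX -natrM ler_nat leq_trunc_div.
rewrite -mulr_sumr ler_wpM2l ?ler0n //.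
have -> : \sum_(1 <= k < n.+1) (p%:R ^+ k)^-1 = (1 - (p%:R ^+ n)^-1) / (p%:R - 1) :> R.
  elim: n => [|n IH]; first by rewrite big_geq // expr0 invr1 subrr mul0r.
  rewrite big_nat_recr //= IH exprS; field.
  by rewrite expf_eq0 !gt_eqF ?andbF //; lra.
rewrite ler_pdivrMr ?mulVf ?gt_eqF; try lra.
by rewrite lerBlDr lerDl invr_ge0 exprn_ge0 // ler0n.
Qed.

Lemma sum_ln_over_sq (R : realType) (n : nat) :
  \sum_(m <- iota 1 n | prime m) ln m%:R / (m%:R * (m%:R - 1)) <= 2 :> R.
Proof.
case: n => [|n]; first by rewrite /= big_nil.
(* The majorant comes from -(ln t + 2) / t, an antiderivative of (ln t + 1) / t^2; its increments
   dominate the terms. *)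
suff H : \sum_(m <- iota 1 n.+1 | prime m) ln m%:R / (m%:R * (m%:R - 1)) <=
   2 - (ln n.+1%:R + 2) / n.+1%:R :> R.
  by apply: le_trans H _; rewrite lerBlDr lerDl divr_ge0 ?ler0n // addr_ge0 ?ln_nat_ge0.
elim: n => [|n IH].
  by rewrite /= big_cons /= big_nil ln1 add0r divr1 subrr.
rewrite sum_iotaS.
set k := n.+2; set m : R := k%:R.
have m2 : 2 <= m by rewrite ler_nat.
have Em : n.+1%:R = m - 1 by rewrite /m /k -[in RHS]natr1 addrK.
rewrite Em in IH; apply: le_trans (lerD IH (_ : _ <= ln m / (m * (m - 1)))) _.
  rewrite -/k -/m; case: ifP => // _; rewrite divr_ge0 ?ln_nat_ge0 // mulr_ge0; lra.
rewrite -/k -/m.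
have m1 : 0 < m - 1 by lra.
have hl : ln (m - 1) >= ln m - (m - 1)^-1.
  have -> : ln m = ln (m - 1) + ln (1 + (m - 1)^-1).
    rewrite -lnM ?posrE //; first by congr ln; field; lra.
    by rewrite addr_gt0 ?invr_gt0.
  have : ln (1 + (m - 1)^-1) <= (m - 1)^-1.
    by rewrite le_ln1Dx // (lt_trans _ (_ : 0 < (m - 1)^-1)) ?invr_gt0 //; lra.
  lra.
rewrite -subr_ge0.
have -> : 2 - (ln m + 2) / m - (2 - (ln (m - 1) + 2) / (m - 1) + ln m / (m * (m - 1)))
  = (m * (ln (m - 1) - ln m + (m - 1)^-1) + (2 - m / (m - 1))) / (m * (m - 1)).
  by field; lra.
apply: divr_ge0; last by rewrite mulr_ge0; lra.
apply: addr_ge0; first by rewrite mulr_ge0; lra.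
rewrite subr_ge0 ler_pdivrMr; lra.
Qed.

(** Legendre's formula bounds ln n! by n times the sum of ln p / (p - 1). Replacing p - 1 by p costs
    2, and the weak Stirling bound costs 1. *)
Lemma mertens_lower (R : realType) (n : nat) : (0 < n)%N ->
  ln n%:R - 3 <= \sum_(p <- iota 1 n | prime p) ln p%:R / p%:R :> R.
Proof.
move=> n0; have nR : (0 : R) < n%:R by rewrite ltr0n.
have h1 := ln_fact_ge R n; rewrite ln_fact_sum in h1.
have h2 : \sum_(p <- iota 1 n | prime p) (logn p n`!)%:R * ln p%:R <=
  n%:R * (\sum_(p <- iota 1 n | prime p) ln p%:R / p%:R +
   \sum_(m <- iota 1 n | prime m) ln m%:R / (m%:R * (m%:R - 1))) :> R.
  rewrite -big_split mulr_sumr /=; apply: ler_sum => p pp.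
  have p2 : (2 : R) <= p%:R by rewrite ler_nat prime_gt1.
  apply: le_trans (ler_wpM2r (ln_nat_ge0 R p) (logn_fact_le R n pp)) _.
  rewrite le_eqVlt; apply/orP; left; apply/eqP; field; lra.
have h3 := sum_ln_over_sq R n.
have := le_trans h1 h2; rewrite -[X in _ - X]mulr1 -mulrBr ler_pM2l //; lra.
Qed.

(** Every prime in (m, 2m] divides the central binomial coefficient, which is at most 4^m. *)
Lemma chebyshev_theta_double (R : realType) (m : nat) :
  \sum_(p <- iota 1 m.*2 | prime p && (m < p)%N) ln p%:R <= 2 * m%:R :> R.
Proof.
pose c := 'C(m.*2, m).
have mm : (m <= m.*2)%N by rewrite -addnn leq_addr.
have c0 : (0 < c)%N by rewrite bin_gt0.
have cf : (c * (m`! * m`!) = (m.*2)`!)%N.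
  by rewrite -(bin_fact mm); congr (_ * (_ * _`!))%N; rewrite -addnn addnK.
have cle : (c <= 2 ^ m.*2)%N.
  have := expnDn 1 1 m.*2; rewrite addn1 => ->.
  have hm : (m < m.*2.+1)%N by rewrite ltnS.
  by rewrite (bigD1 (Ordinal hm)) //= !exp1n !muln1 leq_addr.
have hc : ln (c%:R : R) <= 2 * m%:R.
  apply: le_trans (_ : ln ((2 ^ m.*2)%N%:R) <= _).
    by rewrite ler_ln ?posrE ?ltr0n ?expn_gt0 // ler_nat.
  rewrite natrX lnXn // -[ln _ *+ _]mulr_natr -addnn natrD.
  have : ln 2 <= 1 :> R by rewrite -[X in ln X]/(1 + 1); apply: le_ln1Dx; lra.
  have : (0 : R) <= m%:R by rewrite ler0n.
  nra.
apply: le_trans hc; rewrite (@ln_prime_sum R c m.*2) //; last first.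
  by move=> p pp /dvdn_mulr h; rewrite -prime_dvd_fact_le // -cf h.
rewrite big_mkcondr /= big_seq_cond [leRHS]big_seq_cond; apply: ler_sum => p.
rewrite mem_iota add1n ltnS => /andP[/andP[_ p2m] pp]; case: ifP => [mp|_]; last first.
  by rewrite mulr_ge0 ?ler0n ?ln_nat_ge0.
have pc : (p %| c)%N.
  have : (p %| (m.*2)`!)%N by rewrite prime_dvd_fact_le.
  by rewrite -cf !Euclid_dvdM // !prime_dvd_fact_le // leqNgt mp !orbF.
rewrite -[leLHS]mul1r ler_wpM2r ?ln_nat_ge0 // ler1n.
by rewrite logn_gt0 mem_primes pp c0.
Qed.

(** Strong induction from n to its upper half m: the bound 6 m + 2 m with 2 m <= n + 1 stays below 6
    n as soon as n >= 2. *)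
Lemma chebyshev_theta (R : realType) (n : nat) :
  \sum_(p <- iota 1 n | prime p) ln p%:R <= 6 * n%:R :> R.
Proof.
have [k] := ubnP n; elim: k n => // k IH n; rewrite ltnS => nk.
case: n nk => [|n] nk; first by rewrite /= big_nil mulr0.
pose m := uphalf n.+1.
have h2m : (n.+1 <= m.*2)%N by rewrite /m; lia.
have mn : (m.*2 <= n.+2)%N by rewrite /m; lia.
case: n => [|n] in nk m h2m mn *.
  rewrite /= big_cons big_nil /=; lra.
have mk : (m < k)%N by move: mn nk; rewrite -/m; lia.
have := IH m mk; have := chebyshev_theta_double R m.
have -> : \sum_(p <- iota 1 m | prime p) ln p%:R = \sum_(p <- iota 1 m.*2 | prime p && ~~ (m < p)%N) ln p%:R :> R.
  rewrite -[LHS]big_filter -[RHS]big_filter; apply: perm_big; apply: uniq_perm; rewrite ?filter_uniq ?iota_uniq // => p.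
  by rewrite !mem_filter !mem_iota -leqNgt; case: (prime p) => //=; lia.
move=> h1 h3.
have : \sum_(p <- iota 1 n.+2 | prime p) ln p%:R <= \sum_(p <- iota 1 m.*2 | prime p) ln p%:R :> R.
  rewrite -(subnKC h2m) iotaD big_cat /= lerDl sumr_ge0 // => p _; exact: ln_nat_ge0.
rewrite [X in _ <= X -> _](bigID (fun p => m < p)%N) /= => h4.
have h5 : (m.*2)%:R <= n%:R + 3 :> R by rewrite -natrD ler_nat addn3.
have -> : n.+2%:R = n%:R + 2 :> R by rewrite -natrD addn2.
have : (0:R) <= n%:R by rewrite ler0n.
move: h5; rewrite -addnn natrD; lra.
Qed.

(** The valuation of n! at p is at least n / p - 1, and the total loss from the -1 is Chebyshev's
    function. *)
Lemma mertens_upper (R : realType) (n : nat) : (0 < n)%N ->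
  \sum_(p <- iota 1 n | prime p) ln p%:R / p%:R <= ln n%:R + 6 :> R.
Proof.
move=> n0; have nR : (0 : R) < n%:R by rewrite ltr0n.
have h1 := ln_fact_le R n; rewrite ln_fact_sum in h1.
have h2 := chebyshev_theta R n.
have h3 : n%:R * \sum_(p <- iota 1 n | prime p) ln p%:R / p%:R
   - \sum_(p <- iota 1 n | prime p) ln p%:R <=
   \sum_(p <- iota 1 n | prime p) (logn p n`!)%:R * ln p%:R :> R.
  rewrite mulr_sumr -sumrB big_seq_cond [leRHS]big_seq_cond; apply: ler_sum => p.
  rewrite mem_iota add1n ltnS => /andP[/andP[_ pn] pp].
  have p0 : (0 : R) < p%:R by rewrite ltr0n prime_gt0.
  have -> : n%:R * (ln p%:R / p%:R) - ln p%:R = (n%:R / p%:R - 1) * ln p%:R :> R by ring.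
  rewrite ler_wpM2r ?ln_nat_ge0 // lerBlDr natr1 ler_pdivrMr // -natrM ler_nat.
  apply: leq_trans (ltnW (ltn_ceil n (prime_gt0 pp))) _.
  rewrite leq_mul2r ltnS; apply/orP; right.
  rewrite logn_fact // (big_cat_nat (n := 2)) //= ?ltnS ?(leq_trans _ pn) ?prime_gt0 //.
  by rewrite big_nat1 expn1 leq_addr.
have h4 : n%:R * \sum_(p <- iota 1 n | prime p) ln p%:R / p%:R <= n%:R * (ln n%:R + 6) :> R.
  by rewrite mulrDr; lra.
by rewrite -(ler_pM2l nR).
Qed.

Lemma mertens (R : realType) (z : R) : 1 <= z ->
  ln z - 4 <= \sum_(p <- upto z | prime p) ln p%:R / p%:R <= ln z + 6.
Proof.
move=> z1; have z0 : 0 <= z by lra.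
have n0 : (0 < Num.truncn z)%N by rewrite truncn_gt0.
have /andP[h1 h2] := truncn_itv z0; rewrite /upto.
have hl := mertens_lower R n0; have hu := mertens_upper R n0.
set n := Num.truncn z in n0 h1 h2 hl hu *.
have nR : (0 : R) < n%:R by rewrite ltr0n.
have n1 : (1 : R) <= n%:R by rewrite ler1n.
have l1 : ln n%:R <= ln z by rewrite ler_ln ?posrE //; lra.
have l2 : ln z <= ln n%:R + 1.
  apply: le_trans (_ : ln (n%:R * 2) <= _).
    rewrite ler_ln ?posrE //; [|lra|lra].
    by move: h2; rewrite -natr1; lra.
  rewrite lnM ?posrE // lerD2l -[X in ln X]/(1 + 1); apply: le_ln1Dx; lra.
apply/andP; split; lra.
Qed.

Lemma lt_ln_expR (R : realType) (U : R) (p : nat) : (0 < p)%N ->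
  (expR U < p%:R) = (U < ln p%:R).
Proof.
by move=> p0; rewrite -[X in expR U < X]lnK ?posrE ?ltr0n // ltr_expR.
Qed.

Lemma le_ln_expR (R : realType) (U : R) (p : nat) : (0 < p)%N ->
  (p%:R <= expR U) = (ln p%:R <= U).
Proof. by move=> p0; rewrite !leNgt lt_ln_expR. Qed.

(** Mertens at both ends gives V - U up to 4 + 6 = 10 for the weight ln p / p; on the block ln p
    exceeds U here, and is at most V in the companion lower bound. *)
Lemma prime_mass_block_le (R : realType) (U V : R) : 0 < U -> U <= V ->
  \sum_(p <- upto (expR V) | prime p && (expR U < p%:R)) (p%:R)^-1 <= (V - U + 10) / U.
Proof.
move=> U0 UV; have eUV : expR U <= expR V by rewrite ler_expR.
have /andP[lU _] := mertens (z := expR U) ltac:(rewrite -expR0 ler_expR; lra).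
have /andP[_ uV] := mertens (z := expR V) ltac:(rewrite -expR0 ler_expR; lra).
rewrite !expRK in lU uV.
rewrite (sum_upto_split _ _ eUV) in uV.
rewrite ler_pdivlMr // mulr_suml.
apply: le_trans (_ : \sum_(p <- upto (expR V) | prime p && (expR U < p%:R)) ln p%:R / p%:R <= _); last by lra.
apply: ler_sum => p /andP[pp]; rewrite lt_ln_expR ?prime_gt0 // => h.
by rewrite mulrC ler_wpM2r ?invr_ge0 ?ler0n // ltW.
Qed.

Lemma prime_mass_block_ge (R : realType) (U V : R) : 0 < U -> U <= V ->
  (V - U - 10) / V <= \sum_(p <- upto (expR V) | prime p && (expR U < p%:R)) (p%:R)^-1.
Proof.
move=> U0 UV; have eUV : expR U <= expR V by rewrite ler_expR.
have /andP[_ uU] := mertens (z := expR U) ltac:(rewrite -expR0 ler_expR; lra).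
have /andP[lV _] := mertens (z := expR V) ltac:(rewrite -expR0 ler_expR; lra).
rewrite !expRK in uU lV.
rewrite (sum_upto_split _ _ eUV) in lV.
rewrite ler_pdivrMr ?(lt_le_trans U0) // mulr_suml.
apply: le_trans (_ : \sum_(p <- upto (expR V) | prime p && (expR U < p%:R)) ln p%:R / p%:R <= _); first by lra.
rewrite big_seq_cond [leRHS]big_seq_cond; apply: ler_sum => p.
rewrite mem_upto => /andP[/andP[p0 h] _].
by rewrite mulrC ler_wpM2l ?invr_ge0 ?ler0n // -le_ln_expR.
Qed.

Lemma half_le_ln2 (R : realType) : 1 / 2 <= ln 2 :> R.
Proof.
have : ln (1 + - (1 / 2)) <= - (1 / 2) :> R by apply: le_ln1Dx; lra.
have -> : 1 + - (1 / 2) = 2^-1 :> R by lra.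
rewrite lnV ?posrE //; lra.
Qed.

(** Each doubling of the range adds a block of mass at most (W + 10) / W <= 11. *)
Lemma prime_mass_pow2_le (R : realType) (U V : R) (K : nat) : 1 <= U -> V <= 2 ^+ K * U ->
  \sum_(p <- upto (expR V) | prime p && (expR U < p%:R)) (p%:R)^-1 <= 11 * K%:R :> R.
Proof.
elim: K V => [|K IH] V U1 hV.
  rewrite expr0 mul1r in hV; rewrite mulr0 big_seq_cond big_pred0 // => p.
  rewrite mem_upto; case: (ltnP 0 p) => //= p0; rewrite le_ln_expR // lt_ln_expR //.
  by apply/negbTE/negP => /and3P[h1 _ h2]; lra.
have [hV2|hV2] := leP V (2 ^+ K * U).
  by apply: le_trans (IH V U1 hV2) _; rewrite ler_wpM2l // ler_nat.
set W := 2 ^+ K * U in IH hV2.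
have W1 : 1 <= W.
  by rewrite -[1]mul1r ler_pM // exprn_ege1 // ler1n.
rewrite (sum_upto_split _ _ (_ : expR W <= expR V)); last by rewrite ler_expR ltW.
apply: le_trans (lerD (IH W U1 (lexx _)) (_ : _ <= 11)) _; last by rewrite -natr1; lra.
apply: le_trans (_ : (V - W + 10) / W <= _).
  apply: le_trans (prime_mass_block_le _ (ltW hV2)); last by lra.
  by apply: ler_sum_upto => // [n _|n /andP[/andP[-> _] ->]]; rewrite ?invr_ge0 ?ler0n.
rewrite ler_pdivrMr; last by lra.
have : V <= 2 * W by rewrite /W mulrA -exprS.
lra.
Qed.

Lemma prime_mass_le (R : realType) (U V : R) : 1 <= U -> U <= V ->
  \sum_(p <- upto (expR V) | prime p && (expR U < p%:R)) (p%:R)^-1 <= 22 * (1 + ln (V / U)).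
Proof.
move=> U1 UV; have VU : 1 <= V / U by rewrite ler_pdivlMr ?mul1r; lra.
(* As ln 2 >= 1/2, this K satisfies 2^K >= V / U. *)
pose K := (Num.truncn (2 * ln (V / U))).+1.
have l0 : 0 <= 2 * ln (V / U) by rewrite mulr_ge0 ?ln_ge0.
have /andP[k1 k2] := truncn_itv l0.
apply: le_trans (prime_mass_pow2_le (K := K) U1 _) _; last first.
  rewrite /K -natr1; lra.
rewrite -ler_pdivrMr; last by lra.
have V0 : 0 < V / U by lra.
rewrite -[leLHS]lnK ?posrE // -[leRHS]lnK ?posrE ?exprn_gt0 // ler_expR lnXn // -[_ *+ K]mulr_natr.
have := half_le_ln2 R; rewrite -/K in k2.
have K0 : 0 <= K%:R :> R by rewrite ler0n.
by move=> h; have := ler_wpM2r K0 h; lra.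
Qed.

Lemma prime_mass_all_le (R : realType) (V : R) : 1 <= V ->
  \sum_(p <- upto (expR V) | prime p) (p%:R)^-1 <= 36 * (1 + ln V) :> R.
Proof.
move=> V1; rewrite (sum_upto_split _ _ (_ : expR 1 <= expR V)) ?ler_expR //.
have := prime_mass_le (lexx 1) V1; rewrite divr1 => h.
have lV := ln_ge0 V1.
have /andP[_ u1] := mertens (z := expR 1) ltac:(rewrite -[X in X <= _]expR0 ler_expR; lra).
rewrite expRK in u1.
(* Up to e, 1 / p is at most 2 ln p / p, and Mertens gives 2 * 7. *)
apply: le_trans (lerD (_ : _ <= 14) h) _; last by lra.
apply: le_trans (_ : 2 * \sum_(p <- upto (expR 1) | prime p) ln p%:R / p%:R <= _); last by lra.
rewrite mulr_sumr; apply: ler_sum => p pp.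
rewrite mulrA -[leLHS]mul1r ler_wpM2r ?invr_ge0 ?ler0n //.
have : ln 2 <= ln p%:R :> R by rewrite ler_ln ?posrE ?ltr0n ?prime_gt0 // ler_nat prime_gt1.
by have := half_le_ln2 R; lra.
Qed.

(** * Elementary bounds for trigonometric functions and exponentials *)

Lemma sin_le_id (R : realType) (b : R) : 0 <= b -> sin b <= b.
Proof.
move=> b0.
have [|c _] := @MVT_segment R sin cos 0 b b0 (fun x _ => is_derive_sin x).
  exact/continuous_subspaceT/continuous_sin.
rewrite sin0 !subr0 => ->; have := cos_le1 c; nra.
Qed.

Lemma one_sub_cos_itv (R : realType) (b : R) : 0 <= b ->
  exists c, [/\ 0 <= c, c <= b & 1 - cos b = sin c * b].
Proof.
move=> b0.
have [|c] := @MVT_segment R cos (fun x => - sin x) 0 b b0 (fun x _ => is_derive_cos x).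
  exact/continuous_subspaceT/continuous_cos.
rewrite in_itv /= => /andP[c0 cb]; rewrite cos0 subr0 => h; exists c; split => //.
lra.
Qed.

Lemma one_sub_cos_le (R : realType) (b : R) : 1 - cos b <= `|b|.
Proof.
rewrite -cos_norm; have [c [c0 cb ->]] := one_sub_cos_itv (normr_ge0 b).
have := sin_le1 c; have := normr_ge0 b; nra.
Qed.

Lemma one_sub_cos_le_sqr (R : realType) (b : R) : 1 - cos b <= b ^+ 2.
Proof.
rewrite -cos_norm -(real_normK (num_real b)).
have [c [c0 cb ->]] := one_sub_cos_itv (normr_ge0 b).
have := sin_le_id c0; have := normr_ge0 b; nra.
Qed.

Lemma sub_sin_itv (R : realType) (b : R) : 0 <= b ->
  exists c, [/\ 0 <= c, c <= b & b - sin b = (1 - cos c) * b].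
Proof.
move=> b0.
have [|c] := @MVT_segment R sin cos 0 b b0 (fun x _ => is_derive_sin x).
  exact/continuous_subspaceT/continuous_sin.
rewrite in_itv /= => /andP[c0 cb]; rewrite sin0 !subr0 => h; exists c; split => //.
by rewrite h; ring.
Qed.

Lemma norm_sin_sub_le (R : realType) (b : R) : `|sin b - b| <= b ^+ 2.
Proof.
have H (t : R) : 0 <= t -> `|sin t - t| <= t ^+ 2.
  move=> t0; have [c [c0 ct h]] := sub_sin_itv t0.
  have := one_sub_cos_le c; have := cos_le1 c; rewrite (ger0_norm c0) => h1 h2.
  rewrite distrC h ger0_norm; last by rewrite mulr_ge0 //; lra.
  rewrite expr2 ler_wpM2r //; lra.
have [b0|b0] := leP 0 b; first exact: H.
have := H (- b); rewrite sinN sqrrN -opprD normrN; apply; lra.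
Qed.

(** Beyond 1/2 monotonicity gives sin x >= sin (1/2) >= 3/8, while x < 2. *)
Lemma sin_ge_frac (R : realType) (x : R) : 0 <= x -> x <= pi / 2 -> 3 / 16 * x <= sin x.
Proof.
have H (t : R) : 0 <= t -> t <= 1 / 2 -> 3 / 4 * t <= sin t.
  move=> t0 t1; have [c [c0 ct h]] := sub_sin_itv t0.
  have h2 := one_sub_cos_le_sqr c; have : c ^+ 2 <= 1 / 4 by nra.
  by have := cos_le1 c; nra.
move=> x0 xpi; have [xh|xh] := leP x (1 / 2); first by have := H x x0 xh; lra.
have hpi := pihalf_lt2 R; have hpi1 := pihalf_ge1 R.
have : sin (1 / 2) < sin x by rewrite ltr_sin ?in_itv /= ?xpi ?andbT //; lra.
have := H (1 / 2) ltac:(lra) ltac:(lra); lra.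
Qed.

Lemma nsq_one_sub_cis (R : realType) (t : R) : nsq (1 - cis t) = 2 * (1 - cos t).
Proof. by rewrite /nsq /=; have := cos2Dsin2 t; nra. Qed.

(** Half-angle formula. It serves to recover the size of a frequency from the distance of its
    exponential to 1. *)
Lemma nsq_one_sub_cis_ge (R : realType) (t : R) : `|t| <= pi -> t ^+ 2 / 32 <= nsq (1 - cis t).
Proof.
move=> tpi; rewrite nsq_one_sub_cis -cos_norm -(real_normK (num_real t)).
set x := `|t| in tpi *; have x0 : 0 <= x by exact: normr_ge0.
have h := sin_ge_frac (x := x / 2) ltac:(lra) ltac:(lra).
have -> : 1 - cos x = 2 * sin (x / 2) ^+ 2.
  rewrite sin2cos2 [in LHS](_ : x = (x / 2) *+ 2); last by rewrite mulr2n; lra.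
  rewrite cos_mulr2n mulr2n; ring.
nra.
Qed.

Local Notation normc := ComplexField.Normc.normc.

Lemma normc_ge0 (R : realType) (a : R[i]) : 0 <= normc a.
Proof. by case: a => x y; exact: sqrtr_ge0. Qed.

Lemma normc_real (R : realType) (a : R) : normc (a%:C)%C = `|a|.
Proof. by rewrite /= expr0n addr0 sqrtr_sqr. Qed.

Lemma normc_cis (R : realType) (t : R) : normc (cis t) = 1.
Proof. by rewrite /= cos2Dsin2 sqrtr1. Qed.

Lemma normc_sum (R : realType) (I : Type) (r : seq I) (P : pred I) (F : I -> R[i]) :
  normc (\sum_(i <- r | P i) F i) <= \sum_(i <- r | P i) normc (F i).
Proof.
apply: (big_ind2 (fun x y => normc x <= y)) => //.
  by rewrite ComplexField.Normc.normc0.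
move=> x1 x2 y1 y2 h1 h2; apply: le_trans (le_normcD _ _) _; exact: lerD.
Qed.

Lemma normc_le_ReIm (R : realType) (a : R[i]) : normc a <= `|complex.Re a| + `|complex.Im a|.
Proof.
rewrite -(ler_sqr (normc_ge0 a)) ?nnegrE ?addr_ge0 ?normr_ge0 //.
rewrite normc_sqr /nsq sqrrD !real_normK ?num_real //.
by rewrite lerD2r lerDl mulrn_wge0 // mulr_ge0 ?normr_ge0.
Qed.

Lemma normc_cis_taylor (R : realType) (b : R) : normc (cis b - 1 - Complex 0 b) <= 2 * b ^+ 2.
Proof.
apply: le_trans (normc_le_ReIm _) _; rewrite /=.
have h1 := one_sub_cos_le_sqr b; have h2 := cos_le1 b.
have h3 := norm_sin_sub_le b; rewrite !subr0.
by rewrite (ler0_norm (_ : cos b - 1 <= 0)); lra.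
Qed.

Lemma normc_cis_sub1 (R : realType) (b : R) : normc (cis b - 1) <= 2 * `|b|.
Proof.
rewrite -(ler_sqr (normc_ge0 _)) ?nnegrE ?mulr_ge0 ?normr_ge0 //.
rewrite normc_sqr -opprB nsqN nsq_one_sub_cis exprMn real_normK ?num_real //.
have := one_sub_cos_le_sqr b; have := sqr_ge0 b; lra.
Qed.

Lemma expR_taylor_neg (R : realType) (a : R) : a <= 0 -> `|expR a - 1 - a| <= a ^+ 2.
Proof.
move=> a0; have h1 := expR_ge1Dx a.
rewrite ger0_norm; last by lra.
have h2 := expR_ge1Dx (- a); rewrite expRN in h2.
have e0 := expR_gt0 a.
have : (1 - a) * expR a <= 1.
  by rewrite -ler_pdivlMr // div1r; lra.
nra.
Qed.

(** First-order expansion of the complex exponential at a + i b; [Complex a b] is the linear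
    term. *)
Lemma normc_exp_taylor (R : realType) (a b : R) : a <= 0 ->
  normc ((expR a)%:C%C * cis b - 1 - Complex a b) <= 2 * (`|a| + `|b|) ^+ 2.
Proof.
move=> a0.
have -> : (expR a)%:C%C * cis b - 1 - Complex a b =
  ((expR a - 1 - a)%:C)%C * cis b + (a%:C)%C * (cis b - 1) + (cis b - 1 - Complex 0 b).
  rewrite /cis; simpc; congr (Complex _ _); ring.
apply: le_trans (le_normcD _ _) _.
apply: le_trans (lerD (le_normcD _ _) (normc_cis_taylor b)) _.
rewrite !ComplexField.Normc.normcM !normc_real normc_cis mulr1.
have h1 := expR_taylor_neg a0.
have h2 := ler_wpM2l (normr_ge0 a) (normc_cis_sub1 b).
rewrite -[a ^+ 2](real_normK (num_real a)) in h1.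
rewrite -[b ^+ 2](real_normK (num_real b)).
have := normr_ge0 a; have := normr_ge0 b; nra.
Qed.

(** * Primes and the twists n^(it) *)

(* The term [n ^ (i t - 1 - 1 / L)] of a Dirichlet series. *)
Definition dterm (R : realType) (L t : R) (n : nat) : R[i] :=
  ((expR (- (1 + L^-1) * ln n%:R))%:C)%C * cis (t * ln n%:R).

Lemma sum_inv_sq_le (R : realType) (N : nat) : \sum_(n <- iota 1 N) (n%:R ^+ 2)^-1 <= 2 :> R.
Proof.
case: N => [|N]; first by rewrite /= big_nil.
suff : \sum_(n <- iota 1 N.+1) (n%:R ^+ 2)^-1 <= 2 - (N.+1%:R)^-1 :> R.
  by move/le_trans; apply; rewrite lerBlDr lerDl invr_ge0 ler0n.
elim: N => [|N IH]; first by rewrite /= big_cons big_nil expr1n invr1 addr0; lra.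
rewrite sum_iotaS; apply: le_trans (lerD IH (lexx _)) _.
set m : R := N.+1%:R; have m0 : 0 < m by rewrite ltr0n.
rewrite (_ : N.+2%:R = m + 1); last by rewrite /m natr1.
rewrite -subr_ge0.
have -> : 2 - (m + 1)^-1 - (2 - m^-1 + ((m + 1) ^+ 2)^-1) = (m * (m + 1) ^+ 2)^-1.
  by field; rewrite !gt_eqF //; lra.
by rewrite invr_ge0 mulr_ge0 ?sqr_ge0 // ltW.
Qed.

Lemma ln_succ_itv (R : realType) (n : nat) : (0 < n)%N ->
  [/\ (ln n.+1%:R - ln n%:R <= (n%:R)^-1 :> R),
   (n%:R)^-1 - (n%:R ^+ 2)^-1 <= ln n.+1%:R - ln n%:R :> R & 0 <= ln n.+1%:R - ln n%:R :> R].
Proof.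
move=> n0; set m : R := n%:R; have m0 : 0 < m by rewrite ltr0n.
have -> : n.+1%:R = m + 1 by rewrite natr1.
have m1 : 0 < m + 1 by lra.
rewrite -ln_div ?posrE //; split.
- have -> : (m + 1) / m = 1 + m^-1 by field; rewrite gt_eqF.
  by apply: le_ln1Dx; rewrite (lt_trans _ (_ : 0 < m^-1)) ?invr_gt0 //; lra.
- apply: le_trans (_ : (m + 1)^-1 <= _).
    rewrite -subr_ge0.
    have -> : (m + 1)^-1 - (m^-1 - (m ^+ 2)^-1) = (m ^+ 2 * (m + 1))^-1.
      by field; rewrite !gt_eqF //; lra.
    by rewrite invr_ge0 mulr_ge0 ?sqr_ge0 // ltW.
  have : ln (1 + - (m + 1)^-1) <= - (m + 1)^-1.
    by apply: le_ln1Dx; rewrite ltrN2 invf_lt1 //; lra.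
  have -> : 1 + - (m + 1)^-1 = m / (m + 1) by field; rewrite gt_eqF.
  by rewrite !ln_div ?posrE //; lra.
by rewrite ln_ge0 // ler_pdivlMr // mul1r; lra.
Qed.

(** This replaces the bound for zeta near the line of abscissa 1. With s = i t - 1 / L and [Phi n] =
    n^s, the number s n^(s-1) differs from [Phi n.+1 - Phi n] by O((1 + |t|)^2 / n^2); the
    differences telescope to at most 2, and one divides by |s| >= |t|. *)
Lemma normc_dterm_sum_le (R : realType) (L t : R) (N : nat) : 1 <= L -> t != 0 ->
  normc (\sum_(n <- iota 1 N) dterm L t n) <= 8 * (1 + `|t|) ^+ 2 / `|t|.
Proof.
move=> L1 t0; have tn0 : 0 < `|t| by rewrite normr_gt0.
pose q := 1 + `|t|; rewrite -/q; have q1 : 1 <= q by rewrite /q; lra.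
have Li : 0 <= L^-1 <= 1 by rewrite invr_ge0 invf_le1; lra.
pose s : R[i] := Complex (- L^-1) t.
pose Phi (n : nat) : R[i] := ((expR (- L^-1 * ln n%:R))%:C)%C * cis (t * ln n%:R).
have sle : normc s <= q.
  apply: le_trans (normc_le_ReIm _) _; rewrite /q /= normrN ger0_norm; lra.
have sge : `|t| <= normc s.
  rewrite -(ler_sqr (normr_ge0 _)) ?nnegrE ?normc_ge0 // normc_sqr /nsq /= real_normK ?num_real //.
  by rewrite lerDr sqr_ge0.
have Phile n : (0 < n)%N -> normc (Phi n) <= 1.
  move=> n0; rewrite ComplexField.Normc.normcM normc_real normc_cis mulr1 ger0_norm ?expR_ge0 //.
  rewrite expR_le1 mulNr oppr_le0 mulr_ge0 ?ln_nat_ge0 //; lra.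
have err n : (0 < n)%N -> normc (s * dterm L t n - (Phi n.+1 - Phi n)) <= 3 * q ^+ 2 * (n%:R ^+ 2)^-1.
  move=> n0; have nR : (0 : R) < n%:R by rewrite ltr0n.
  have [l1 l2 l3] := ln_succ_itv R n0.
  set l := ln n.+1%:R - ln n%:R in l1 l2 l3.
  have E1 : dterm L t n = ((n%:R^-1)%:C)%C * Phi n.
    rewrite /dterm /Phi mulrA -rmorphM; congr (_%:C%C * _).
    rewrite -[n%:R^-1]lnK ?posrE ?invr_gt0 // lnV ?posrE // -expRD; congr expR; ring.
  have E2 : Phi n.+1 = Phi n * (((expR (- L^-1 * l))%:C)%C * cis (t * l)).
    rewrite /Phi mulrACA -rmorphM -expRD -cisD /l; congr ((expR _)%:C%C * cis _); ring.
  have -> : s * dterm L t n - (Phi n.+1 - Phi n) = Phi n *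
     (s * ((n%:R^-1 - l)%:C)%C - (((expR (- L^-1 * l))%:C)%C * cis (t * l) - 1 - Complex (- L^-1 * l) (t * l))).
    have -> : Complex (- L^-1 * l) (t * l) = s * (l%:C)%C.
      by rewrite /s; simpc; congr (Complex _ _); ring.
    rewrite E1 E2 rmorphB /=; ring.
  rewrite ComplexField.Normc.normcM.
  apply: le_trans (ler_wpM2r (normc_ge0 _) (Phile n n0)) _; rewrite mul1r.
  apply: le_trans (le_normcD _ _) _; rewrite normcN ComplexField.Normc.normcM normc_real.
  have h1 : `|n%:R^-1 - l| <= (n%:R ^+ 2)^-1 by rewrite ger0_norm; lra.
  have h2 := normc_exp_taylor (t * l) (_ : - L^-1 * l <= 0).
  have h3 : - L^-1 * l <= 0 by rewrite mulNr oppr_le0 mulr_ge0 //; lra.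
  apply: le_trans (lerD (_ : _ <= q * (n%:R ^+ 2)^-1) (h2 h3)) _.
    by rewrite ler_pM ?normc_ge0 ?normr_ge0.
  have h4 : `|- L^-1 * l| + `|t * l| <= q * n%:R^-1.
    rewrite !normrM normrN !(ger0_norm l3) (ger0_norm (_ : 0 <= L^-1)); last by lra.
    rewrite -mulrDl ler_pM //; rewrite /q; lra.
  have h5 : (`|- L^-1 * l| + `|t * l|) ^+ 2 <= q ^+ 2 * (n%:R ^+ 2)^-1.
    rewrite -exprVn -exprMn ler_sqr ?nnegrE // ?addr_ge0 ?normr_ge0 // mulr_ge0 ?invr_ge0; lra.
  have : 0 <= (n%:R ^+ 2)^-1 :> R by rewrite invr_ge0 sqr_ge0.
  nra.
have tel : \sum_(n <- iota 1 N) (Phi n.+1 - Phi n) = Phi N.+1 - Phi 1%N.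
  elim: {err} N => [|N IH]; first by rewrite /= big_nil subrr.
  by rewrite sum_iotaS IH; ring.
have : normc (s * \sum_(n <- iota 1 N) dterm L t n) <= 8 * q ^+ 2.
  have -> : s * \sum_(n <- iota 1 N) dterm L t n =
     \sum_(n <- iota 1 N) (s * dterm L t n - (Phi n.+1 - Phi n)) + (Phi N.+1 - Phi 1%N).
    by rewrite -tel sumrB mulr_sumr subrK.
  apply: le_trans (le_normcD _ _) _.
  have h1 : normc (Phi N.+1 - Phi 1%N) <= 2.
    apply: le_trans (le_normcD _ _) _; rewrite normcN.
    by have := Phile 1%N isT; have := Phile N.+1 isT; lra.
  have h2 : normc (\sum_(n <- iota 1 N) (s * dterm L t n - (Phi n.+1 - Phi n))) <=  3 * q ^+ 2 * 2.
    apply: le_trans (normc_sum _ _ _) _.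
    apply: le_trans (_ : \sum_(n <- iota 1 N) 3 * q ^+ 2 * (n%:R ^+ 2)^-1 <= _).
      rewrite big_seq [leRHS]big_seq; apply: ler_sum => n; rewrite mem_iota => /andP[n0 _].
      exact: err.
    by rewrite -mulr_sumr ler_wpM2l ?sum_inv_sq_le // mulr_ge0 ?sqr_ge0.
  nra.
rewrite ComplexField.Normc.normcM ler_pdivlMr // => h.
by apply: le_trans h; rewrite mulrC ler_wpM2r ?normc_ge0.
Qed.

(** The integers met when expanding the Euler product over [ps] with exponents below [A]; truncating
    the exponents as well keeps every sum finite. *)
Fixpoint smooth_seq (A : nat) (ps : seq nat) : seq nat :=
  if ps is p :: ps' then [seq (p ^ a * n)%N | a <- iota 0 A, n <- smooth_seq A ps'] else [:: 1%N].

Lemma smooth_seq_gt0 (A : nat) (ps : seq nat) (n : nat) : all prime ps ->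
  n \in smooth_seq A ps -> (0 < n)%N.
Proof.
elim: ps n => [|p ps IH] n /=; first by rewrite inE => _ /eqP->.
move=> /andP[pp hps] /allpairsP[[a m] /= [_ hm ->]].
by rewrite muln_gt0 expn_gt0 prime_gt0 //= IH.
Qed.

Lemma smooth_seq_dvd (A : nat) (ps : seq nat) (n q : nat) : all prime ps ->
  n \in smooth_seq A ps -> prime q -> (q %| n)%N -> q \in ps.
Proof.
elim: ps n => [|p ps IH] n /=; first by rewrite inE => _ /eqP-> pq; rewrite dvdn1 => /eqP hq; rewrite hq in pq.
move=> /andP[pp hps] /allpairsP[[a m] /= [_ hm ->]] pq.
rewrite Euclid_dvdM // => /orP[|h]; last by rewrite inE (IH m) ?orbT.
by rewrite Euclid_dvdX // dvdn_prime2 // inE => /andP[-> _].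
Qed.

(** As p is not in the tail of the list, the valuation at p recovers its exponent. *)
Lemma smooth_seq_uniq (A : nat) (ps : seq nat) : all prime ps -> uniq ps ->
  uniq (smooth_seq A ps).
Proof.
elim: ps => [|p ps IH] //= /andP[pp hps] /andP[pn ups].
apply: allpairs_uniq; rewrite ?iota_uniq ?IH //.
move=> [a m] [b n] /allpairsP[[a' m'] /= [_ hm [-> ->]]] /allpairsP[[b' n'] /= [_ hn [-> ->]]] e.
have L k c : k \in smooth_seq A ps -> logn p (p ^ c * k) = c.
  move=> hk; rewrite lognM; [|by rewrite expn_gt0 prime_gt0|exact: smooth_seq_gt0 hps hk].
  rewrite pfactorK //.
  rewrite (_ : logn p k = 0%N) ?addn0 //; apply/eqP; rewrite -leqn0 leqNgt logn_gt0 mem_primes.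
  apply/negP => /and3P[_ _ pk]; move: pn; rewrite (smooth_seq_dvd hps hk pp pk) //.
have ab : a' = b' by rewrite -(L m' a' hm) e L.
rewrite ab in e *; congr (_, _).
by apply/eqP; rewrite -(eqn_pmul2l (m := p ^ b')) ?expn_gt0 ?prime_gt0 // e.
Qed.

Lemma smooth_seq_complete (A : nat) (ps : seq nat) (n : nat) : all prime ps -> (0 < n)%N ->
  (forall q, prime q -> (q %| n)%N -> q \in ps) -> (forall q, (logn q n < A)%N) ->
  n \in smooth_seq A ps.
Proof.
elim: ps n => [|p ps IH] n /=.
  move=> _ n0 h _; rewrite inE; case: (posnP n.-1) => [|n1]; first by case: n n0 h => [|[]].
  have : pdiv n \in [::] by apply: h; rewrite ?pdiv_prime ?pdiv_dvd //; lia.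
  by [].
move=> /andP[pp hps] n0 h hA; apply/allpairsP.
exists (logn p n, n`_p^')%N; split => /=.
- by rewrite mem_iota /= add0n.
- apply: IH => //.
  + move=> q pq hq; have := h q pq (dvdn_trans hq (dvdn_part _ _)).
    rewrite inE => /orP[/eqP qp|//]; move: hq; rewrite qp => hq.
    have hp : p \in \pi((n`_p^')%N) by rewrite mem_primes pp part_gt0 hq.
    by have := pnatPpi (part_pnat p^' n) hp; rewrite !inE eqxx.
  + move=> q; apply: leq_ltn_trans (hA q); exact: dvdn_leq_log n0 (dvdn_part _ _).
- by rewrite -p_part partnC.
Qed.

Lemma smooth_seq_prod (C : comNzRingType) (A : nat) (ps : seq nat) (u : nat -> C) :
  all prime ps -> u 1%N = 1 ->
  (forall m n : nat, (0 < m)%N -> (0 < n)%N -> u (m * n)%N = u m * u n) ->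
  \prod_(p <- ps) \sum_(0 <= a < A) u p ^+ a = \sum_(n <- smooth_seq A ps) u n.
Proof.
move=> + u1 uM; elim: ps => [|p ps IH] /=; first by rewrite big_nil big_cons big_nil addr0 u1.
move=> /andP[pp hps]; rewrite big_cons IH // big_flatten big_map /index_iota subn0 mulr_suml.
apply: eq_bigr => a _; rewrite big_map mulr_sumr [LHS]big_seq [RHS]big_seq; apply: eq_bigr => n hn.
have p0 := prime_gt0 pp.
rewrite uM ?expn_gt0 ?p0 ?(smooth_seq_gt0 hps hn) //; congr (_ * _).
by elim: a => [|a IHa]; rewrite ?expr0 ?expn0 ?u1 // exprS IHa expnS uM // expn_gt0 p0.
Qed.

Definition primes_upto (N : nat) := [seq p <- iota 1 N | prime p].

Lemma primes_upto_prime N : all prime (primes_upto N).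
Proof. exact: filter_all. Qed.

Lemma primes_upto_uniq N : uniq (primes_upto N).
Proof. by rewrite filter_uniq // iota_uniq. Qed.

(** Exponents up to N reach every n <= N, because the valuation of n at any prime is smaller than
    n. *)
Lemma euler_product_split (C : comNzRingType) (N : nat) (u : nat -> C) : u 1%N = 1 ->
  (forall m n : nat, (0 < m)%N -> (0 < n)%N -> u (m * n)%N = u m * u n) ->
  \prod_(p <- primes_upto N) \sum_(0 <= a < N.+1) u p ^+ a =
  \sum_(n <- iota 1 N) u n + \sum_(n <- smooth_seq N.+1 (primes_upto N) | (N < n)%N) u n.
Proof.
move=> u1 uM; rewrite (smooth_seq_prod _ (primes_upto_prime N) u1 uM).
rewrite (bigID (fun n => N < n)%N) /= addrC; congr (_ + _).
rewrite -big_filter; apply: perm_big; apply: uniq_perm; rewrite ?iota_uniq //.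
  by rewrite filter_uniq // smooth_seq_uniq ?primes_upto_prime ?primes_upto_uniq.
move=> n; rewrite mem_filter mem_iota add1n ltnS -leqNgt.
apply/andP/andP => [[nN hn]|[n0 nN]]; split => //.
  exact: smooth_seq_gt0 (primes_upto_prime N) hn.
apply: smooth_seq_complete => //; first exact: primes_upto_prime.
  move=> q pq hq; rewrite mem_filter pq mem_iota prime_gt0 // add1n ltnS.
  exact: leq_trans (dvdn_leq n0 hq) nN.
move=> q; rewrite ltnS; apply: leq_trans nN; apply: ltnW; exact: ltn_logl.
Qed.

Lemma dterm1 (R : realType) (L t : R) : dterm L t 1 = 1.
Proof. by rewrite /dterm ln1 !mulr0 expR0 cis0 mulr1. Qed.

Lemma dtermM (R : realType) (L t : R) (m n : nat) : (0 < m)%N -> (0 < n)%N ->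
  dterm L t (m * n) = dterm L t m * dterm L t n.
Proof.
move=> m0 n0; rewrite /dterm natrM lnM ?posrE ?ltr0n // !mulrDr expRD cisD rmorphM /=; ring.
Qed.

(** This is n^(-1 - 1/L), the modulus of [dterm L t n] for every t. *)
Definition dweight (R : realType) (L : R) (n : nat) : R := expR (- (1 + L^-1) * ln n%:R).

Lemma normc_dterm (R : realType) (L t : R) (n : nat) : normc (dterm L t n) = dweight L n.
Proof. by rewrite ComplexField.Normc.normcM normc_real normc_cis mulr1 ger0_norm ?expR_ge0. Qed.

Lemma dweight_le (R : realType) (L : R) (n : nat) : 0 < L -> (0 < n)%N -> dweight L n <= (n%:R)^-1.
Proof.
move=> L0 n0; rewrite -[leRHS]lnK ?posrE ?invr_gt0 ?ltr0n // ler_expR lnV ?posrE ?ltr0n //.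
have := ln_nat_ge0 R n => l0; have : 0 <= L^-1 * ln n%:R by rewrite mulr_ge0 // invr_ge0 ltW.
lra.
Qed.

Lemma ln_succ_ge (R : realType) (n : nat) : (0 < n)%N ->
  (n.+1%:R)^-1 <= ln n.+1%:R - ln n%:R :> R.
Proof.
move=> n0; set m : R := n%:R; have m0 : 0 < m by rewrite ltr0n.
have -> : n.+1%:R = m + 1 by rewrite natr1.
have m1 : 0 < m + 1 by lra.
have : ln (1 + - (m + 1)^-1) <= - (m + 1)^-1.
  by apply: le_ln1Dx; rewrite ltrN2 invf_lt1 //; lra.
have -> : 1 + - (m + 1)^-1 = m / (m + 1) by field; rewrite gt_eqF.
by rewrite !ln_div ?posrE //; lra.
Qed.

Lemma dweight_tail_le (R : realType) (L : R) (N : nat) (s : seq nat) : 0 < L -> (0 < N)%N ->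
  uniq s -> all (fun n => N < n)%N s ->
  \sum_(n <- s) dweight L n <= L * expR (- L^-1 * ln N%:R).
Proof.
move=> L0 N0 us hs.
have [M hM] : exists M, all (fun n => n < N.+1 + M)%N s.
  elim: s {us hs} => [|n s [M IH]]; first by exists 0%N.
  exists (maxn n M); rewrite /= (_ : n < _)%N /=; last by have := leq_maxl n M; lia.
  apply: sub_all IH => m /= hm; have := leq_maxr n M; lia.
apply: le_trans (_ : \sum_(n <- iota N.+1 M) dweight L n <= _).
  have -> : \sum_(n <- s) dweight L n = \sum_(n <- iota N.+1 M | n \in s) dweight L n.
    rewrite -[RHS]big_filter; apply: perm_big; apply: uniq_perm; rewrite ?filter_uniq ?iota_uniq //.
    move=> n; rewrite mem_filter mem_iota; case hn: (n \in s) => //=.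
    by rewrite (allP hs _ hn) (allP hM _ hn).
  by rewrite big_mkcond; apply: ler_sum => n _; case: ifP => // _; rewrite expR_ge0.
(* Comparison with the integral of t^(-1-1/L), which has the antiderivative -L t^(-1/L). *)
suff : \sum_(n <- iota N.+1 M) dweight L n <=
    L * (expR (- L^-1 * ln N%:R) - expR (- L^-1 * ln (N + M)%:R)).
  by move/le_trans; apply; rewrite ler_wpM2l ?(ltW L0) // lerBlDr lerDl expR_ge0.
elim: {s us hs hM} M => [|M IH]; first by rewrite /= big_nil addn0 subrr mulr0.
rewrite -(addn1 M) iotaD big_cat.
apply: le_trans (lerD IH (_ : _ <= dweight L (N + M).+1)) _.
  by rewrite /= big_cons big_nil addr0 addSn.
rewrite addn1 addnS.
set n := (N + M)%N; have n0 : (0 < n)%N by rewrite /n; lia.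
have := ln_succ_ge R n0; set v' := ln n.+1%:R; set v := ln n%:R => h.
have e1 : expR (- L^-1 * v) >= expR (- L^-1 * v') * (1 + L^-1 * (v' - v)).
  have -> : - L^-1 * v = - L^-1 * v' + L^-1 * (v' - v) by ring.
  by rewrite expRD ler_wpM2l ?expR_ge0 // expR_ge1Dx.
have e2 : dweight L n.+1 = expR (- L^-1 * v') * (n.+1%:R)^-1.
  rewrite /dweight -/v' -[(n.+1%:R)^-1 in RHS]lnK ?posrE ?invr_gt0 ?ltr0n // lnV ?posrE ?ltr0n //.
  by rewrite -/v' -expRD; congr expR; ring.
have e3 := ler_wpM2l (expR_ge0 (- L^-1 * v')) h.
have e4 := ler_wpM2l (ltW L0) e1.
have e5 : L * (expR (- L^-1 * v') * (1 + L^-1 * (v' - v))) = L * expR (- L^-1 * v') + expR (- L^-1 * v') * (v' - v).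
  by field; rewrite gt_eqF.
rewrite e5 in e4; rewrite e2; move: e3 e4.
set q := expR _ / _; set r := expR _ * (v' - v).
rewrite !mulrBr /=; set a := L * expR (_ * v'); set b := L * expR (_ * v) => e3 e4.
by move: q r a b e3 e4 => q r a b e3 e4; lra.
Qed.

(** The truncated Euler factor is (1 - u^A) / (1 - u). With r = |u|^2, the numerator has squared
    modulus at least (1 - r)^2 >= e^(-4r), since A >= 2, and the denominator at most e^(r - 2 Re
    u). *)
Lemma nsq_geom_ge (R : realType) (u : R[i]) (A : nat) : nsq u <= 1 / 4 -> (1 < A)%N ->
  expR (2 * complex.Re u - 5 * nsq u) <= nsq (\sum_(0 <= a < A) u ^+ a).
Proof.
move=> hu A1; set r := nsq u in hu *; have r0 : 0 <= r := nsq_ge0 u.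
have e : (1 - u) * \sum_(0 <= a < A) u ^+ a = 1 - u ^+ A.
  by rewrite big_mkord -[1 - u]opprB mulNr -subrX1 opprB.
have hA : nsq (u ^+ A) <= r ^+ 2.
  by rewrite nsqX -/r; apply: ler_wiXn2l => //; lra.
have h1 : (1 - r) ^+ 2 <= nsq (1 - u ^+ A).
  set z := u ^+ A in hA *; have m0 := normc_ge0 z.
  have m2 := normc_sqr z; set m := normc z in m0 m2.
  have mr : m <= r by rewrite -(ler_sqr m0) ?nnegrE // m2.
  apply: le_trans (_ : (1 - m) ^+ 2 <= _).
    by rewrite ler_sqr ?nnegrE; lra.
  have : `|complex.Re z| <= m.
    rewrite -(ler_sqr _ m0) ?nnegrE ?normr_ge0 // real_normK ?num_real // m2 /nsq lerDl sqr_ge0 //.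
  move/(le_trans (ler_norm _)) => hz; move: m2; rewrite /nsq /=; case: (z) hz => a b /=; nra.
have h2 : nsq (1 - u) <= expR (- (2 * complex.Re u) + r).
  apply: le_trans (expR_ge1Dx _); rewrite /r /nsq /=; case: (u) => a b /=; nra.
have h3 : expR (- (4 * r)) <= (1 - r) ^+ 2.
  rewrite expRN -[leRHS]invrK lef_pV2 ?posrE ?expR_gt0 ?invr_gt0 ?exprn_gt0; try lra.
  apply: le_trans (expR_ge1Dx _); rewrite -div1r ler_pdivrMr ?exprn_gt0; try lra.
  nra.
have := congr1 (@nsq R) e; rewrite nsqM => e'.
have h4 : expR (- (2 * complex.Re u) + r) * nsq (\sum_(0 <= a < A) u ^+ a) >= expR (- (4 * r)).
  apply: le_trans h3 _; apply: le_trans h1 _; rewrite -e'.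
  by rewrite ler_wpM2r ?nsq_ge0.
have -> : 2 * complex.Re u - 5 * r = 2 * complex.Re u - r + - (4 * r) by ring.
rewrite expRD; apply: le_trans (ler_wpM2l (expR_ge0 _) h4) _.
by rewrite mulrA -expRD (_ : _ + _ = 0) ?expR0 ?mul1r //; ring.
Qed.

(** The truncated Euler product has modulus at most B + T, B for its part n <= N and T for the
    integers beyond. Bounding its factors from below and taking a real logarithm gives the claim;
    the 5 is half of 5 times the bound 2 for the sum of p^(-2). *)
Lemma prime_dweight_sum_le (R : realType) (L t : R) (N : nat) : 1 <= L -> t != 0 -> (0 < N)%N ->
  \sum_(p <- iota 1 N | prime p) dweight L p * cos (t * ln p%:R) <=
  ln (8 * (1 + `|t|) ^+ 2 / `|t| + L * expR (- L^-1 * ln N%:R)) + 5.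
Proof.
move=> L1 t0 N0; have L0 : 0 < L by lra.
set B := 8 * _ / _; set T := L * _.
have B0 : 0 < B by rewrite divr_gt0 ?normr_gt0 // mulr_gt0 // exprn_gt0 //; have := normr_ge0 t; lra.
have T0 : 0 < T by rewrite mulr_gt0 // expR_gt0.
have := euler_product_split N (dterm1 L t) (fun m n => @dtermM R L t m n).
set V := \prod_(p <- _) _ => hV.
have VB : normc V <= B + T.
  rewrite hV; apply: le_trans (le_normcD _ _) _; apply: lerD; first exact: normc_dterm_sum_le.
  apply: le_trans (normc_sum _ _ _) _; under eq_bigr do rewrite normc_dterm.
  rewrite -big_filter; apply: dweight_tail_le => //; last exact: filter_all.
  by rewrite filter_uniq // smooth_seq_uniq ?primes_upto_prime ?primes_upto_uniq.
have VL : expR (2 * \sum_(p <- iota 1 N | prime p) dweight L p * cos (t * ln p%:R) - 10) <= normc V ^+ 2.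
  rewrite normc_sqr.
  apply: le_trans (_ : \prod_(p <- primes_upto N) expR (2 * complex.Re (dterm L t p) - 5 * nsq (dterm L t p)) <= _).
    rewrite -expR_sum ler_expR sumrB -!mulr_sumr big_filter.
    apply: lerB; first by rewrite ler_wpM2l // ler_sum // => p _; rewrite /= mul0r subr0.
    rewrite (_ : 10 = 5 * 2); last by lra.
    rewrite ler_wpM2l //; apply: le_trans (sum_inv_sq_le R N).
    rewrite big_filter big_mkcond big_seq [leRHS]big_seq; apply: ler_sum => p.
    rewrite mem_iota => /andP[p0 _]; case: ifP => _; last by rewrite invr_ge0 sqr_ge0.
    rewrite -normc_sqr normc_dterm -exprVn ler_sqr ?nnegrE ?expR_ge0 ?invr_ge0 ?ler0n //.
    exact: dweight_le.
  have nP (s : seq nat) (F : nat -> R[i]) : nsq (\prod_(p <- s) F p) = \prod_(p <- s) nsq (F p).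
    by apply: (big_morph _ (@nsqM R) (nsq1 R)).
  rewrite nP big_seq [leRHS]big_seq; apply: ler_prod => p hp; rewrite expR_ge0 andTb.
  have pp := allP (primes_upto_prime N) _ hp.
  suff hn : nsq (dterm L t p) <= 1 / 4 by exact: (nsq_geom_ge hn (N0 : (1 < N.+1)%N)).
  rewrite -normc_sqr normc_dterm.
  have h := dweight_le L0 (prime_gt0 pp).
  have h2 : (p%:R)^-1 <= 1 / 2 :> R.
    by rewrite div1r lef_pV2 ?posrE ?ltr0n ?prime_gt0 // ler_nat prime_gt1.
  have h3 : 0 <= dweight L p by rewrite expR_ge0.
  nra.
have VV : 0 < normc V.
  rewrite lt_neqAle normc_ge0 andbT; apply: contraTneq VL => <-.
  by rewrite expr0n /= -ltNge expR_gt0.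
have : expR (2 * \sum_(p <- iota 1 N | prime p) dweight L p * cos (t * ln p%:R) - 10) <= (B + T) ^+ 2.
  apply: le_trans VL _; rewrite ler_sqr ?nnegrE //; lra.
have BT : 0 < B + T by lra.
rewrite -[X in _ <= X ^+ 2]lnK ?posrE // -expRM_natl ler_expR; lra.
Qed.

Lemma sum_inv_ge_ln (R : realType) (N : nat) : ln N.+1%:R <= \sum_(n <- iota 1 N) (n%:R)^-1 :> R.
Proof.
elim: N => [|N IH]; first by rewrite /= big_nil ln1.
rewrite sum_iotaS /=; apply: le_trans (lerD IH (lexx _)).
by have [h _ _] := ln_succ_itv R (ltn0Sn N); rewrite -lerBlDl.
Qed.

(** The Euler product at t = 0 exceeds the sum over n <= e^L, where n^(-1/L) >= 1/e, hence L / e;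
    its factors 1 / (1 - w) are at most e^(w + 2 w^2). *)
Lemma prime_dweight_sum_ge (R : realType) (L : R) (N : nat) : 1 <= L -> expR L < N.+1%:R ->
  ln L - 5 <= \sum_(p <- iota 1 N | prime p) dweight L p.
Proof.
move=> L1 hN; have L0 : 0 < L by lra.
have d1 : dweight L 1 = 1 by rewrite /dweight ln1 mulr0 expR0.
have dM (m n : nat) : (0 < m)%N -> (0 < n)%N -> dweight L (m * n) = dweight L m * dweight L n.
  by move=> m0 n0; rewrite /dweight natrM lnM ?posrE ?ltr0n // !mulrDr expRD.
have := euler_product_split N d1 dM.
set V := \prod_(p <- _) _ => hV.
have VU : V <= expR (\sum_(p <- iota 1 N | prime p) dweight L p + 4).
  apply: le_trans (_ : \prod_(p <- primes_upto N) expR (dweight L p + 2 * dweight L p ^+ 2) <= _).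
    rewrite /V big_seq [leRHS]big_seq; apply: ler_prod => p hp.
    have pp := allP (primes_upto_prime N) _ hp.
    have h := dweight_le L0 (prime_gt0 pp).
    have h2 : (p%:R)^-1 <= 1 / 2 :> R.
      by rewrite div1r lef_pV2 ?posrE ?ltr0n ?prime_gt0 // ler_nat prime_gt1.
    have h3 : 0 <= dweight L p by rewrite expR_ge0.
    apply/andP; split; first by apply: sumr_ge0 => a _; rewrite exprn_ge0.
    set w := dweight L p in h h3 *.
    have e : (1 - w) * \sum_(0 <= a < N.+1) w ^+ a = 1 - w ^+ N.+1.
      by rewrite big_mkord -[1 - w]opprB mulNr -subrX1 opprB.
    have e2 : 1 <= (1 - w) * expR (w + 2 * w ^+ 2).
      apply: le_trans (ler_wpM2l (_ : 0 <= 1 - w) (expR_ge1Dx _)); nra.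
    have e3 : 0 <= w ^+ N.+1 by rewrite exprn_ge0.
    rewrite -(ler_pM2l (_ : 0 < 1 - w)); last by lra.
    rewrite e; lra.
  rewrite -expR_sum ler_expR big_split /= big_filter lerD2l -mulr_sumr.
  rewrite (_ : 4 = 2 * 2); last by lra.
  rewrite ler_wpM2l //; apply: le_trans (sum_inv_sq_le R N).
  rewrite big_filter big_mkcond big_seq [leRHS]big_seq; apply: ler_sum => p.
  rewrite mem_iota => /andP[p0 _]; case: ifP => _; last by rewrite invr_ge0 sqr_ge0.
  rewrite -exprVn ler_sqr ?nnegrE ?expR_ge0 ?invr_ge0 ?ler0n //.
  exact: dweight_le.
have VL : expR (ln L - 1) <= V.
  have e0 := expR_gt0 (- 1 : R).
  rewrite expRD lnK ?posrE //.
  have n0 : (0 <= expR L) by rewrite expR_ge0.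
  have /andP[k1 k2] := truncn_itv n0.
  apply: le_trans (_ : \sum_(n <- upto (expR L)) dweight L n <= _); last first.
    rewrite hV -[leLHS]addr0; apply: lerD; last by apply: sumr_ge0 => n _; rewrite expR_ge0.
    have kN : (Num.truncn (expR L) <= N)%N by rewrite truncn_le_nat.
    rewrite /upto -(subnKC kN) iotaD big_cat lerDl; apply: sumr_ge0 => n _; exact: expR_ge0.
  apply: le_trans (_ : \sum_(n <- upto (expR L)) (n%:R)^-1 * expR (- 1) <= _).
    rewrite -mulr_suml ler_pM2r //; apply: le_trans (sum_inv_ge_ln R _).
    by rewrite -[leLHS]expRK ler_ln ?posrE ?expR_gt0 ?ltr0n // ltW.
  rewrite big_seq [leRHS]big_seq; apply: ler_sum => n; rewrite mem_upto => /andP[n1].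
  rewrite le_ln_expR // => hn.
  rewrite -[X in X * _]lnK ?posrE ?invr_gt0 ?ltr0n // lnV ?posrE ?ltr0n // -expRD ler_expR.
  have : L^-1 * ln n%:R <= 1 by rewrite mulrC ler_pdivrMr // mul1r.
  lra.
have := le_trans VL VU; rewrite ler_expR; lra.
Qed.

(** The block of primes with ln p between j L and (j + 1) L has mass at most 11 and is damped by
    e^(-j) <= 2^(-j); the right-hand side is the geometric sum in closed form, as the induction
    needs. *)
Lemma prime_dweight_tail_le (R : realType) (L : R) (k : nat) : 1 <= L ->
  \sum_(p <- upto (expR (k.+1%:R * L)) | prime p && (expR L < p%:R)) dweight L p <=
  22 * (1 - (2 ^+ k.+1)^-1).
Proof.
move=> L1; have L0 : 0 < L by lra.
elim: k => [|k IH].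
  rewrite big_seq_cond big_pred0; first by rewrite expr1; lra.
  move=> p; rewrite mem_upto mul1r leNgt.
  by case: (expR L < p%:R); rewrite ?andbF.
set j : R := k.+1%:R in IH *.
have j1 : 1 <= j by rewrite ler1n.
have -> : k.+2%:R = j + 1 by rewrite natr1.
have le1 : j * L <= (j + 1) * L by rewrite ler_wpM2r; lra.
rewrite (sum_upto_split _ _ (_ : expR (j * L) <= expR ((j + 1) * L))) ?ler_expR //.
suff H : \sum_(n <- upto (expR ((j + 1) * L)) | prime n && (expR L < n%:R) && (expR (j * L) < n%:R)) dweight L n
   <= 11 * (2 ^+ k.+1)^-1.
  apply: le_trans (lerD IH H) _; rewrite [2 ^+ k.+2]exprS invfM; lra.
have jL : 0 < j * L by rewrite mulr_gt0 //; lra.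
have B : \sum_(n <- upto (expR ((j + 1) * L)) | prime n && (expR (j * L) < n%:R)) (n%:R)^-1 <= 11 :> R.
  apply: le_trans (prime_mass_block_le jL le1) _.
  rewrite ler_pdivrMr //; nra.
have E2 : expR (- j) <= (2 ^+ k.+1)^-1.
  rewrite expRN lef_pV2 ?posrE ?expR_gt0 ?exprn_gt0 //.
  rewrite -[j]mulr1 expRM_natl; apply: lerXn2r; rewrite ?nnegrE ?expR_ge0 //.
  by have := expR_ge1Dx (1 : R); lra.
have i0 : 0 <= (2 ^+ k.+1)^-1 :> R by rewrite invr_ge0 exprn_ge0.
apply: le_trans (ler_wpM2r i0 B).
rewrite mulr_suml.
apply: le_trans (_ : \sum_(n <- upto (expR ((j + 1) * L)) | prime n && (expR (j * L) < n%:R)) dweight L n <= _).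
  apply: ler_sum_upto => // [n _|n]; first exact: expR_ge0.
  by move=> /andP[/andP[-> _] ->].
apply: ler_sum => p /andP[pp]; rewrite lt_ln_expR ?prime_gt0 // => hp.
have p0 : (0 : R) < p%:R by rewrite ltr0n prime_gt0.
apply: le_trans (_ : (p%:R)^-1 * expR (- j) <= _); last by rewrite ler_wpM2l // invr_ge0 ltW.
rewrite -[X in X * _]lnK ?posrE ?invr_gt0 // lnV ?posrE // -expRD ler_expR.
have : j <= L^-1 * ln p%:R by rewrite mulrC ler_pdivlMr // ltW.
lra.
Qed.

(** The two preceding estimates are for the smooth weight p^(-1-1/L). It is at most 1 / p up to e^L,
    and the primes beyond contribute at most 44; 54 is 44 plus the errors 5 + 5. *)
Lemma prime_cos_sum_ge (R : realType) (L t : R) : 1 <= L -> t != 0 ->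
  ln L - ln (8 * (1 + `|t|) ^+ 2 / `|t| + 2) - 54 <=
  \sum_(p <- upto (expR L) | prime p) (1 - cos (t * ln p%:R)) / p%:R.
Proof.
move=> L1 t0; have L0 : 0 < L by lra.
(* The product is cut at e^X with X at least L (L + 1), so that the tail L N^(-1/L) is at most L
   e^(-L). *)
pose k := (Num.truncn L).+1.
have /andP[_ hk] := truncn_itv (ltW L0); rewrite -/k in hk.
pose X := k.+1%:R * L.
have kL : L + 1 <= k.+1%:R by rewrite -natr1; lra.
have LX : L <= X by rewrite /X -[leLHS]mul1r ler_wpM2r; lra.
pose N := Num.truncn (expR X).
have eX1 : 1 <= expR X by have := expR_ge1Dx X; lra.
have N0 : (0 < N)%N by rewrite truncn_gt0.
have /andP[N1 N2] := truncn_itv (expR_ge0 X); rewrite -/N in N1 N2.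
have NR : (0 : R) < N%:R by rewrite ltr0n.
have NR1 : (1 : R) <= N%:R by rewrite ler1n.
have h1 := prime_dweight_sum_le L1 t0 N0.
have h2 : ln L - 5 <= \sum_(p <- iota 1 N | prime p) dweight L p.
  by apply: prime_dweight_sum_ge => //; apply: le_lt_trans N2; rewrite ler_expR.
have h3 := prime_dweight_tail_le k L1; rewrite -/X in h3.
have T2 : L * expR (- L^-1 * ln N%:R) <= 2.
  have hN : X - 1 <= ln N%:R.
    have : expR X <= N%:R * 2 by apply: le_trans (ltW N2) _; rewrite -natr1; lra.
    rewrite -ler_ln ?posrE ?expR_gt0 ?mulr_gt0 // expRK lnM ?posrE // => h.
    have : ln (1 + 1) <= 1 :> R by apply: le_ln1Dx; lra.
    rewrite (_ : 1 + 1 = 2); last by lra.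
    lra.
  have h : L <= L^-1 * ln N%:R.
    rewrite mulrC ler_pdivlMr //; rewrite /X in hN; nra.
  have : expR (- L^-1 * ln N%:R) <= expR (- L) by rewrite ler_expR; lra.
  move/(ler_wpM2l (ltW L0))/le_trans; apply; rewrite expRN ler_pdivrMr ?expR_gt0 //.
  by have := expR_ge1Dx L; lra.
set B := 8 * _ / _ in h1 *.
have B0 : 0 < B by rewrite divr_gt0 ?normr_gt0 // mulr_gt0 // exprn_gt0 //; have := normr_ge0 t; lra.
have h4 : ln (B + L * expR (- L^-1 * ln N%:R)) <= ln (B + 2).
  rewrite ler_ln ?posrE ?lerD2l //; last by lra.
  by rewrite addr_gt0 // mulr_gt0 // expR_gt0.
have h5 : \sum_(p <- iota 1 N | prime p) dweight L p * (1 - cos (t * ln p%:R)) >=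
  ln L - ln (B + 2) - 10.
  under eq_bigr do rewrite mulrBr mulr1.
  rewrite sumrB; set S1 := \sum_(p <- _ | _) _ in h2 *; set S2 := \sum_(p <- _ | _) _ in h1 *.
  by move: S1 S2 h1 h2 h4 => S1 S2 h1 h2 h4; lra.
rewrite -/(upto (expR X)) in h5.
rewrite (sum_upto_split _ _ (_ : expR L <= expR X)) ?ler_expR // in h5.
have h6 : \sum_(p <- upto (expR L) | prime p) dweight L p * (1 - cos (t * ln p%:R)) <=
   \sum_(p <- upto (expR L) | prime p) (1 - cos (t * ln p%:R)) / p%:R.
  apply: ler_sum => p pp; rewrite mulrC ler_wpM2l //; first by rewrite subr_ge0 cos_le1.
  by apply: dweight_le => //; exact: prime_gt0.
have h7 : \sum_(n <- upto (expR X) | prime n && (expR L < n%:R)) dweight L n * (1 - cos (t * ln n%:R)) <= 44.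
  apply: le_trans (_ : \sum_(n <- upto (expR X) | prime n && (expR L < n%:R)) dweight L n * 2 <= _).
    apply: ler_sum => p _; rewrite ler_wpM2l ?expR_ge0 //.
    by have := cos_geN1 (t * ln p%:R); lra.
  rewrite -mulr_suml; move: h3; set S := \sum_(n <- _ | _) _ => h3.
  have : 0 <= (2 ^+ k.+1)^-1 :> R by rewrite invr_ge0 exprn_ge0.
  by move: S h3 => S h3; lra.
move: h5 h6 h7; set S1 := \sum_(p <- _ | _) _; set S2 := \sum_(p <- _ | _) _; set S3 := \sum_(p <- _ | _) _.
by move: S1 S2 S3 => S1 S2 S3 h5 h6 h7; rewrite /= in h5; lra.
Qed.

(** * The Halász-type theorem *)

Lemma cos_eq1_small (R : realType) (t : R) : `|t| < pi *+ 2 -> cos t = 1 -> t = 0.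
Proof.
move=> ht ct; apply/eqP; rewrite -normr_eq0; apply/eqP.
have ct' : cos `|t| = 1 by rewrite cos_norm.
set x := `|t| in ht ct' *; have x0 : 0 <= x by exact: normr_ge0.
rewrite mulr2n in ht; have p0 := pi_gt0 R.
have [xp|xp] := leP x pi.
  have := nsq_one_sub_cis_ge (t := x); rewrite ger0_norm // => /(_ xp).
  rewrite nsq_one_sub_cis ct' subrr mulr0 => h; nra.
have := nsq_one_sub_cis_ge (t := x - pi *+ 2).
rewrite ler0_norm mulr2n; last by lra.
have -> : - (x - (pi + pi)) <= pi by lra.
move=> /(_ isT); rewrite nsq_one_sub_cis.
have -> : cos (x - (pi + pi)) = 1.
  by rewrite -(cosD2pi (x - (pi + pi))) mulr2n subrK.
by rewrite subrr mulr0 => h; nra.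
Qed.

(** Orthogonality of the characters of Z/N: the ratio of the geometric sum is not 1 because its
    angle is nonzero and below 2 pi in absolute value. *)
Lemma cis_root_sum (R : realType) (N : nat) (i j : 'I_N) : i != j ->
  \sum_(k < N) cis (pi *+ 2 * (i%:R - j%:R) / N%:R * k%:R : R) = 0.
Proof.
move=> ij; have N0 : (0 < N)%N by apply: leq_ltn_trans (ltn_ord i).
have NR : (0 : R) < N%:R by rewrite ltr0n.
set th := pi *+ 2 * (i%:R - j%:R) / N%:R.
under eq_bigr do rewrite mulrC cis_natmul.
have z1 : cis th != 1.
  apply/eqP => h; have c1 : cos th = 1 by have := congr1 (@complex.Re R) h.
  have p0 : 0 < pi *+ 2 :> R by rewrite pmulrn_rgt0 // pi_gt0.
  have hd : `|i%:R - j%:R| < N%:R :> R.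
    rewrite ltr_norml; have := ltn_ord i; have := ltn_ord j.
    rewrite -!(ltr_nat R) => h1 h2; have := ler0n R i; have := ler0n R j.
    by move=> h3 h4; apply/andP; split; lra.
  have : th = 0.
    apply: cos_eq1_small c1; rewrite /th !normrM normfV (gtr0_norm p0) (gtr0_norm NR).
    by rewrite ltr_pdivrMr // ltr_pM2l.
  move/eqP; rewrite /th !mulf_eq0 invr_eq0 (gt_eqF NR) (gt_eqF p0) orbF /= subr_eq0 eqr_nat.
  by move=> /eqP e; move/eqP: ij; apply; apply: val_inj.
have zN : cis th ^+ N = 1.
  rewrite -cis_natmul /th mulrC divfK ?gt_eqF //.
  have per (n : nat) : cis (pi *+ 2 * n%:R : R) = 1.
    rewrite mulrC cis_natmul /cis cos2pi sin2pi.
    by rewrite (_ : Complex 1 0 = 1) // expr1n.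
  by rewrite mulrBr cisD per mul1r cisN per conjc1.
have : (cis th - 1) * \sum_(k < N) cis th ^+ k = 0 by rewrite -subrX1 zN subrr.
by move/eqP; rewrite mulf_eq0 subr_eq0 (negbTE z1) => /eqP.
Qed.

Lemma conjM_cis (R : realType) (a : R[i]) (t : R) : ((a * cis t)^*)%C = (a^*)%C * cis (- t).
Proof. by rewrite cisN; exact: rmorphM. Qed.

Definition dft (R : realType) (N : nat) (F : nat -> R[i]) (k : nat) : R[i] :=
  \sum_(j < N) F j * cis (pi *+ 2 * j%:R / N%:R * k%:R).

Lemma dft_parseval (R : realType) (N : nat) (F : nat -> R[i]) :
  \sum_(k < N) nsq (dft N F k) = N%:R * \sum_(j < N) nsq (F j).
Proof.
apply: complexI; rewrite rmorphM rmorph_nat !rmorph_sum /=.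
under eq_bigr => k _.
  rewrite -mul_conj_nsq /dft rmorph_sum mulr_suml.
  under eq_bigr => j _ do rewrite mulr_sumr.
  over.
rewrite exchange_big mulr_sumr /=; apply: eq_bigr => i _.
rewrite exchange_big /= (bigD1 i) //= [X in _ + X]big1 ?addr0.
  under eq_bigr => k _.
    rewrite conjM_cis mulrACA -cisD subrr cis0 mulr1 mul_conj_nsq.
    over.
  by rewrite sumr_const card_ord mulr_natl.
move=> j ji.
under eq_bigr => k _.
  rewrite conjM_cis mulrACA -cisD.
  rewrite (_ : _ - _ = pi *+ 2 * (i%:R - j%:R) / N%:R * k%:R); last by ring.
  over.
by rewrite -mulr_sumr cis_root_sum ?mulr0 // eq_sym.
Qed.

(** A cyclic shift multiplies the transform by the inverse of the unimodular w, and w (w^(-1) - g) =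
    1 - g w. *)
Lemma dft_shift (R : realType) (N s : nat) (F : nat -> R[i]) (g : R[i]) (k : nat) : (0 < N)%N ->
  nsq (dft N (fun j => F ((j + s) %% N)%N - g * F j) k) =
  nsq (1 - g * cis (pi *+ 2 * s%:R / N%:R * k%:R)) * nsq (dft N F k).
Proof.
move=> N0; have NR : (N%:R : R) != 0 by rewrite pnatr_eq0 -lt0n.
have per (n : nat) : cis (pi *+ 2 * n%:R : R) = 1.
  rewrite mulrC cis_natmul /cis cos2pi sin2pi.
  by rewrite (_ : Complex 1 0 = 1) // expr1n.
pose w : R[i] := cis (pi *+ 2 * s%:R / N%:R * k%:R).
have E1 : w * dft N (fun j => F ((j + s) %% N)%N) k = dft N F k.
  pose h (j : 'I_N) : 'I_N := Ordinal (ltn_pmod (j + s) N0).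
  have hinj : injective h.
    move=> a b /(congr1 val) /= e; apply: val_inj => /=.
    have := ltn_ord a; have := ltn_ord b => hb ha.
    by have /eqP := e; rewrite eqn_modDr !modn_small // => /eqP.
  rewrite /dft [RHS](reindex_inj hinj) /= mulr_sumr; apply: eq_bigr => j _.
  rewrite mulrCA -cisD; congr (_ * _).
  have -> : pi *+ 2 * s%:R / N%:R * k%:R + pi *+ 2 * j%:R / N%:R * k%:R =
     pi *+ 2 * ((j + s) %% N)%N%:R / N%:R * k%:R + pi *+ 2 * ((j + s) %/ N * k)%N%:R :> R.
    have : (j + s)%N%:R = ((j + s) %/ N)%N%:R * N%:R + ((j + s) %% N)%N%:R :> R.
      by rewrite -natrM -natrD -divn_eq.
    rewrite natrD natrM => e; have -> : s%:R = ((j + s) %/ N)%N%:R * N%:R + ((j + s) %% N)%N%:R - j%:R :> R.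
      by rewrite -e addrC addKr.
    by field.
  by rewrite cisD per mulr1.
have E2 : dft N (fun j => F ((j + s) %% N)%N - g * F j) k =
   dft N (fun j => F ((j + s) %% N)%N) k - g * dft N F k.
  rewrite /dft mulr_sumr -sumrB; apply: eq_bigr => j _; ring.
have w1 : nsq w = 1 by rewrite nsq_cis.
have -> : nsq (dft N (fun j => F ((j + s) %% N)%N - g * F j) k) =
  nsq (w * dft N (fun j => F ((j + s) %% N)%N - g * F j) k) by rewrite nsqM w1 mul1r.
rewrite E2 mulrBr E1 -nsqM; congr nsq.
rewrite -/w; ring.
Qed.

(* By Parseval the right-hand side is an average over the frequencies [k], with weights
   [nsq (dft N F k)]; some frequency does no worse than the average. *)
Lemma dft_frequency (R : realType) (N : nat) (F : nat -> R[i]) (I : Type) (r : seq I)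
    (P : pred I) (c : I -> R) (g : I -> R[i]) (s : I -> nat) : (0 < N)%N ->
  exists2 k, (k < N)%N &
  (\sum_(j < N) nsq (F j)) *
    (\sum_(i <- r | P i) c i * nsq (1 - g i * cis (pi *+ 2 * (s i)%:R / N%:R * k%:R)))
  <= \sum_(i <- r | P i) c i * \sum_(j < N) nsq (F ((j + s i) %% N)%N - g i * F j).
Proof.
move=> N0; set E := \sum_(j < N) nsq (F j); set D := \sum_(i <- r | P i) c i * \sum_(j < N) _.
pose v k := \sum_(i <- r | P i) c i * nsq (1 - g i * cis (pi *+ 2 * (s i)%:R / N%:R * k%:R)).
have NR : (0 : R) < N%:R by rewrite ltr0n.
have ED : \sum_(k < N) nsq (dft N F k) * v k = N%:R * D.
  rewrite /v /D mulr_sumr; under eq_bigr do rewrite mulr_sumr.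
  rewrite exchange_big /=; apply: eq_bigr => i _.
  rewrite [RHS]mulrCA -(dft_parseval N (fun j => F ((j + s i) %% N)%N - g i * F j)) mulr_sumr.
  apply: eq_bigr => k _.
  by rewrite dft_shift //; ring.
have EE : \sum_(k < N) nsq (dft N F k) = N%:R * E by rewrite dft_parseval.
have E0 : 0 <= E by apply: sumr_ge0 => j _; exact: nsq_ge0.
apply: contrapT => H.
have H2 (k : 'I_N) : D < E * v k.
  by rewrite ltNge; apply/negP => h; apply: H; exists k => //; exact: ltn_ord.
have [Ez|Ep] := eqVneq E 0.
  have z (k : 'I_N) : nsq (dft N F k) = 0.
    apply/eqP; rewrite eq_le nsq_ge0 andbT.
    move: EE; rewrite Ez mulr0 => e; rewrite -e (bigD1 k) //= lerDl.
    by apply: sumr_ge0 => j _; exact: nsq_ge0.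
  have := H2 (Ordinal N0); rewrite Ez mul0r => D0.
  move: ED; rewrite big1 => [e|k _]; last by rewrite z mul0r.
  by move: D0; rewrite -(pmulr_rlt0 _ NR) -e ltxx.
have Epos : 0 < E by rewrite lt_neqAle eq_sym Ep.
have Z : \sum_(k < N) nsq (dft N F k) * (E * v k - D) = 0.
  under eq_bigr do rewrite mulrBr mulrCA.
  rewrite sumrB -mulr_sumr -mulr_suml ED EE; ring.
have z (k : 'I_N) : nsq (dft N F k) = 0.
  have h : 0 < E * v k - D by rewrite subr_gt0.
  have h2 (i : 'I_N) : true -> 0 <= nsq (dft N F i) * (E * v i - D).
    by move=> _; rewrite mulr_ge0 ?nsq_ge0 // subr_ge0 ltW.
  have /eqP := psumr_eq0P h2 Z (i := k) isT.
  by rewrite mulf_eq0 (gt_eqF h) orbF => /eqP.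
move: EE; rewrite big1 => [e|k _]; last exact: z.
by have := mulr_gt0 NR Epos; rewrite -e ltxx.
Qed.

(** The condition 2 U <= t makes the sum of the primes up to e^U at most e^(2U) <= e^t. *)
Lemma turan_kubilius_exp (R : realType) (g : nat -> R[i]) (t U : R) :
  completely_multiplicative g -> (forall n, nsq (g n) <= 1) -> 0 <= U -> 2 * U <= t ->
  \sum_(p <- upto (expR U) | prime p)
    (p%:R)^-1 * nsq (g p * mean g (expR (t - ln p%:R)) - mean g (expR t)) <= 6.
Proof.
move=> gM g1 U0 Ut; rewrite -big_filter.
set ps := [seq p <- _ | _].
have pps : all prime ps by exact: filter_all.
have ups : uniq ps by rewrite filter_uniq // uniq_upto.
have sps : \sum_(p <- ps) (p%:R : R) <= expR t.
  apply: le_trans (_ : \sum_(p <- upto (expR U)) expR U <= _).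
    rewrite /ps big_filter big_mkcond big_seq [leRHS]big_seq; apply: ler_sum => p.
    by rewrite mem_upto => /andP[_ h]; case: ifP => _ //; rewrite expR_ge0.
  have /andP[_] := count_upto (expR_ge0 U).
  have -> : \sum_(p <- upto (expR U)) expR U = expR U * \sum_(p <- upto (expR U)) 1.
    by rewrite mulr_sumr; apply: eq_bigr => p _; rewrite mulr1.
  move=> h; apply: le_trans (ler_wpM2l (expR_ge0 U) h) _.
  rewrite -expRD ler_expR; lra.
apply: le_trans (turan_kubilius_mean (expR_gt0 t) ups pps sps gM g1).
rewrite le_eqVlt; apply/orP; left; apply/eqP; rewrite [LHS]big_seq [RHS]big_seq; apply: eq_bigr => p hp.
have p0 := prime_gt0 (allP pps _ hp).
by rewrite expRB lnK ?posrE ?ltr0n.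
Qed.

Lemma nsq_le1_normc (R : realType) (a : R[i]) : (nsq a <= 1) = (normc a <= 1).
Proof. by rewrite -normc_sqr expr_le1 // normc_ge0. Qed.

Lemma normc_mean_le1 (R : realType) (g : nat -> R[i]) (z : R) : 0 < z ->
  (forall n, nsq (g n) <= 1) -> normc (mean g z) <= 1.
Proof. by move=> z0 g1; rewrite -nsq_le1_normc nsq_mean_le1. Qed.

(** On the logarithmic scale a mean is Lipschitz, up to e^(-t') for the rounding of one integer. *)
Lemma mean_lipschitz (R : realType) (g : nat -> R[i]) (t t' : R) : t <= t' ->
  (forall n, nsq (g n) <= 1) ->
  normc (mean g (expR t') - mean g (expR t)) <= 2 * (t' - t) + expR (- t').
Proof.
move=> tt g1; set z := expR t; set z' := expR t'.
have z0 : 0 < z := expR_gt0 t; have z0' : 0 < z' := expR_gt0 t'.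
have zz : z <= z' by rewrite ler_expR.
have g1' n : normc (g n) <= 1 by rewrite -nsq_le1_normc.
have -> : mean g z' - mean g z = ((z'^-1)%:C)%C * \sum_(n <- upto z' | z < n%:R) g n
   + ((z'^-1 - z^-1)%:C)%C * \sum_(n <- upto z) g n.
  by rewrite /mean (sum_upto_split _ _ zz) rmorphB /=; ring.
apply: le_trans (le_normcD _ _) _; rewrite !ComplexField.Normc.normcM !normc_real.
rewrite (ger0_norm (_ : 0 <= z'^-1)); last by rewrite invr_ge0 ltW.
have zV : z'^-1 <= z^-1 by rewrite lef_pV2.
rewrite (ler0_norm (_ : z'^-1 - z^-1 <= 0)); last by lra.
have h1 : normc (\sum_(n <- upto z) g n) <= z.
  apply: le_trans (normc_sum _ _ _) _; have /andP[_] := count_upto (ltW z0).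
  by apply: le_trans; apply: ler_sum.
have h2 : normc (\sum_(n <- upto z' | z < n%:R) g n) <= z' - z + 1.
  apply: le_trans (normc_sum _ _ _) _.
  apply: le_trans (_ : \sum_(n <- upto z' | z < n%:R) 1 <= _); first exact: ler_sum.
  have /andP[_ ] := count_upto (ltW z0'); rewrite (sum_upto_split _ _ zz).
  have /andP[] := count_upto (ltW z0).
  set a := \sum_(n <- _) 1; set b := \sum_(n <- _ | _) 1 => k1 k2 /=.
  by move: a b k1 k2 => a b k1 k2 k3; lra.
have e : z / z' >= 1 - (t' - t).
  by rewrite /z /z' -expRB; have := expR_ge1Dx (t - t'); lra.
apply: le_trans (lerD (ler_wpM2l _ h2) (ler_wpM2l _ h1)) _.
- by rewrite invr_ge0 ltW.
- lra.
have -> : z'^-1 * (z' - z + 1) + - (z'^-1 - z^-1) * z = 2 * (1 - z / z') + z'^-1.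
  by field; rewrite !gt_eqF.
rewrite expRN -/z'; lra.
Qed.

Lemma mean_near (R : realType) (g : nat -> R[i]) (t t' t0 dl : R) :
  (forall n, nsq (g n) <= 1) -> t0 <= Num.max t t' -> `|t - t'| <= dl ->
  normc (mean g (expR t') - mean g (expR t)) <= 2 * dl + expR (- t0).
Proof.
move=> g1; case: (leP t t') => tt h0.
  rewrite distrC ger0_norm ?subr_ge0 // => h.
  apply: le_trans (mean_lipschitz tt g1) _; apply: lerD; first by lra.
  by rewrite ler_expR lerN2.
rewrite ger0_norm ?subr_ge0 ?(ltW tt) // => h.
rewrite -normcN opprB; apply: le_trans (mean_lipschitz (ltW tt) g1) _; apply: lerD; first by lra.
by rewrite ler_expR lerN2.
Qed.

(** The dyadic blocks abut, so their increments telescope; if all J exceeded 1/8 they would add up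
    to more than B. *)
Lemma small_block (R : realType) (M : R -> R) (X B : R) (J : nat) : 0 < X ->
  (forall U, 0 <= M U) -> M (X / 2) <= B -> 8 * B < J%:R ->
  exists2 i, (i < J)%N & M (2 * (X / (4 * 2 ^+ i))) - M (X / (4 * 2 ^+ i)) <= 1 / 8.
Proof.
move=> X0 M0 MB BJ; apply: contrapT => H.
have H2 i : (i < J)%N -> 1 / 8 < M (2 * (X / (4 * 2 ^+ i))) - M (X / (4 * 2 ^+ i)).
  by move=> iJ; rewrite ltNge; apply/negP => h; apply: H; exists i.
suff K k : (k <= J)%N -> k%:R / 8 <= M (X / 2) - M (2 * (X / (4 * 2 ^+ k))).
  by have := K J (leqnn J); have := M0 (2 * (X / (4 * 2 ^+ J))); lra.
elim: k => [|k IH] kJ.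
  by rewrite mul0r expr0 (_ : 2 * (X / (4 * 1)) = X / 2) ?subrr //; field.
have := IH (ltnW kJ); have := H2 k kJ; rewrite -natr1.
have -> : 2 * (X / (4 * 2 ^+ k.+1)) = X / (4 * 2 ^+ k).
  by rewrite exprS; field; rewrite ?expf_neq0 ?pnatr_eq0 //.
lra.
Qed.

Lemma sum_ord_mul (R : nmodType) (a b : nat) (F : nat -> R) :
  \sum_(j < a * b) F j = \sum_(c < a) \sum_(i < b) F (c * b + i)%N.
Proof.
elim: a => [|a IH]; first by rewrite !big_ord0.
by rewrite mulSnr big_split_ord big_ord_recr /= IH.
Qed.

(* A non-exceptional prime [p] in [(expR U, expR (2 * U)]] transfers the size of the mean at [X]
   to the mean near [X - ln p]; a cell of length [U / r] holds prime mass at most [11 / U], so many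
   cells contain such a prime. *)
Lemma energy_lower (R : realType) (g : nat -> R[i]) (eta X U : R) (r m : nat) :
  completely_multiplicative g -> (forall n, nsq (g n) <= 1) ->
  0 < eta -> eta <= 1 -> eta <= normc (mean g (expR X)) -> 100 / eta <= U -> 4 * U <= X ->
  \sum_(p <- upto (expR (2 * U)) | prime p && (expR U < p%:R) &&
      (eta / 2 <= normc (g p * mean g (expR (X - ln p%:R)) - mean g (expR X)))) (p%:R)^-1 <= 1 / 8 :> R ->
  20 * U / eta <= r%:R -> (0 < m)%N ->
  U / 88 * m%:R * (eta ^+ 2 / 16) <=
   \sum_(j < r * m) nsq (mean g (expR (X - 2 * U + j%:R * (U / (r * m)%N%:R)))).
Proof.
move=> gM g1 e0 e1 eX hU UX hbad hr m0.
have U100 : 100 <= U by apply: le_trans hU; rewrite ler_pdivlMr // ; lra.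
have U0 : 0 < U by lra.
have rR : (0 : R) < r%:R by apply: lt_le_trans hr; rewrite divr_gt0 // mulr_gt0.
have mR : (0 : R) < m%:R by rewrite ltr0n.
pose good p := ~~ (eta / 2 <= normc (g p * mean g (expR (X - ln p%:R)) - mean g (expR X))).
pose w := U / r%:R.
have rw : r%:R * w = U by rewrite /w mulrC divfK ?gt_eqF.
have w0 : 0 < w by rewrite divr_gt0.
have we : w <= eta / 20.
  rewrite /w ler_pdivrMr //; move: hr; rewrite ler_pdivrMr // => h.
  rewrite mulrAC ler_pdivlMr //; clear -h; lra.
(* Cells are counted downwards from 2 U, so that X - ln p runs upwards through the grid that starts
   at X - 2 U. *)
pose cell (c p : nat) := (2 * U - c.+1%:R * w < ln p%:R) && (ln p%:R <= 2 * U - c%:R * w).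
pose P p := [&& prime p, expR U < p%:R & good p].
pose G c := has (fun p => P p && cell c p) (upto (expR (2 * U))).
(* The whole block has mass at least (U - 10) / (2 U) >= 1/4, and the exceptional primes take at
   most 1/8. *)
have hgood : 1 / 8 <= \sum_(p <- upto (expR (2 * U)) | P p) (p%:R)^-1 :> R.
  have := prime_mass_block_ge U0 (_ : U <= 2 * U).
  rewrite (bigID (fun p => eta / 2 <= normc (g p * mean g (expR (X - ln p%:R)) - mean g (expR X)))) /=.
  have -> : \sum_(p <- upto (expR (2 * U)) | P p) (p%:R)^-1 =
    \sum_(i <- upto (expR (2 * U)) | prime i && (expR U < i%:R) &&
           ~~ (eta / 2 <= normc (g i * mean g (expR (X - ln i%:R)) - mean g (expR X)))) (i%:R)^-1 :> R.
    by apply: eq_bigl => p; rewrite /P andbA.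
  move: hbad; set a := \sum_(p <- _ | _) _; set b := \sum_(p <- _ | _) _ => h1 h2.
  have h3 : 1 / 4 <= (2 * U - U - 10) / (2 * U) by rewrite ler_pdivlMr; lra.
  have := le_trans h3 (h2 ltac:(lra)); move: a b h1 {h2} => a b h1 /= h2; lra.
have cells : \sum_(p <- upto (expR (2 * U)) | P p) (p%:R)^-1 <=
    \sum_(c < r) \sum_(p <- upto (expR (2 * U)) | P p && cell c p) (p%:R)^-1 :> R.
  rewrite (exchange_big_dep P) /=; last by move=> c p _ /andP[].
  rewrite big_seq_cond [leRHS]big_seq_cond; apply: ler_sum => p; rewrite mem_upto => /andP[/andP[p0 pU] hP].
  have /and3P[pp pU' _] := hP.
  rewrite le_ln_expR // in pU; rewrite lt_ln_expR // in pU'.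
  pose y := (2 * U - ln p%:R) / w.
  have y0 : 0 <= y by rewrite divr_ge0 ?(ltW w0) //; lra.
  have /andP[y1 y2] := truncn_itv y0.
  have yr : (Num.truncn y < r)%N.
    rewrite truncn_lt_nat // /y ltr_pdivrMr // rw; clear -pU'; lra.
  have pc : P p && cell (Ordinal yr) p.
    rewrite hP /= /cell /=.
    move: y1 y2; rewrite /y ler_pdivlMr // ltr_pdivrMr // => y1 y2.
    clear -y1 y2; apply/andP; split; lra.
  rewrite (bigD1 (Ordinal yr)) //= lerDl; apply: sumr_ge0 => c _.
  by rewrite invr_ge0 ler0n.
have cellG c : \sum_(p <- upto (expR (2 * U)) | P p && cell c p) (p%:R)^-1 <= (G c)%:R * (11 / U) :> R.
  have [Gc|Gc] := boolP (G c); last first.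
    rewrite mul0r big_seq_cond big_pred0 // => p; apply/negP => /andP[hp h].
    by move/negP: Gc; apply; apply/hasP; exists p.
  rewrite mul1r; pose V := 2 * U - c.+1%:R * w.
  have V' : 2 * U - c%:R * w = V + w by rewrite /V -natr1; ring.
  have [p0 hp0] : exists p, [&& p \in upto (expR (2 * U)), P p & cell c p].
    by move/hasP: Gc => [p hp h]; exists p; rewrite hp.
  (* A cell starting at or below U is cut at U, where the primes under consideration begin. *)
  have [VU|VU] := leP V U.
    apply: le_trans (_ : \sum_(p <- upto (expR (U + w)) | prime p && (expR U < p%:R)) (p%:R)^-1 <= _).
      have -> : \sum_(p <- upto (expR (2 * U)) | P p && cell c p) (p%:R)^-1 =
          \sum_(p <- upto (expR (2 * U)) | P p && cell c p && (p%:R <= expR (U + w))) (p%:R)^-1 :> R.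
        rewrite big_seq_cond [RHS]big_seq_cond; apply: eq_bigl => p; rewrite mem_upto.
        case: (ltnP 0 p) => //= p1; case hP: (P p) => //=; rewrite ?andbF //.
        case hc : (cell c p) => //=; rewrite ?andbF //.
        have -> : p%:R <= expR (U + w); last by rewrite andbT.
        rewrite le_ln_expR //; move: hc; rewrite /cell V' => /andP[_ h]; clear -h VU; lra.
      have [h|h] := leP (expR (U + w)) (expR (2 * U)).
        rewrite -(sum_upto_sub (fun p => P p && cell c p) _ h).
        apply: ler_sum_upto => // [n _|n /andP[/and3P[-> -> _] _]] //.
        by rewrite invr_ge0 ler0n.
      apply: ler_sum_upto => // [|n _|n /andP[/andP[/and3P[-> -> _] _] _]] //; first exact: ltW.
      by rewrite invr_ge0 ler0n.
    apply: le_trans (prime_mass_block_le U0 _) _; first by clear -w0; lra.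
    by rewrite ler_pM2r ?invr_gt0 //; clear -we e1; lra.
  apply: le_trans (_ : \sum_(p <- upto (expR (V + w)) | prime p && (expR V < p%:R)) (p%:R)^-1 <= _).
    have h : expR (V + w) <= expR (2 * U).
      by rewrite ler_expR -V' lerBlDr lerDl mulr_ge0 ?ler0n ?ltW.
    rewrite [leRHS](sum_upto_sub _ _ h) big_seq_cond [leRHS]big_seq_cond.
    rewrite [leLHS]big_mkcond [leRHS]big_mkcond; apply: ler_sum => p _.
    case: ifP; last by case: ifP => // _ _; rewrite invr_ge0 ler0n.
    move=> /and3P[hp /and3P[pp _ _] /andP[h1 h2]]; rewrite hp pp lt_ln_expR ?prime_gt0 // h1.
    by rewrite le_ln_expR ?prime_gt0 // -V' h2.
  apply: le_trans (prime_mass_block_le (lt_trans U0 VU) _) _; first by clear -w0; lra.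
  by clearbody V; rewrite ler_pM ?invr_ge0 ?lef_pV2 ?posrE //; clear -U0 we e1 w0 VU; lra.
(* A mass of 1/8 spread over cells of mass at most 11 / U occupies at least U / 88 of them. *)
have sumG : U / 88 <= \sum_(c < r) (G c)%:R :> R.
  have h : 1 / 8 <= (\sum_(c < r) (G c)%:R) * (11 / U) :> R.
    apply: le_trans hgood (le_trans cells _); rewrite mulr_suml; apply: ler_sum => c _; exact: cellG.
  move: h; rewrite mulrA ler_pdivlMr //; lra.
rewrite (sum_ord_mul r m (fun j : nat => nsq (mean g (expR (X - 2 * U + j%:R * (U / (r * m)%N%:R)))))).
apply: le_trans (_ : \sum_(c < r) (G c)%:R * (m%:R * (eta ^+ 2 / 16)) <= _).
  rewrite -mulr_suml -mulrA ler_wpM2r // mulr_ge0 ?ler0n // divr_ge0 ?sqr_ge0 //.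
apply: ler_sum => c _; have [Gc|_] := boolP (G c); last first.
  by rewrite mul0r; apply: sumr_ge0 => i _; exact: nsq_ge0.
have [p hp /andP[/and3P[pp pU hg] /andP[c1 c2]]] := hasP Gc.
rewrite mul1r mulr_natl -[X in _ *+ X](card_ord m) -sumr_const; apply: ler_sum => i _.
set t := X - 2 * U + _.
have tE : t = X - 2 * U + c%:R * w + i%:R / m%:R * w.
  rewrite /t /w natrD !natrM; field; rewrite !gt_eqF //.
have im : 0 <= (i%:R / m%:R : R) <= 1.
  by rewrite divr_ge0 ?ler0n //= ler_pdivrMr // mul1r ler_nat ltnW.
rewrite -natr1 in c1.
have dt : `|(X - ln p%:R) - t| <= w.
  rewrite tE ler_norml; have := mulr_ge0 (proj1 (andP im)) (ltW w0).
  have := ler_wpM2r (ltW w0) (proj2 (andP im)); rewrite mul1r.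
  set q := _ / _ * w => q1 q2; clear -q1 q2 c1 c2; apply/andP; split; lra.
have t2 : 2 * U <= Num.max (X - ln p%:R) t.
  rewrite le_max tE; apply/orP; right.
  have := mulr_ge0 (proj1 (andP im)) (ltW w0).
  have := mulr_ge0 (ler0n R c) (ltW w0); clear -UX U0; lra.
have near := mean_near g1 t2 dt.
have ee : expR (- (2 * U)) <= eta / 20.
  rewrite expRN -[leRHS]invrK lef_pV2 ?posrE ?expR_gt0 ?invr_gt0 ?divr_gt0 //.
  apply: le_trans (expR_ge1Dx _); rewrite invf_div.
  have : 20 / eta <= 100 / eta by rewrite ler_pM2r ?invr_gt0 // ler_nat.
  clear -hU U0 U100; lra.
have hp1 : eta / 2 <= normc (mean g (expR (X - ln p%:R))).
  rewrite /good -ltNge in hg.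
  have : normc (mean g (expR X)) <= normc (g p * mean g (expR (X - ln p%:R))) +
     normc (g p * mean g (expR (X - ln p%:R)) - mean g (expR X)).
    rewrite -[X in _ <= _ + X]normcN opprB.
    by apply: le_trans (le_normcD _ _); rewrite addrC subrK.
  rewrite [normc (g p * mean g (expR (X - ln p%:R)))]ComplexField.Normc.normcM => tri.
  have gp : normc (g p) * normc (mean g (expR (X - ln p%:R))) <= normc (mean g (expR (X - ln p%:R))).
    by rewrite -[leRHS]mul1r ler_wpM2r ?normc_ge0 // -nsq_le1_normc.
  move: hg tri gp; set a := normc (_ - _); set b := normc (g p) * _ => hg tri gp.
  by have := le_trans eX tri; move: a b hg gp {tri} => a b hg gp tri; clear -hg gp tri; lra.
have : normc (mean g (expR (X - ln p%:R))) <= normc (mean g (expR t)) +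
     normc (mean g (expR t) - mean g (expR (X - ln p%:R))).
  rewrite -[X in _ <= _ + X]normcN opprB.
  by apply: le_trans (le_normcD _ _); rewrite subrKC.
move=> tri; have tge : eta / 4 <= normc (mean g (expR t)) by clear -tri hp1 near ee we e0; lra.
rewrite -normc_sqr; have : (eta / 4) ^+ 2 <= normc (mean g (expR t)) ^+ 2.
  by rewrite ler_sqr ?nnegrE ?normc_ge0 // divr_ge0 // ltW.
clear; lra.
Qed.

(** The true shift [lam] is rounded down to s grid steps. Away from the wrap-around, rounding moves
    the mean by at most 3 eps, whose doubled square is 18 eps^2; the s indices that wrap around are
    bounded trivially by 4 each. *)
Lemma shift_sum_le (R : realType) (g : nat -> R[i]) (gam : R[i]) (a eps lam : R) (N s : nat) :
  (forall n, nsq (g n) <= 1) -> nsq gam <= 1 -> 0 < eps -> expR (- a) <= eps ->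
  s%:R * eps <= lam -> lam <= s.+1%:R * eps -> (s <= N)%N ->
  \sum_(j < N) nsq (mean g (expR (a + ((j + s) %% N)%N%:R * eps)) - gam * mean g (expR (a + j%:R * eps)))
  <= 2 * (\sum_(j < N) nsq (gam * mean g (expR (a + j%:R * eps - lam)) - mean g (expR (a + j%:R * eps))))
     + 18 * eps ^+ 2 * N%:R + 4 * s%:R.
Proof.
move=> g1 gam1 e0 ea l1 l2 sN.
pose T t := mean g (expR t); pose t (j : nat) := a + j%:R * eps.
pose f j := nsq (T (t ((j + s) %% N)%N) - gam * T (t j)).
pose h j := nsq (gam * T (t j - lam) - T (t j)).
rewrite -(big_mkord xpredT f) -(big_mkord xpredT h).
have T1 x : nsq (T x) <= 1 by apply: nsq_mean_le1 => //; exact: expR_gt0.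
have h0 j : 0 <= h j by exact: nsq_ge0.
have f4 j : f j <= 4.
  apply: le_trans (nsqB_le _ _) _; rewrite nsqM.
  have := T1 (t ((j + s) %% N)%N).
  have : nsq gam * nsq (T (t j)) <= 1 by rewrite mulr_ile1 ?nsq_ge0.
  lra.
have fh j : (j < N - s)%N -> f j <= 2 * h (j + s)%N + 18 * eps ^+ 2.
  move=> js; rewrite /f modn_small; last by lia.
  have -> : T (t (j + s)%N) - gam * T (t j) =
    - (gam * T (t (j + s)%N - lam) - T (t (j + s)%N)) + gam * (T (t (j + s)%N - lam) - T (t j)) by ring.
  apply: le_trans (nsqD_le _ _) _; rewrite nsqN; apply: lerD => //.
  rewrite nsqM.
  have d1 : normc (T (t (j + s)%N - lam) - T (t j)) <= 2 * eps + expR (- a).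
    apply: mean_near => //.
      by rewrite le_max lerDl mulr_ge0 ?ler0n ?(ltW e0).
    rewrite /t natrD mulrDl ler_norml; rewrite -natr1 mulrDl mul1r in l2.
    by apply/andP; split; lra.
  have d2 : nsq (T (t (j + s)%N - lam) - T (t j)) <= 9 * eps ^+ 2.
    rewrite -normc_sqr; have := normc_ge0 (T (t (j + s)%N - lam) - T (t j)).
    set u := normc _ in d1 *; nra.
  have : nsq gam * nsq (T (t (j + s)%N - lam) - T (t j)) <= 1 * (9 * eps ^+ 2).
    by rewrite ler_pM ?nsq_ge0.
  lra.
rewrite (big_cat_nat (n := (N - s)%N)) //=; last by rewrite leq_subr.
have p1 : \sum_(0 <= j < N - s) f j <= 2 * (\sum_(0 <= j < N) h j) + 18 * eps ^+ 2 * N%:R.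
  apply: le_trans (_ : \sum_(0 <= j < N - s) (2 * h (j + s)%N + 18 * eps ^+ 2) <= _).
    rewrite big_nat [leRHS]big_nat; apply: ler_sum => j /andP[_]; exact: fh.
  rewrite big_split /=; apply: lerD.
    rewrite -mulr_sumr ler_wpM2l // (big_cat_nat (n := s) (m := 0) (p := N)) //=.
    rewrite -[X in _ <= _ + X](_ : \sum_(0 <= j < N - s) h (j + s)%N = _).
      by rewrite lerDr; apply: sumr_ge0 => j _; exact: h0.
    by rewrite -[in RHS](add0n s) big_addn.
  rewrite sumr_const_nat subn0 -[_ *+ _]mulr_natr ler_wpM2l ?ler_nat ?leq_subr //.
  by rewrite mulr_ge0 // sqr_ge0.
have p2 : \sum_(N - s <= j < N) f j <= 4 * s%:R.
  apply: le_trans (_ : \sum_(N - s <= j < N) 4 <= _); first exact: ler_sum.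
  by rewrite sumr_const_nat subKn // -[_ *+ _]mulr_natr.
exact: lerD.
Qed.

(** The angle 2 pi k / N is moved into [-pi, pi], where |1 - e^(i th)| controls th. *)
Lemma dft_angle (R : realType) (N k : nat) : (k < N)%N ->
  exists2 th : R, `|th| <= pi & forall s : nat, cis (pi *+ 2 * s%:R / N%:R * k%:R) = cis (th * s%:R).
Proof.
move=> kN; have NR : (0 : R) < N%:R by rewrite ltr0n (leq_ltn_trans _ kN).
pose x : R := pi *+ 2 * k%:R / N%:R.
have p0 := pi_gt0 R.
have x0 : 0 <= x by rewrite divr_ge0 ?ler0n // mulr_ge0 ?ler0n // mulrn_wge0 // ltW.
have x2 : x < pi *+ 2.
  by rewrite /x ltr_pdivrMr // ltr_pM2l ?ltr_nat // pmulrn_rgt0.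
have E (s : nat) : pi *+ 2 * s%:R / N%:R * k%:R = x * s%:R :> R by rewrite /x; ring.
have [xp|xp] := leP x pi.
  by exists x; rewrite ?ger0_norm // => s; rewrite E.
exists (x - pi *+ 2) => [|s].
  rewrite mulr2n in x2 *; rewrite ler_norml; apply/andP; split; lra.
rewrite E mulrBl cisD -mulNr.
have -> : cis (- (pi *+ 2) * s%:R) = 1 :> R[i].
  rewrite mulrC cis_natmul cisN /cis cos2pi sin2pi.
  by rewrite (_ : Complex 1 0 = 1) // conjc1 expr1n.
by rewrite mulr1.
Qed.

Lemma nsq_cis_sub_le (R : realType) (x y : R) : nsq (cis x - cis y) <= 2 * (x - y) ^+ 2.
Proof.
have -> : cis x - cis y = - cis x * (cis (y - x) - 1).
  by rewrite mulrBr !mulNr mulr1 -cisD opprK addrC [x + _]addrC subrK addrC.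
rewrite nsqM nsqN nsq_cis mul1r -opprB nsqN nsq_one_sub_cis.
have := one_sub_cos_le_sqr (y - x); rewrite -[(y - x) ^+ 2]sqrrN opprB; lra.
Qed.

Lemma one_add_ln_le (R : realType) (U : R) : 0 < U -> 1 + ln U <= U.
Proof.
move=> U0; have h : -1 < U - 1 by lra.
have := le_ln1Dx h; have -> : 1 + (U - 1) = U by ring.
lra.
Qed.

Lemma expRN_le_inv (R : realType) (U B : R) : 0 < U -> 0 < B -> B <= U -> expR (- (2 * U)) <= (U * B)^-1.
Proof.
move=> U0 B0 BU; rewrite expRN lef_pV2 ?posrE ?expR_gt0 ?mulr_gt0 //.
have h := expR_ge1Dx U; have -> : 2 * U = U + U by ring.
rewrite expRD; apply: ler_pM; lra.
Qed.

(** About 20 U / eta cells of about U points each give a step eps of order eta / U. Cells of length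
    at most eta / 20 keep the mean nearly constant on them. The step is small enough for the phase
    errors in [halasz_window], and large enough that eta / eps^2 = O(N), which pays for the
    wrap-around of one step. *)
Lemma grid_parameters (R : realType) (eta U : R) : 0 < eta -> eta <= 1 -> 100 / eta <= U ->
  exists r m : nat, let N := (r * m)%N in let eps := U / N%:R in
  [/\ (0 < m)%N, 20 * U / eta <= r%:R, r%:R * eta <= 21 * U, 0 < eps & eps * (20 * U) <= eta] /\
  [/\ eta <= 42 * (U * eps), (0 < N)%N, N%:R * eps = U & expR (- (2 * U)) <= eps].
Proof.
move=> e0 e1 hU.
have U100 : 100 <= U by apply: le_trans hU; rewrite ler_pdivlMr //; lra.
have U0 : 0 < U by lra.
have hU' : 100 <= U * eta by rewrite -ler_pdivrMr.
pose q := 20 * U / eta; have q0 : 0 <= q by rewrite divr_ge0 ?mulr_ge0 ?ltW.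
have /andP[r1 r2] := truncn_itv q0; have /andP[m1 m2] := truncn_itv (ltW U0).
set r := (Num.truncn q).+1 in r2; set m := (Num.truncn U).+1 in m2.
have r3 : r%:R <= q + 1 by rewrite /r -natr1; lra.
have m3 : m%:R <= 2 * U by rewrite /m -natr1; lra.
have m0 : (0 < m)%N by []. have r0 : (0 < r)%N by [].
exists r, m => N eps.
have N0 : (0 < N)%N by rewrite muln_gt0 r0 m0.
have NR : (0 : R) < N%:R by rewrite ltr0n.
have NE : N%:R = r%:R * m%:R :> R by rewrite natrM.
have eps0 : 0 < eps by rewrite divr_gt0.
have Ne : N%:R * eps = U by rewrite /eps mulrC divfK // gt_eqF.
have qe : q * eta = 20 * U by rewrite /q divfK // gt_eqF.
have re : r%:R * eta <= 21 * U.
  by have := ler_wpM2r (ltW e0) r3; rewrite mulrDl qe; lra.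
have rl : 20 * U <= r%:R * eta by have := ler_wpM2r (ltW e0) (ltW r2); rewrite qe.
have rR : (0 : R) < r%:R by rewrite ltr0n.
have mR : (0 : R) < m%:R by rewrite ltr0n.
have e42 : eta <= 42 * (U * eps).
  rewrite /eps; have -> : 42 * (U * (U / N%:R)) = 42 * (U * U) / N%:R by ring.
  rewrite ler_pdivlMr // NE.
  have h1 : r%:R * eta * m%:R <= 21 * U * (2 * U) by rewrite ler_pM // ?mulr_ge0 // ltW.
  lra.
split; split => //; first exact: ltW.
- rewrite /eps mulrAC ler_pdivrMr // NE.
  have h1 : 20 * U * U <= r%:R * eta * m%:R by rewrite ler_pM ?mulr_ge0 ?(ltW U0) // ltW.
  lra.
apply: le_trans (expRN_le_inv U0 (_ : 0 < 42 / eta) _) _.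
- by rewrite divr_gt0.
- by rewrite ler_pdivrMr //; lra.
rewrite mulrA invf_div ler_pdivrMr ?mulr_gt0 //; lra.
Qed.

(** In [halasz_window], 240 N bounds the total cost of the shifts and 300 * 100 is the loss in the
    lower bound for the energy. *)
Definition halasz_K (R : realType) : R := 240 * (300 * 100).

Lemma halasz_K_gt0 (R : realType) : 0 < halasz_K R.
Proof. by rewrite /halasz_K; lra. Qed.

(** The energy E of the sampled means is at least of order N eta^3, whereas all shifts together,
    weighted by 1 / p, cost O(N): Turan-Kubilius bounds them by a constant at each grid point. So
    one frequency th serves all primes on average, and tau = th / eps because ln p is within eps of
    s(p) eps. *)
Lemma halasz_window (R : realType) (g : nat -> R[i]) (eta X U : R) :
  completely_multiplicative g -> (forall n, nsq (g n) <= 1) ->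
  0 < eta -> eta <= 1 -> eta <= normc (mean g (expR X)) -> 100 / eta <= U -> 4 * U <= X ->
  \sum_(p <- upto (expR (2 * U)) | prime p && (expR U < p%:R) &&
      (eta / 2 <= normc (g p * mean g (expR (X - ln p%:R)) - mean g (expR X)))) (p%:R)^-1 <= 1 / 8 :> R ->
  exists2 tau : R, tau ^+ 2 <= 32 * halasz_K R / eta ^+ 4 &
    \sum_(p <- upto (expR U) | prime p) (p%:R)^-1 * nsq (1 - g p * cis (tau * ln p%:R))
      <= 3 * halasz_K R / eta ^+ 3.
Proof.
move=> gM g1 e0 e1 eX hU UX hbad.
have U100 : 100 <= U by apply: le_trans hU; rewrite ler_pdivlMr //; lra.
have U0 : 0 < U by lra.
have hU' : 100 <= U * eta by rewrite -ler_pdivrMr.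
have [r [m [[m0 r20 r21 eps0 epsU] [eta42 N0 Neps expeps]]]] := grid_parameters e0 e1 hU.
have En := energy_lower gM g1 e0 e1 eX hU UX hbad r20 m0.
set N := (r * m)%N in eps0 epsU eta42 N0 Neps expeps En.
set eps := U / N%:R in eps0 epsU eta42 Neps expeps En.
set a := X - 2 * U in En.
clearbody eps.
pose F j := mean g (expR (a + j%:R * eps)).
set E := \sum_(j < N) _ in En.
have NR : (0 : R) < N%:R by rewrite ltr0n.
have EN : N%:R * eta ^+ 3 <= 300 * 100 * E.
  have h : r%:R * eta * (m%:R * eta ^+ 2) <= 21 * U * (m%:R * eta ^+ 2).
    by rewrite ler_wpM2r // mulr_ge0 ?ler0n ?sqr_ge0.
  have -> : N%:R * eta ^+ 3 = r%:R * eta * (m%:R * eta ^+ 2) by rewrite /N natrM; ring.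
  apply: le_trans h _; have : 0 <= U * (m%:R * eta ^+ 2) by rewrite mulr_ge0 ?(ltW U0) // mulr_ge0 ?ler0n ?sqr_ge0.
  move: En; move: (E) => E' En h0; clear -En h0; lra.
(* The index [0] stands for the shift by one grid step; its large weight forces the frequency
   to be small, which is what bounds [tau]. *)
pose c (p : nat) : R := if p == 0%N then eta / eps ^+ 2 else (p%:R)^-1.
pose gg (p : nat) : R[i] := if p == 0%N then 1 else g p.
pose s (p : nat) : nat := if p == 0%N then 1%N else Num.truncn (ln (p%:R : R) / eps).
pose P (p : nat) := (p == 0%N) || prime p.
have [k kN hk] := dft_frequency F (0%N :: upto (expR U)) P c gg s N0.
have [th thpi hth] := @dft_angle R N k kN.
have sp p : prime p -> [/\ s p = Num.truncn (ln (p%:R : R) / eps), c p = (p%:R)^-1 & gg p = g p].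
  by move=> pp; have := prime_gt0 pp; rewrite /s /c /gg; case: p {pp}.
have P0 p : p \in upto (expR U) -> P p = prime p.
  by rewrite mem_upto /P => /andP[]; case: p.
have ea : expR (- a) <= eps.
  by apply: le_trans expeps; rewrite ler_expR /a; clear -UX; lra.
(* The primes up to e^U have mass at most 36 U, so this makes the accumulated discretisation errors
   harmless. *)
have eU : eps ^+ 2 * U <= eta ^+ 3 / (400 * 100).
  rewrite ler_pdivlMr ?mulr_gt0 //.
  have h1 : (eps * (20 * U)) ^+ 2 <= eta ^+ 2.
    by rewrite ler_sqr ?nnegrE ?(ltW e0) // mulr_ge0 ?(ltW eps0) // mulr_ge0 ?(ltW U0).
  have h2 : (eps ^+ 2 * U * 400) * 100 <= (eps ^+ 2 * U * 400) * (U * eta).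
    by rewrite ler_wpM2l // !mulr_ge0 ?(ltW eps0) ?(ltW U0) //.
  have h3 := ler_wpM2r (ltW e0) h1.
  rewrite mulrA; apply: le_trans h2 _.
  have -> : eps ^+ 2 * U * 400 * (U * eta) = (eps * (20 * U)) ^+ 2 * eta by ring.
  by rewrite [leRHS]exprSr.
have e31 : eta ^+ 3 <= 1 by rewrite exprn_ile1 // ltW.
have S36 : \sum_(p <- upto (expR U) | prime p) (p%:R)^-1 <= 36 * U :> R.
  apply: le_trans (prime_mass_all_le _) _; first by apply: le_trans U100; rewrite ler1n.
  by have := one_add_ln_le U0; clear; lra.
have epsV : eps^-1 * eps = 1 by rewrite mulVf // gt_eqF.
have NU : U / eps = N%:R by rewrite -Neps mulfK // gt_eqF.
(* The cost is 12 N from Turan-Kubilius, at most N from discretisation, and 8 N from the wrap-around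
   of at most ln p / eps indices, summed by Mertens. *)
have Sprime : \sum_(p <- upto (expR U) | prime p) (p%:R)^-1 *
     \sum_(j < N) nsq (F ((j + s p) %% N)%N - g p * F j) <= 22 * N%:R.
  pose h p := \sum_(j < N) nsq (g p * mean g (expR (a + j%:R * eps - ln p%:R)) - mean g (expR (a + j%:R * eps))).
  apply: le_trans (_ : \sum_(p <- upto (expR U) | prime p)
     (2 * ((p%:R)^-1 * h p) + 18 * eps ^+ 2 * N%:R * (p%:R)^-1 + 4 * eps^-1 * (ln p%:R / p%:R)) <= _).
    rewrite big_seq_cond [leRHS]big_seq_cond; apply: ler_sum => p; rewrite mem_upto => /andP[/andP[p0 pU] pp].
    have [sE _ _] := sp p pp.
    rewrite le_ln_expR // in pU.
    have y0 : 0 <= ln (p%:R : R) / eps by rewrite divr_ge0 ?ln_nat_ge0 ?(ltW eps0).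
    have /andP[y1 y2] := truncn_itv y0; rewrite -sE in y1 y2.
    have sl : (s p)%:R * eps <= ln p%:R by rewrite -ler_pdivlMr.
    have su : ln p%:R <= (s p).+1%:R * eps by rewrite -ler_pdivrMr // ltW.
    have sN : (s p <= N)%N.
      by rewrite -(ler_nat R); apply: le_trans y1 _; rewrite -NU ler_pM2r ?invr_gt0.
    have H := shift_sum_le g1 (g1 p) eps0 ea sl su sN; rewrite -/(h p) in H.
    have pV : 0 <= (p%:R)^-1 :> R by rewrite invr_ge0 ler0n.
    apply: le_trans (ler_wpM2l pV H) _.
    have : 4 * (s p)%:R * (p%:R)^-1 <= 4 * (ln p%:R / eps) * (p%:R)^-1.
      by rewrite ler_wpM2r // ler_wpM2l.
    move: (h p) => hh h4.
    have -> : 4 / eps * (ln p%:R / p%:R) = 4 * (ln p%:R / eps) / p%:R by ring.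
    clear -h4; lra.
  rewrite !big_split /= -!mulr_sumr.
  have t1 : \sum_(p <- upto (expR U) | prime p) (p%:R)^-1 * h p <= 6 * N%:R.
    under eq_bigr do rewrite /h mulr_sumr.
    rewrite exchange_big /=; apply: le_trans (_ : \sum_(j < N) 6 <= _).
      apply: ler_sum => j _; apply: turan_kubilius_exp => //; first exact: ltW.
      rewrite /a; have := mulr_ge0 (ler0n R j) (ltW eps0); clear -UX; lra.
    by rewrite sumr_const card_ord -[_ *+ _]mulr_natr.
  have t2 : 18 * eps ^+ 2 * N%:R * (\sum_(p <- upto (expR U) | prime p) (p%:R)^-1) <= N%:R.
    apply: le_trans (ler_wpM2l _ S36) _.
      by rewrite !mulr_ge0 ?(ltW eps0) ?ler0n //.
    have : N%:R * (eps ^+ 2 * U) <= N%:R * (1 / (400 * 100)).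
      by rewrite ler_wpM2l // (le_trans eU) // ler_pM2r // invr_gt0 mulr_gt0.
    have : (0 : R) <= N%:R by [].
    clear; lra.
  have t3 : 4 * eps^-1 * (\sum_(p <- upto (expR U) | prime p) ln p%:R / p%:R) <= 8 * N%:R.
    have /andP[_ u1] := mertens (z := expR U) ltac:(have := expR_ge1Dx U; clear -U100; lra).
    rewrite expRK in u1.
    apply: le_trans (ler_wpM2l _ u1) _; first by rewrite mulr_ge0 // invr_ge0 ltW.
    rewrite -NU; have -> : 4 / eps * (U + 6) = 4 * (U + 6) / eps by ring.
    have -> : 8 * (U / eps) = 8 * U / eps by ring.
    by rewrite ler_pM2r ?invr_gt0 //; clear -U100; lra.
  move: t1 t2 t3; set A1 := \sum_(p <- _ | _) (_ * h _); set A2 := _ * \sum_(p <- _ | _) _; set A3 := _ * \sum_(p <- _ | _) _.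
  by move: A1 A2 A3 => A1 A2 A3 t1 t2 t3; have : (0 : R) <= N%:R by []; clear -t1 t2 t3; lra.
(* One step changes the mean by O(eps), giving 36 eta N after weighting; the wrap-around 4 eta /
   eps^2 is at most 168 N by the choice of the grid. *)
have Slip : eta / eps ^+ 2 * \sum_(j < N) nsq (F ((j + 1) %% N)%N - 1 * F j) <= 204 * N%:R.
  have g11 : nsq (1 : R[i]) <= 1 by rewrite nsq1.
  have H := shift_sum_le (lam := eps) g1 g11 eps0 ea _ _ N0.
  have {}H := H ltac:(rewrite mul1r; exact: lexx) ltac:(rewrite -[leLHS]mul1r ler_wpM2r ?(ltW eps0) // ler1n).
  set S := \sum_(j < N) _; rewrite -/S in H.
  have h9 : \sum_(j < N) nsq (1 * mean g (expR (a + j%:R * eps - eps)) - mean g (expR (a + j%:R * eps))) <= 9 * eps ^+ 2 * N%:R.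
    apply: le_trans (_ : \sum_(j < N) 9 * eps ^+ 2 <= _); last by rewrite sumr_const card_ord -[_ *+ _]mulr_natr.
    apply: ler_sum => j _; rewrite mul1r.
    have d1 : normc (mean g (expR (a + j%:R * eps - eps)) - mean g (expR (a + j%:R * eps))) <= 2 * eps + expR (- a).
      apply: mean_near => //.
        by rewrite le_max lerDl mulr_ge0 ?ler0n ?(ltW eps0).
      by rewrite opprB addrC subrK ger0_norm // ltW.
    rewrite -normc_sqr; have := normc_ge0 (mean g (expR (a + j%:R * eps - eps)) - mean g (expR (a + j%:R * eps))).
    set u := normc _ in d1 *; clearbody u; clear -d1 ea eps0; nra.
  have H2 : S <= 36 * eps ^+ 2 * N%:R + 4.
    move: H h9; set Z := \sum_(j < N) _. move: (S) (Z) => S' Z' /(_ isT) H h9; clear -H h9; lra.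
  have ee0 : 0 <= eta / eps ^+ 2 by rewrite divr_ge0 ?sqr_ge0 ?(ltW e0).
  apply: le_trans (ler_wpM2l ee0 H2) _.
  have -> : eta / eps ^+ 2 * (36 * eps ^+ 2 * N%:R + 4) = 36 * eta * N%:R + 4 * (eta / eps ^+ 2).
    by field; rewrite gt_eqF.
  have q1 : eta / eps ^+ 2 <= 42 * N%:R.
    rewrite ler_pdivrMr ?exprn_gt0 //; have -> : 42 * N%:R * eps ^+ 2 = 42 * (N%:R * eps * eps) by ring.
    by rewrite Neps.
  have : eta * N%:R <= 1 * N%:R by rewrite ler_wpM2r // ltW.
  by have : (0 : R) <= N%:R by []; clear -q1; lra.
set Q := \sum_(p <- upto (expR U) | prime p) (p%:R)^-1 * nsq (1 - g p * cis (th * (s p)%:R)).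
have Q0 : 0 <= Q by apply: sumr_ge0 => p _; rewrite mulr_ge0 ?nsq_ge0 // invr_ge0 ler0n.
have main : E * (eta / eps ^+ 2 * nsq (1 - cis th) + Q) <= 240 * N%:R.
  have L : \sum_(i <- 0%N :: upto (expR U) | P i) c i * nsq (1 - gg i * cis (pi *+ 2 * (s i)%:R / N%:R * k%:R)) =
     eta / eps ^+ 2 * nsq (1 - cis th) + Q.
    rewrite big_cons /P /= /c /gg /= mul1r hth /s /= mulr1; congr (_ + _).
    rewrite /Q big_seq_cond [RHS]big_seq_cond; apply: eq_big => p.
      by case hp : (p \in _) => //=; exact: P0.
    move=> /andP[hp hP]; have pp : prime p by rewrite -(P0 p hp).
    by have [_ cE gE] := sp p pp; rewrite -/(c p) -/(gg p) -/(s p) cE gE hth.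
  rewrite L in hk; apply: le_trans hk _.
  rewrite big_cons /P /= {1}/c {1}/gg {1}/s /=.
  apply: le_trans (lerD Slip (_ : _ <= 22 * N%:R)) _; last by have : (0 : R) <= N%:R by []; clear; lra.
  apply: le_trans Sprime; rewrite le_eqVlt; apply/orP; left; apply/eqP.
  rewrite big_seq_cond [RHS]big_seq_cond; apply: eq_big => p.
    by case hp : (p \in _) => //=; exact: P0.
  move=> /andP[hp hP]; have pp : prime p by rewrite -(P0 p hp).
  by have [_ -> ->] := sp p pp.
have c00 : 0 < eta / eps ^+ 2 by rewrite divr_gt0 // exprn_gt0.
set nn := nsq (1 - cis th) in main.
have nn0 : 0 <= nn by exact: nsq_ge0.
have BK : (eta / eps ^+ 2 * nn + Q) * eta ^+ 3 <= halasz_K R.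
  rewrite -(ler_pM2l NR).
  have B0 : 0 <= eta / eps ^+ 2 * nn + Q by rewrite addr_ge0 // mulr_ge0 // ltW.
  have := ler_wpM2r B0 EN; rewrite /halasz_K.
  move: main B0; move: (_ + Q) => B main B0; clear -main; lra.
have e3 : 0 < eta ^+ 3 by rewrite exprn_gt0.
have e4 : 0 < eta ^+ 4 by rewrite exprn_gt0.
have QK : Q <= halasz_K R / eta ^+ 3.
  rewrite ler_pdivlMr //; apply: le_trans BK; rewrite ler_wpM2r ?(ltW e3) // lerDr.
  by rewrite mulr_ge0 // ltW.
have th2 : th ^+ 2 <= 32 * halasz_K R / eta ^+ 4 * eps ^+ 2.
  have h1 := nsq_one_sub_cis_ge thpi; rewrite -/nn in h1.
  have h2 : eta / eps ^+ 2 * nn * eta ^+ 3 <= halasz_K R.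
    by apply: le_trans BK; rewrite ler_wpM2r ?(ltW e3) // lerDl.
  have h3 : nn <= halasz_K R / eta ^+ 4 * eps ^+ 2.
    rewrite mulrAC ler_pdivlMr //.
    have -> : nn * eta ^+ 4 = eta / eps ^+ 2 * nn * eta ^+ 3 * eps ^+ 2 by field; rewrite gt_eqF.
    by rewrite ler_wpM2r ?sqr_ge0.
  have -> : 32 * halasz_K R / eta ^+ 4 * eps ^+ 2 = 32 * (halasz_K R / eta ^+ 4 * eps ^+ 2) by ring.
  clear -h1 h3; lra.
have tau2 : (th / eps) ^+ 2 <= 32 * halasz_K R / eta ^+ 4.
  by rewrite expr_div_n ler_pdivrMr ?exprn_gt0.
exists (th / eps) => //.
have K0 := halasz_K_gt0 R.
(* Passing from th s(p) to tau ln p changes a phase by at most |th|, and th^2 = O(eps^2 / eta^4). *)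
apply: le_trans (_ : 2 * Q + 4 * (32 * halasz_K R / eta ^+ 4 * eps ^+ 2) *
    (\sum_(p <- upto (expR U) | prime p) (p%:R)^-1) <= _).
  rewrite /Q !mulr_sumr -big_split big_seq_cond [leRHS]big_seq_cond; apply: ler_sum => p /=.
  rewrite mem_upto => /andP[/andP[p0 pU] pp].
  have [sE _ _] := sp p pp.
  have y0 : 0 <= ln (p%:R : R) / eps by rewrite divr_ge0 ?ln_nat_ge0 ?(ltW eps0).
  have /andP[y1 y2] := truncn_itv y0; rewrite -sE ler_pdivlMr // in y1.
  rewrite -sE ltr_pdivrMr // -natr1 in y2.
  have pV : 0 <= (p%:R)^-1 :> R by rewrite invr_ge0 ler0n.
  have -> : 1 - g p * cis (th / eps * ln p%:R) = (1 - g p * cis (th * (s p)%:R)) +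
     g p * (cis (th * (s p)%:R) - cis (th / eps * ln p%:R)) by ring.
  apply: le_trans (ler_wpM2l pV (nsqD_le _ _)) _.
  have d1 : nsq (g p * (cis (th * (s p)%:R) - cis (th / eps * ln p%:R))) <=
      2 * (32 * halasz_K R / eta ^+ 4 * eps ^+ 2).
    rewrite nsqM; apply: le_trans (ler_wpM2r (nsq_ge0 _) (g1 p)) _; rewrite mul1r.
    apply: le_trans (nsq_cis_sub_le _ _) _; rewrite ler_wpM2l //.
    have -> : th * (s p)%:R - th / eps * ln p%:R = th / eps * ((s p)%:R * eps - ln p%:R).
      by field; rewrite gt_eqF.
    rewrite exprMn; apply: ler_pM => //; rewrite ?sqr_ge0 //.
    rewrite -[leLHS]sqrrN opprB ler_sqr ?nnegrE ?(ltW eps0) //; clear -y1 y2; lra.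
  have := ler_wpM2l pV d1.
  set u := nsq (g p * _); set v := nsq (1 - _); set w := 32 * _ / _ * _ => d2.
  move: (p%:R^-1) pV d2 => q q0 d2; clear -d2; lra.
have h0 : 0 <= 4 * (32 * halasz_K R / eta ^+ 4 * eps ^+ 2).
  by rewrite mulr_ge0 // mulr_ge0 ?sqr_ge0 // divr_ge0 ?(ltW e4) // mulr_ge0 // ltW.
have h1 : 4 * (32 * halasz_K R / eta ^+ 4 * eps ^+ 2) * (\sum_(p <- upto (expR U) | prime p) (p%:R)^-1)
   <= halasz_K R / eta ^+ 3.
  apply: le_trans (ler_wpM2l h0 S36) _.
  have -> : 4 * (32 * halasz_K R / eta ^+ 4 * eps ^+ 2) * (36 * U) =
    4 * 32 * 36 * (eps ^+ 2 * U) / eta * (halasz_K R / eta ^+ 3) by field; rewrite gt_eqF.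
  rewrite -[leRHS]mul1r ler_wpM2r ?divr_ge0 ?(ltW e3) ?(ltW K0) //.
  rewrite ler_pdivrMr // mul1r.
  have : eta ^+ 3 <= eta * 1 by rewrite exprS ler_wpM2l ?(ltW e0) // exprn_ile1 // ltW.
  move: eU; rewrite ler_pdivlMr ?mulr_gt0 //; move: (eps ^+ 2 * U) (eta ^+ 3) => A B; clear -e0; lra.
apply: le_trans (lerD (ler_wpM2l (_ : 0 <= 2) QK) h1) _ => //.
have -> : 3 * halasz_K R / eta ^+ 3 = 3 * (halasz_K R / eta ^+ 3) by ring.
clear; lra.
Qed.

(** A bad prime contributes at least eta^2 / (4 p) to the Turan-Kubilius sum, so the bad primes have
    mass at most 24 / eta^2, and 192 = 8 * 24 lets [small_block] apply. *)
Lemma halasz_weak (R : realType) (g : nat -> R[i]) (eta X : R) (J : nat) :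
  completely_multiplicative g -> (forall n, nsq (g n) <= 1) ->
  0 < eta -> eta <= 1 -> eta <= normc (mean g (expR X)) ->
  192 / eta ^+ 2 < J%:R -> 100 / eta <= X / (4 * 2 ^+ J) ->
  exists2 tau : R, tau ^+ 2 <= 32 * halasz_K R / eta ^+ 4 &
    \sum_(p <- upto (expR (X / (4 * 2 ^+ J))) | prime p)
       (p%:R)^-1 * nsq (1 - g p * cis (tau * ln p%:R)) <= 3 * halasz_K R / eta ^+ 3.
Proof.
move=> gM g1 e0 e1 eX hJ hX.
have J0 : 0 < 4 * 2 ^+ J :> R by rewrite mulr_gt0 // exprn_gt0.
have X0 : 0 < X.
  have : 0 < X / (4 * 2 ^+ J) by apply: lt_le_trans hX; rewrite divr_gt0.
  by rewrite pmulr_lgt0 // invr_gt0.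
pose bad p := eta / 2 <= normc (g p * mean g (expR (X - ln p%:R)) - mean g (expR X)).
pose M (V : R) : R := \sum_(p <- upto (expR V) | prime p && bad p) (p%:R)^-1.
have M0 V : 0 <= M V by apply: sumr_ge0 => p _; rewrite invr_ge0 ler0n.
have e2 : 0 < eta ^+ 2 by rewrite exprn_gt0.
have MB : M (X / 2) <= 24 / eta ^+ 2.
  rewrite ler_pdivlMr // -[leRHS](_ : 4 * 6 = 24); last by lra.
  have h := turan_kubilius_exp (t := X) (U := X / 2) gM g1 ltac:(lra) ltac:(lra).
  apply: le_trans (ler_wpM2l (_ : 0 <= 4) h) => //.
  rewrite /M mulr_suml mulr_sumr big_mkcondr; apply: ler_sum => p _.
  have pV : 0 <= (p%:R)^-1 :> R by rewrite invr_ge0 ler0n.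
  case: ifP => [hb|_]; last by rewrite !mulr_ge0 ?nsq_ge0.
  rewrite [leRHS]mulrCA ler_wpM2l // -normc_sqr.
  have : (eta / 2) ^+ 2 <= normc (g p * mean g (expR (X - ln p%:R)) - mean g (expR X)) ^+ 2.
    by rewrite ler_sqr ?nnegrE ?normc_ge0 // divr_ge0 // ltW.
  by rewrite expr_div_n; lra.
have BJ : 8 * (24 / eta ^+ 2) < J%:R.
  by apply: le_lt_trans hJ; rewrite mulrA (_ : 8 * 24 = 192) //; lra.
(* Among [J] dyadic windows one contains little mass of bad primes. *)
have [i iJ hi] := small_block X0 M0 MB BJ.
set U := X / (4 * 2 ^+ i) in hi.
have iJ2 : 2 ^+ i <= 2 ^+ J :> R by rewrite ler_weXn2l // ?ler1n // ltnW.
have i0 : 0 < 2 ^+ i :> R by rewrite exprn_gt0.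
have i1 : 1 <= 2 ^+ i :> R by rewrite exprn_ege1 // ler1n.
have UJ : X / (4 * 2 ^+ J) <= U.
  have h : 4 * 2 ^+ i <= 4 * 2 ^+ J :> R by rewrite ler_wpM2l.
  by rewrite /U ler_wpM2l ?(ltW X0) // lef_pV2 // posrE mulr_gt0.
have UX : 4 * U <= X.
  have -> : 4 * U = X / 2 ^+ i by rewrite /U; field; rewrite gt_eqF.
  by rewrite ler_pdivrMr // -[leLHS]mulr1 ler_wpM2l // ltW.
have U0 : 0 < U by apply: lt_le_trans UJ; rewrite divr_gt0.
have hbad : \sum_(p <- upto (expR (2 * U)) | prime p && (expR U < p%:R) && bad p) (p%:R)^-1 <= 1 / 8 :> R.
  have UU : expR U <= expR (2 * U) by rewrite ler_expR; lra.
  move: hi; rewrite /M (sum_upto_split _ _ UU) addrC addKr.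
  apply: le_trans; rewrite le_eqVlt; apply/orP; left; apply/eqP.
  by apply: eq_bigl => p; rewrite andbAC.
have [tau t1 t2] := halasz_window gM g1 e0 e1 eX (le_trans hX UJ) UX hbad.
exists tau => //; apply: le_trans t2.
apply: ler_sum_upto => // [|p _]; first by rewrite ler_expR.
by rewrite mulr_ge0 ?nsq_ge0 // invr_ge0 ler0n.
Qed.

(** * Differences of a large subset of a cyclic group *)

Fixpoint diff_layer (d : nat) (A : {set 'Z_d}) (n : nat) : {set 'Z_d} :=
  if n is n'.+1 then [set x + (ab.1 - ab.2) | x in diff_layer A n', ab in finset.setX A A]%SET
  else [set 0]%SET.

Lemma diff_layerSP (d : nat) (A : {set 'Z_d}) (n : nat) (x : 'Z_d) :
  reflect (exists y a b, [/\ y \in diff_layer A n, a \in A, b \in A & x = y + (a - b)])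
    (x \in diff_layer A n.+1).
Proof.
apply: (iffP imset2P) => [[y [a b] hy]|[y [a [b [hy ha hb ->]]]]].
  by rewrite inE /= => /andP[ha hb] ->; exists y, a, b.
by exists y (a, b) => //; rewrite inE /= ha hb.
Qed.

Lemma diff_layer_add (d : nat) (A : {set 'Z_d}) (m n : nat) (x y : 'Z_d) :
  x \in diff_layer A m -> y \in diff_layer A n -> x + y \in diff_layer A (m + n).
Proof.
move=> hx; elim: n y => [|n IH] y; first by rewrite inE addn0 => /eqP ->; rewrite addr0.
move=> /diff_layerSP[z [a [b [hz ha hb ->]]]]; rewrite addnS; apply/diff_layerSP.
by exists (x + z), a, b; split; rewrite ?IH // addrA.
Qed.

Lemma diff_layer_mono (d : nat) (A : {set 'Z_d}) (m n : nat) : A != finset.set0 -> (m <= n)%N ->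
  diff_layer A m \subset diff_layer A n.
Proof.
move=> /finset.set0Pn[a ha]; elim: n => [|n IH]; first by rewrite leqn0 => /eqP ->.
rewrite leq_eqVlt => /orP[/eqP -> //|]; rewrite ltnS => /IH /fintype.subset_trans; apply.
apply/fintype.subsetP => x hx; apply/diff_layerSP; exists x, a, a; split => //.
by rewrite subrr addr0.
Qed.

Lemma diff_layer_stop (d : nat) (A : {set 'Z_d}) (n k : nat) :
  diff_layer A n.+1 = diff_layer A n -> (n <= k)%N -> diff_layer A k = diff_layer A n.
Proof.
move=> h; elim: k => [|k IH]; first by rewrite leqn0 => /eqP ->.
rewrite leq_eqVlt => /orP[/eqP -> //|]; rewrite ltnS => nk.
by rewrite /= IH // -{2}h.
Qed.

(* If the layers kept growing, elements [y i] entering at step [2 * i] would give [m + 1] disjoint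
   translates of [A]. They stop at a subgroup containing a translate of [A], hence of index at
   most [m], hence everything. *)
Lemma diff_layer_full (d m : nat) (A : {set 'Z_d}) : (1 < d)%N ->
  (d < m.+1 * #|A|)%N -> (m < pdiv d)%N -> forall l : 'Z_d, l \in diff_layer A (2 * m).
Proof.
move=> d1 hA hm.
have A0 : A != finset.set0 by apply: contraTneq hA => ->; rewrite cards0 muln0.
have cT : #|[set: 'Z_d]%SET| = d by rewrite cardsT card_ord Zp_cast.
have [i im hi] : exists2 i, (i < 2 * m)%N & diff_layer A i.+1 = diff_layer A i.
  apply: contrapT => H.
  have ch (i : nat) : (i < m)%N -> exists y, (y \in diff_layer A (2 * i.+1)) && (y \notin diff_layer A (2 * i).+1).
    move=> im; have /fintype.subsetPn[y hy1 hy2] : ~~ (diff_layer A (2 * i).+2 \subset diff_layer A (2 * i).+1).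
      apply/negP => h; apply: H; exists (2 * i).+1; first by lia.
      by apply/eqP; rewrite finset.eqEsubset h diff_layer_mono.
    by exists y; rewrite hy2 andbT mulnS; exact: hy1.
  pose y (i : 'I_m.+1) : 'Z_d := if unlift ord0 i is Some j then xchoose (ch _ (ltn_ord j)) else 0.
  have y1 (i : 'I_m.+1) : y i \in diff_layer A (2 * i).
    rewrite /y; case: unliftP => [j ->|->]; last by rewrite muln0 inE.
    by have /andP[] := xchooseP (ch _ (ltn_ord j)).
  have y2 (i : 'I_m.+1) : (0 < i)%N -> y i \notin diff_layer A (2 * i).-1.
    rewrite /y; case: unliftP => [j ->|-> //] _.
    have /andP[_] := xchooseP (ch _ (ltn_ord j)).
    have e : (2 * lift ord0 j).-1 = (2 * j).+1 by rewrite lift0 mulnS.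
    by rewrite e.
  (* A collision would put [y j] into layer 2 i + 1, but it lies outside layer 2 j - 1. *)
  have dis (i j : 'I_m.+1) a b : (i < j)%N -> a \in A -> b \in A -> y i + a != y j + b.
    move=> ij ha hb; apply/eqP => e; have /negP := y2 j (leq_ltn_trans (leq0n i) ij); apply.
    apply: (fintype.subsetP (diff_layer_mono A0 (_ : ((2 * i).+1 <= _)%N))); first by lia.
    by apply/diff_layerSP; exists (y i), a, b; split => //; rewrite addrA e addrK.
  pose F (x : 'I_m.+1 * 'Z_d) := y x.1 + x.2.
  have Finj : {in finset.setX [set: 'I_m.+1]%SET A &, injective F}.
    move=> [i a] [j b]; rewrite !inE /F /= => ha hb e.
    case: (ltngtP i j) => h.
    - by have := dis i j a b h ha hb; rewrite e eqxx.
    - by have := dis j i b a h hb ha; rewrite e eqxx.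
    - by move: e; rewrite (val_inj h) => /addrI ->.
  have := subset_leq_card (finset.subsetT (F @: finset.setX [set: 'I_m.+1]%SET A)).
  by rewrite cT card_in_imset // cardsX cardsT card_ord leqNgt hA.
have stop := diff_layer_stop hi (ltnW im).
set H := diff_layer A i in hi stop.
have HH x y : x \in H -> y \in H -> x + y \in H.
  by move=> hx hy; rewrite /H -(diff_layer_stop hi (leq_addr i i)) diff_layer_add.
have gH : group_set H.
  apply/group_setP; split; last exact: HH.
  apply: (fintype.subsetP (diff_layer_mono A0 (leq0n i))); by rewrite inE.
have dvd : (#|H| %| d)%N by rewrite -[X in (_ %| X)%N]cT; exact: (cardSg (finset.subsetT (Group gH))).
have AH : (#|A| <= #|H|)%N.
  have /finset.set0Pn[a ha] := A0.
  have <- : #|[set x - a | x in A]%SET| = #|A| by rewrite card_imset // => u v /addIr.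
  apply/subset_leq_card/fintype.subsetP => z /imsetP[x hx ->].
  rewrite -hi; apply/diff_layerSP; exists 0, x, a; split => //; last by rewrite add0r.
  by apply: (fintype.subsetP (diff_layer_mono A0 (leq0n i))); rewrite inE.
have H0 : (0 < #|H|)%N by apply: leq_trans AH; rewrite card_gt0.
have full : H = [set: 'Z_d]%SET.
  apply/eqP; rewrite eqEcard finset.subsetT cT /=.
  have [q hq] := dvdnP dvd.
  have q1 : (q <= 1)%N.
    (* A proper subgroup has index q >= [pdiv d] > m, so d = q |H| >= (m + 1) |A|, against the
       hypothesis. *)
    rewrite leqNgt; apply/negP => q2.
    have := pdiv_min_dvd q2 (_ : q %| d)%N; rewrite {1}hq dvdn_mulr // => /(_ isT) h.
    nia.
  by have := leq_mul q1 (leqnn #|H|); rewrite -hq mul1n.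
by move=> l; rewrite stop -/H full inE.
Qed.

(** * Approximate characters *)

(* Agrees with [fpow f l] on positive integers; the junk value [f 0] is replaced by [0]. *)
Definition chi (R : realType) (f : nat -> R[i]) (l n : nat) : R[i] :=
  if (n == 0%N) || (f n == 0) then 0 else f n ^+ l.

Lemma sum_fpow_chi (R : realType) (f : nat -> R[i]) (l : nat) (x : R) :
  \sum_(n <- upto x) fpow f l n = \sum_(n <- upto x) chi f l n.
Proof.
rewrite [LHS]big_seq [RHS]big_seq; apply: eq_bigr => n; rewrite mem_upto => /andP[n0 _].
rewrite /fpow /chi; case: n n0 => // n _ /=.
case: (eqVneq l 0%N) => [->|l0]; first by rewrite expr0.
by case: eqP => // ->; rewrite expr0n (negbTE l0).
Qed.

Lemma chi_mult (R : realType) (f : nat -> R[i]) (l : nat) :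
  completely_multiplicative f -> completely_multiplicative (chi f l).
Proof.
move=> [f1 fM]; split; first by rewrite /chi /= f1 oner_eq0 expr1n.
move=> m n m0 n0; rewrite /chi muln_eq0 !gtn_eqF //= fM // mulf_eq0.
by case: (f m == 0) => /=; rewrite ?mul0r //; case: (f n == 0); rewrite ?mulr0 // exprMn.
Qed.

Lemma nsq_root1 (R : realType) (d : nat) (a : R[i]) : (0 < d)%N -> a ^+ d = 1 -> nsq a = 1.
Proof.
move=> d0 h; have : nsq a ^+ d = 1 by rewrite -nsqX h nsq1.
by move/eqP; rewrite pexprn_eq1 ?nsq_ge0 // (gtn_eqF d0) => /eqP.
Qed.

Lemma nsq_chi_le1 (R : realType) (d : nat) (f : nat -> R[i]) (l n : nat) : (0 < d)%N ->
  values_in_mu0 d f -> nsq (chi f l n) <= 1.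
Proof.
move=> d0 hv; rewrite /chi; case: eqP => [_|/eqP n0] /=; first by rewrite nsq0.
case: eqP => [_|/eqP fn]; first by rewrite nsq0.
rewrite nsqX.
have n0' : (0 < n)%N by rewrite lt0n.
have [h|h] := hv n n0'.
  by rewrite h eqxx in fn.
by rewrite (nsq_root1 d0 h) expr1n.
Qed.

Lemma chi_modn (R : realType) (d : nat) (f : nat -> R[i]) (l n : nat) : 
  values_in_mu0 d f -> chi f (l %% d) n = chi f l n.
Proof.
move=> hv; rewrite /chi; case: eqP => [_|/eqP n0] //=.
case: eqP => [_|/eqP fn] //.
have n0' : (0 < n)%N by rewrite lt0n.
have [h|h] := hv n n0'.
  by rewrite h eqxx in fn.
by rewrite {2}(divn_eq l d) exprD mulnC exprM h expr1n mul1r.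
Qed.

Lemma chi_add (R : realType) (f : nat -> R[i]) (l k n : nat) :
  chi f (l + k) n = chi f l n * chi f k n.
Proof. by rewrite /chi; case: ifP => _; rewrite ?mul0r // exprD. Qed.

Lemma chi_mul_conj (R : realType) (d : nat) (f : nat -> R[i]) (l n : nat) : (0 < d)%N ->
  values_in_mu0 d f -> chi f l n * (chi f l n)^*%C = chi f 0 n.
Proof.
move=> d0 hv; rewrite mul_conj_nsq /chi; case: eqP => [_|/eqP n0] /=; first by rewrite nsq0.
case: eqP => [_|/eqP fn]; first by rewrite nsq0.
have n0' : (0 < n)%N by rewrite lt0n.
have [h|h] := hv n n0'.
  by rewrite h eqxx in fn.
by rewrite nsqX (nsq_root1 d0 h) expr1n expr0.
Qed.

(** [chi f 0] is the indicator of f(n) <> 0 and a unit for the other [chi f k], so inverses modulo d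
    are conjugates even where f vanishes. *)
Lemma chi_conj_eq (R : realType) (d : nat) (f : nat -> R[i]) (l k n : nat) : (0 < d)%N ->
  values_in_mu0 d f -> (d %| l + k)%N -> chi f k n = (chi f l n)^*%C.
Proof.
move=> d0 hv hd.
have e : chi f (l + k) n = chi f 0 n by rewrite -(chi_modn _ _ hv); move: hd => /eqP ->.
have idem k' : chi f k' n = chi f 0 n * chi f k' n by rewrite -chi_add add0n.
have cz : (chi f 0 n)^*%C = chi f 0 n.
  by rewrite /chi; case: ifP => _; rewrite ?conjc0 ?expr0 ?conjc1.
rewrite idem -(chi_mul_conj l n d0 hv) mulrAC -chi_add e -{1}cz.
by rewrite [X in _ = X^*%C]idem; exact/esym/rmorphM.
Qed.

(** For unimodular z this is twice the squared pretentious distance between z and 1, as |1 - z|^2 =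
    2 (1 - Re z). *)
Definition dist2 (R : realType) (Y : R) (z : nat -> R[i]) : R :=
  \sum_(p <- upto (expR Y) | prime p) (p%:R)^-1 * nsq (1 - z p).

Lemma dist2_ge0 (R : realType) (Y : R) (z : nat -> R[i]) : 0 <= dist2 Y z.
Proof. by apply: sumr_ge0 => p _; rewrite mulr_ge0 ?nsq_ge0 // invr_ge0 ler0n. Qed.

Lemma eq_dist2 (R : realType) (Y : R) (z w : nat -> R[i]) : (forall p, prime p -> z p = w p) ->
  dist2 Y z = dist2 Y w.
Proof. by move=> h; apply: eq_bigr => p pp; rewrite h. Qed.

Lemma dist2_conj (R : realType) (Y : R) (z : nat -> R[i]) :
  dist2 Y (fun p => (z p)^*%C) = dist2 Y z.
Proof.
apply: eq_bigr => p _; congr (_ * _); rewrite -[RHS]nsq_conj; congr nsq.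
by case: (z p) => a b; apply/eqP; rewrite eq_complex /=; apply/andP; split; apply/eqP; ring.
Qed.

(** The triangle inequality for the square root of [dist2], proved term by term with the weights 1 +
    b/a and 1 + a/b. Iterating it gives quadratic growth, where [dist2_mul_le] would give
    exponential growth. *)
Lemma dist2_mul (R : realType) (Y a b M : R) (z w : nat -> R[i]) :
  (forall p, nsq (z p) <= 1) -> 0 < a -> 0 < b ->
  dist2 Y z <= a ^+ 2 * M -> dist2 Y w <= b ^+ 2 * M ->
  dist2 Y (fun p => z p * w p) <= (a + b) ^+ 2 * M.
Proof.
move=> z1 a0 b0 hz hw.
apply: le_trans (_ : (1 + b / a) * dist2 Y z + (1 + a / b) * dist2 Y w <= _).
  rewrite /dist2 !mulr_sumr -big_split; apply: ler_sum => p _ /=.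
  rewrite [in leRHS]mulrCA [in X in _ <= _ + X]mulrCA -mulrDr ler_wpM2l ?invr_ge0 ?ler0n //.
  rewrite -!normc_sqr.
  have tri : normc (1 - z p * w p) <= normc (1 - z p) + normc (1 - w p).
    have -> : 1 - z p * w p = (1 - z p) + z p * (1 - w p) by ring.
    apply: le_trans (le_normcD _ _) _; rewrite lerD2l ComplexField.Normc.normcM.
    rewrite -[leRHS]mul1r ler_wpM2r ?normc_ge0 // -(@expr_le1 _ 2) ?normc_ge0 //.
    by rewrite normc_sqr.
  set u := normc (1 - z p) in tri *; set v := normc (1 - w p) in tri *.
  have u0 : 0 <= u by exact: normc_ge0.
  have v0 : 0 <= v by exact: normc_ge0.
  apply: le_trans (_ : (u + v) ^+ 2 <= _).
    by rewrite ler_sqr ?nnegrE ?normc_ge0 ?addr_ge0.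
  rewrite -subr_ge0.
  have -> : (1 + b / a) * u ^+ 2 + (1 + a / b) * v ^+ 2 - (u + v) ^+ 2 = (b * u - a * v) ^+ 2 / (a * b).
    by field; rewrite !gt_eqF.
  by rewrite divr_ge0 ?sqr_ge0 // mulr_ge0 ?ltW.
have c1 : 0 <= 1 + b / a by rewrite addr_ge0 // divr_ge0 ?ltW.
have c2 : 0 <= 1 + a / b by rewrite addr_ge0 // divr_ge0 ?ltW.
apply: le_trans (lerD (ler_wpM2l c1 hz) (ler_wpM2l c2 hw)) _.
rewrite le_eqVlt; apply/orP; left; apply/eqP; field.
by rewrite !gt_eqF.
Qed.

Lemma dist2_mul_le (R : realType) (Y : R) (z w : nat -> R[i]) :
  (forall p, nsq (z p) <= 1) ->
  dist2 Y (fun p => z p * w p) <= 2 * dist2 Y z + 2 * dist2 Y w.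
Proof.
move=> z1; rewrite /dist2 !mulr_sumr -big_split; apply: ler_sum => p _ /=.
rewrite [in leRHS]mulrCA [in X in _ <= _ + X]mulrCA -mulrDr ler_wpM2l ?invr_ge0 ?ler0n //.
have -> : 1 - z p * w p = (1 - z p) + z p * (1 - w p) by ring.
apply: le_trans (nsqD_le _ _) _; rewrite lerD2l ler_wpM2l // nsqM.
by rewrite -[leRHS]mul1r ler_wpM2r ?nsq_ge0.
Qed.

Lemma dist2_cis (R : realType) (Y t : R) :
  dist2 Y (fun p => cis (t * ln p%:R)) =
  2 * \sum_(p <- upto (expR Y) | prime p) (1 - cos (t * ln p%:R)) / p%:R.
Proof.
rewrite /dist2 mulr_sumr; apply: eq_bigr => p _; rewrite nsq_one_sub_cis; ring.
Qed.

(** For ln p <= Y / V one uses 1 - cos v <= v^2 and Mertens; the remaining primes have mass O(1 + ln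
    V). *)
Lemma dist2_cis_small (R : realType) (Y t V : R) : 1 <= Y -> 1 <= V -> `|t| <= V / Y ->
  dist2 Y (fun p => cis (t * ln p%:R)) <= 14 + 144 * (1 + ln V).
Proof.
move=> Y1 V1 ht; have Y0 : 0 < Y by lra. have V0 : 0 < V by lra.
have lV := ln_ge0 V1.
have b4 (u : R) : nsq (1 - cis u) <= 4.
  by rewrite nsq_one_sub_cis; have := cos_geN1 u; lra.
have [YV|YV] := leP V Y; last first.
  apply: le_trans (_ : 4 * \sum_(p <- upto (expR Y) | prime p) (p%:R)^-1 <= _).
    rewrite mulr_sumr; apply: ler_sum => p _; rewrite mulrC ler_wpM2r //.
    by rewrite invr_ge0 ler0n.
  have := prime_mass_all_le Y1; have : ln Y <= ln V by rewrite ler_ln ?posrE // ltW.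
  by move: (\sum_(p <- _ | _) _) => S h1 h2; lra.
pose Z := Y / V; have Z1 : 1 <= Z by rewrite ler_pdivlMr ?mul1r.
have ZY : Z <= Y by rewrite ler_pdivrMr // -[leLHS]mulr1 ler_wpM2l // ltW.
have eZY : expR Z <= expR Y by rewrite ler_expR.
rewrite /dist2 (sum_upto_split _ _ eZY).
have h1 : \sum_(n <- upto (expR Z) | prime n) (n%:R)^-1 * nsq (1 - cis (t * ln n%:R)) <= 14.
  apply: le_trans (_ : 2 * (V / Y) * \sum_(p <- upto (expR Z) | prime p) ln p%:R / p%:R <= _).
    rewrite mulr_sumr big_seq_cond [leRHS]big_seq_cond; apply: ler_sum => p.
    rewrite mem_upto => /andP[/andP[p0 pZ] pp]; rewrite le_ln_expR // in pZ.
    rewrite mulrC [leRHS]mulrA ler_wpM2r ?invr_ge0 ?ler0n // nsq_one_sub_cis.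
    have := one_sub_cos_le_sqr (t * ln p%:R); rewrite exprMn.
    have t2 : t ^+ 2 <= (V / Y) ^+ 2.
      by rewrite -(real_normK (num_real t)) ler_sqr ?nnegrE ?normr_ge0 // divr_ge0 ?ltW.
    have l0 := ln_nat_ge0 R p.
    have l2 : ln p%:R ^+ 2 <= Z * ln p%:R by rewrite expr2 ler_wpM2r.
    have : t ^+ 2 * ln p%:R ^+ 2 <= (V / Y) ^+ 2 * (Z * ln p%:R).
      by rewrite ler_pM ?sqr_ge0.
    have -> : (V / Y) ^+ 2 * (Z * ln p%:R) = V / Y * ln p%:R by rewrite /Z; field; rewrite !gt_eqF.
    move=> k1 k2; lra.
  have /andP[_ u1] := mertens (z := expR Z) ltac:(have := expR_ge1Dx Z; lra).
  rewrite expRK in u1.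
  have c0 : 0 <= 2 * (V / Y) by rewrite mulr_ge0 // divr_ge0 ?ltW.
  apply: le_trans (ler_wpM2l c0 u1) _.
  have -> : 2 * (V / Y) * (Z + 6) = 2 + 12 * (V / Y) by rewrite /Z; field; rewrite !gt_eqF.
  have : V / Y <= 1 by rewrite ler_pdivrMr ?mul1r.
  lra.
have h2 : \sum_(n <- upto (expR Y) | prime n && (expR Z < n%:R)) (n%:R)^-1 * nsq (1 - cis (t * ln n%:R)) <= 88 * (1 + ln V).
  apply: le_trans (_ : 4 * \sum_(p <- upto (expR Y) | prime p && (expR Z < p%:R)) (p%:R)^-1 <= _).
    rewrite mulr_sumr; apply: ler_sum => p _; rewrite mulrC ler_wpM2r //.
    by rewrite invr_ge0 ler0n.
  have := prime_mass_le Z1 ZY.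
  have -> : Y / Z = V by rewrite /Z; field; rewrite !gt_eqF.
  by move: (\sum_(p <- _ | _) _) => S h; lra.
apply: le_trans (lerD h1 h2) _; lra.
Qed.

Lemma sum_nsq_sub_root (R : realType) (d : nat) (a : R[i]) : (0 < d)%N -> a ^+ d = 1 -> a != 1 ->
  \sum_(l < d) nsq (1 - a ^+ l) = 2 * d%:R.
Proof.
move=> d0 ad a1.
have e (l : 'I_d) : nsq (1 - a ^+ l) = 2 - 2 * complex.Re (a ^+ l).
  have : nsq (a ^+ l) = 1 by rewrite nsqX (nsq_root1 d0 ad) expr1n.
  by rewrite /nsq; case: (a ^+ l) => u v /=; lra.
under eq_bigr do rewrite e.
rewrite sumrB -mulr_sumr -Re_sum.
have : (a - 1) * \sum_(l < d) a ^+ l = 0 by rewrite -subrX1 ad subrr.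
move/eqP; rewrite mulf_eq0 subr_eq0 (negbTE a1) => /eqP -> /=.
by rewrite mulr0 subr0 sumr_const card_ord -[_ *+ _]mulr_natr.
Qed.

(** The lower bound of [prime_cos_sum_ge] is ln (Y |u|) up to bounded factors inside the logarithm;
    exponentiating it isolates |u| Y. *)
Lemma twist_small (R : realType) (Y u B U1 : R) : 1 <= Y -> `|u| <= U1 ->
  dist2 Y (fun p => cis (u * ln p%:R)) <= B ->
  `|u| * Y <= expR (B / 2 + 54) * (10 * (1 + U1) ^+ 2).
Proof.
move=> Y1 uU hB; have Y0 : 0 < Y by lra.
have n0 := normr_ge0 u.
have [->|u0] := eqVneq u 0.
  by rewrite normr0 mul0r mulr_ge0 ?expR_ge0 // mulr_ge0 ?sqr_ge0.
have up : 0 < `|u| by rewrite normr_gt0.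
have h := prime_cos_sum_ge Y1 u0; rewrite dist2_cis in hB.
set A := 8 * _ / _ + 2 in h.
have A0 : 0 < A.
  by rewrite addr_gt0 // divr_gt0 // mulr_gt0 // exprn_gt0 //; lra.
have h2 : ln Y <= B / 2 + 54 + ln A.
  by move: h hB; move: (\sum_(p <- _ | _) _) => S h hB; lra.
have YA : Y <= expR (B / 2 + 54) * A.
  by rewrite -[X in _ <= _ * X](lnK A0) -expRD -[leLHS](lnK Y0) ler_expR.
apply: le_trans (ler_wpM2l n0 YA) _; rewrite mulrCA ler_wpM2l ?expR_ge0 //.
have -> : `|u| * A = 8 * (1 + `|u|) ^+ 2 + 2 * `|u| by rewrite /A; field; rewrite gt_eqF.
have : (1 + `|u|) ^+ 2 <= (1 + U1) ^+ 2 by rewrite ler_sqr ?nnegrE; lra.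
have : `|u| <= (1 + `|u|) ^+ 2 by nra.
lra.
Qed.

Lemma Zp_val_modn (d : nat) (d1 : (1 < d)%N) (a b : 'Z_d) : val (a + b) = ((val a + val b) %% d)%N.
Proof. by rewrite /=; congr modn; exact: Zp_cast. Qed.

(** On the scale of square roots an element of A costs 1, hence a difference 2 and n differences 2
    n. Negation in Z/d is conjugation, which preserves [dist2]. *)
Lemma approx_character_layers (R : realType) (d n : nat) (f : nat -> R[i]) (A : {set 'Z_d}) (Y M T : R) :
  (1 < d)%N -> values_in_mu0 d f -> 0 <= T ->
  A != finset.set0 ->
  (forall l, l \in A -> exists2 tau : R, `|tau| <= T &
      dist2 Y (fun p => chi f (val l) p * cis (tau * ln p%:R)) <= M) ->
  forall l, l \in diff_layer A n ->
    exists2 tau : R, `|tau| <= (2 * n)%N%:R * T &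
      dist2 Y (fun p => chi f (val l) p * cis (tau * ln p%:R)) <= (2 * n).+1%:R ^+ 2 * M.
Proof.
move=> d1 hv T0 /finset.set0Pn[l0 hl0] hA; have d0 : (0 < d)%N by lia.
have z1 l tau p : nsq (chi f l p * cis (tau * ln p%:R)) <= 1.
  by rewrite nsqM nsq_cis mulr1; exact: nsq_chi_le1 d0 hv.
have cM l k tau tau' p : (chi f l p * cis (tau * ln p%:R)) * (chi f k p * cis (tau' * ln p%:R)) =
   chi f (l + k) p * cis ((tau + tau') * ln (p%:R : R)).
  by rewrite mulrACA -chi_add -cisD mulrDl.
elim: n => [|n IH] l.
  (* The remaining 1 in 2 n + 1: [chi f 0] differs from 1 only where f vanishes, and there the
     approximation for any l0 in A has the same defect. *)
  rewrite inE => /eqP ->; exists 0; first by rewrite normr0 mulr_ge0.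
  rewrite expr1n mul1r; have [tau _ h] := hA l0 hl0; apply: le_trans h.
  apply: ler_sum => p _; rewrite ler_wpM2l ?invr_ge0 ?ler0n // mul0r cis0 mulr1.
  rewrite /chi; case: ifP => _; last by rewrite expr0 subrr nsq0 nsq_ge0.
  by rewrite mul0r.
move=> /diff_layerSP[y [a [b [hy ha hb ->]]]].
have [ty ty1 ty2] := IH y hy; have [ta ta1 ta2] := hA a ha; have [tb tb1 tb2] := hA b hb.
exists (ty + (ta - tb)).
  apply: le_trans (ler_normD _ _) _; have := ler_normB ta tb.
  rewrite (_ : (2 * n.+1)%N = ((2 * n) + 2)%N); last by rewrite mulnS addnC.
  by rewrite natrD mulrDl; lra.
have M0 : 0 <= M by apply: le_trans ta2; exact: dist2_ge0.
have cb : dist2 Y (fun p => chi f (val (- b)) p * cis (- tb * ln p%:R)) <= 1 ^+ 2 * M.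
  rewrite expr1n mul1r; apply: le_trans tb2; rewrite -[leRHS]dist2_conj.
  rewrite (@eq_dist2 R Y _ (fun p => ((chi f (val b) p * cis (tb * ln p%:R))^*)%C)) // => p _.
  rewrite conjM_cis mulNr; congr (_ * _); apply: (chi_conj_eq (d := d)) => //.
  by rewrite /dvdn -(Zp_val_modn d1) subrr.
have dab := dist2_mul (z1 (val a) ta) ltr01 ltr01 (_ : _ <= 1 ^+ 2 * M) cb.
rewrite expr1n mul1r in dab; have {}dab := dab ta2.
have p2 : 0 < (2 * n).+1%:R :> R by rewrite ltr0n.
have z2 p : nsq (chi f (val y) p * cis (ty * ln (p%:R : R))) <= 1 by exact: z1.
have H := dist2_mul z2 p2 (ltr0Sn R 1) ty2 dab.
have eN : (2 * n.+1).+1 = ((2 * n).+1 + 2)%N by rewrite mulnS addn2.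
rewrite [(2 * n.+1).+1%:R](_ : _ = (2 * n).+1%:R + 2); last by rewrite eN natrD.
apply: le_trans H; rewrite le_eqVlt; apply/orP; left; apply/eqP; apply: eq_dist2 => p _.
rewrite !cM; congr (_ * cis _).
rewrite -(chi_modn _ _ hv) !(Zp_val_modn d1).
rewrite -(chi_modn (d := d) (val y + (val a + val (- b))) _ hv).
by congr chi; rewrite modnDmr modn_mod.
Qed.

(** Since chi_l^2 times the conjugate of chi_(2l) is chi_0, the twist by 2 tau_l - tau_(2l) is
    itself close to 1, which forces it to be at most V / Y. Undoing a twist of that size costs O(1 +
    ln V), linear in [Mt] although V is exponential. *)
Lemma approx_character_trivial (R : realType) (d : nat) (f : nat -> R[i]) (Y Mt T1 : R) :
  (1 < d)%N -> values_in_mu0 d f -> 1 <= Y -> 0 <= T1 -> 0 <= Mt ->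
  (forall l : 'Z_d, exists2 tau : R, `|tau| <= T1 &
      dist2 Y (fun p => chi f (val l) p * cis (tau * ln p%:R)) <= Mt) ->
  forall l : 'Z_d, dist2 Y (chi f (val l)) <=
    2 * Mt + 2 * (14 + 144 * (1 + (18 * Mt + 54 + ln (10 * (1 + 3 * T1) ^+ 2)))).
Proof.
move=> d1 hv Y1 T0 M0 hall; have d0 : (0 < d)%N by lia.
have Y0 : 0 < Y by lra.
have /boolp.choice[tau htau] : forall l : 'Z_d, exists t : R, `|t| <= T1 /\
      dist2 Y (fun p => chi f (val l) p * cis (t * ln p%:R)) <= Mt.
  by move=> l; have [t t1 t2] := hall l; exists t.
have z1 l t p : nsq (chi f l p * cis (t * ln (p%:R : R))) <= 1.
  by rewrite nsqM nsq_cis mulr1; exact: nsq_chi_le1 d0 hv.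
have t10 : 0 < 10 * (1 + 3 * T1) ^+ 2 by rewrite mulr_gt0 // exprn_gt0 //; lra.
pose V := expR (18 * Mt + 54) * (10 * (1 + 3 * T1) ^+ 2).
have V1 : 1 <= V.
  have h1 : 1 <= expR (18 * Mt + 54) by have := expR_ge1Dx (18 * Mt + 54); lra.
  have h2 : 1 <= 10 * (1 + 3 * T1) ^+ 2 by nra.
  by rewrite -[1]mulr1 ler_pM.
have add l : `|tau l + tau l - tau (l + l)| <= V / Y.
  set u := tau l + tau l - _.
  have [a1 a2] := htau l; have [b1 b2] := htau (l + l).
  have a2' : dist2 Y (fun p => chi f (val l) p * cis (tau l * ln p%:R)) <= 1 ^+ 2 * Mt.
    by rewrite expr1n mul1r.
  have h1 := dist2_mul (z1 (val l) (tau l)) ltr01 ltr01 a2' a2'.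
  have z2 p : nsq ((chi f (val l) p * cis (tau l * ln p%:R)) * (chi f (val l) p * cis (tau l * ln (p%:R : R)))) <= 1.
    by rewrite nsqM mulr_ile1 ?nsq_ge0.
  have b3 : dist2 Y (fun p => (chi f (val (l + l)) p * cis (tau (l + l) * ln p%:R))^*%C) <= 1 ^+ 2 * Mt.
    by rewrite dist2_conj expr1n mul1r.
  have h2 := dist2_mul z2 (ltr0Sn R 1) ltr01 h1 b3.
  have {h1}h2 : dist2 Y (fun p => chi f 0 p * cis (u * ln p%:R)) <= 9 * Mt.
    have -> : 9 * Mt = (1 + 1 + 1) ^+ 2 * Mt by ring.
    apply: le_trans h2; rewrite le_eqVlt; apply/orP; left; apply/eqP; apply: eq_dist2 => p _.
    have rr (x c k e : R[i]) : (x * c) * (x * c) * (k * e) = (x * x * k) * (c * c * e) by ring.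
    rewrite conjM_cis rr -!cisD -chi_add.
    rewrite (Zp_val_modn d1) (chi_modn _ _ hv) (chi_mul_conj _ _ d0 hv).
    by congr (_ * cis _); rewrite /u; ring.
  (* Removing [chi f 0]: where it vanishes the term was 1 and becomes at most 4. *)
  have h3 : dist2 Y (fun p => cis (u * ln p%:R)) <= 36 * Mt.
    apply: le_trans (_ : 4 * dist2 Y (fun p => chi f 0 p * cis (u * ln p%:R)) <= _); last by lra.
    rewrite /dist2 mulr_sumr; apply: ler_sum => p _; rewrite mulrCA ler_wpM2l ?invr_ge0 ?ler0n //.
    rewrite /chi; case: ifP => _.
      rewrite mul0r subr0 nsq1 nsq_one_sub_cis; have := cos_geN1 (u * ln p%:R); lra.
    rewrite expr0 mul1r; have := nsq_ge0 (1 - cis (u * ln p%:R)); lra.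
  have uT : `|u| <= 3 * T1.
    apply: le_trans (ler_normB _ _) _; have := ler_normD (tau l) (tau l); lra.
  have h4 := twist_small Y1 uT h3.
  by rewrite ler_pdivlMr // /V (_ : 18 * Mt = 36 * Mt / 2) //; lra.
(* A bounded function on a group that is additive up to [delta] is bounded by [delta]: double
   a point where it is maximal. *)
have small l : `|tau l| <= V / Y.
  have [ls _ hls] := @arg_maxP _ _ _ (0 : 'Z_d) xpredT (fun l => `|tau l|) isT.
  have hl := hls l isT; have h2 := hls (ls + ls) isT; have h3 := add ls.
  have h4 : `|tau ls + tau ls| <= `|tau ls + tau ls - tau (ls + ls)| + `|tau (ls + ls)|.
    by rewrite -{1}(subrK (tau (ls + ls)) (tau ls + tau ls)) ler_normD.
  have h5 : `|tau ls + tau ls| = 2 * `|tau ls|.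
    by rewrite -mulr2n normrMn mulr2n; ring.
  rewrite /= in hl h2; lra.
move=> l; have [a1 a2] := htau l.
have lV : ln V = 18 * Mt + 54 + ln (10 * (1 + 3 * T1) ^+ 2).
  by rewrite /V lnM ?posrE ?expR_gt0 // expRK.
have sm : dist2 Y (fun p => cis (- tau l * ln p%:R)) <= 14 + 144 * (1 + ln V).
  by apply: dist2_cis_small => //; rewrite normrN.
rewrite -lV; apply: le_trans (lerD (ler_wpM2l (_ : 0 <= 2) a2) (ler_wpM2l (_ : 0 <= 2) sm)) => //.
apply: le_trans (dist2_mul_le _ _ (z1 (val l) (tau l))).
rewrite le_eqVlt; apply/orP; left; apply/eqP; apply: eq_dist2 => p _.
by rewrite -mulrA -cisD mulNr subrr cis0 mulr1.
Qed.

(** If f(p) is neither 0 nor 1, its powers over a full period sum to 0, so |1 - f(p)^l|^2 has mean 2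
    over l. *)
Lemma nontrivial_mass_le (R : realType) (d : nat) (f : nat -> R[i]) (Y D : R) : (0 < d)%N ->
  values_in_mu0 d f -> (forall l, (l < d)%N -> dist2 Y (chi f l) <= D) ->
  2 * \sum_(p <- upto (expR Y) | prime p && (f p != 0) && (f p != 1)) (p%:R)^-1 <= D.
Proof.
move=> d0 hv hD; have dR : (0 : R) < d%:R by rewrite ltr0n.
rewrite -(ler_pM2l dR).
have -> : d%:R * D = \sum_(l < d) D by rewrite sumr_const card_ord -[RHS]mulr_natl.
apply: le_trans (_ : \sum_(l < d) dist2 Y (chi f l) <= _); last first.
  by apply: ler_sum => l _; exact: hD.
rewrite /dist2 exchange_big /= !mulr_sumr.
rewrite [leLHS](eq_bigl (fun p => prime p && ((f p != 0) && (f p != 1)))); last by move=> p; rewrite andbA.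
rewrite [leLHS]big_mkcondr; apply: ler_sum => p pp; rewrite -mulr_sumr.
case: ifP => [/andP[f0 f1]|_]; last first.
  by rewrite mulr_ge0 ?invr_ge0 ?ler0n // sumr_ge0 // => l _; exact: nsq_ge0.
have p0 := prime_gt0 pp.
have E (l : 'I_d) : nsq (1 - chi f l p) = nsq (1 - f p ^+ l).
  by rewrite /chi (gtn_eqF p0) (negbTE f0).
under eq_bigr do rewrite E.
have [h|h] := hv p p0; first by rewrite h eqxx in f0.
rewrite (sum_nsq_sub_root d0 h f1); rewrite le_eqVlt; apply/orP; left; apply/eqP; ring.
Qed.

(** * Conclusion *)

Lemma sum_ord_Zp (V : nmodType) (d : nat) (F : nat -> V) : (1 < d)%N ->
  \sum_(l < d) F l = \sum_(l : 'Z_d) F (val l).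
Proof. by move=> d1; rewrite -[LHS](big_mkord xpredT) -[RHS](big_mkord xpredT) Zp_cast. Qed.

Lemma halasz_K_ge1 (R : realType) : 1 <= halasz_K R.
Proof. by rewrite /halasz_K; lra. Qed.

(** The first line bounds D in [nontrivial_mass_main]; 22 * 196 pays for the primes between e^Y and
    e^X, and 36 * 296 for the case of a short Y. *)
Definition mass_K (R : realType) : R :=
  150 * halasz_K R + 316 + 288 * (18 * (75 * halasz_K R) + 54 + 10 * (73 * halasz_K R) ^+ 2)
  + 22 * 196 + 36 * 296.

Lemma large_set_card (R : realType) (d : nat) (eta : R) (G : nat -> R[i]) : (1 < d)%N -> 0 < eta ->
  (forall l, normc (G l) <= 1) -> 2 * eta ^+ 2 * d%:R <= \sum_(l < d) nsq (G l) ->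
  eta ^+ 2 * d%:R <= #|[set l : 'Z_d | eta <= normc (G (val l))]%SET|%:R.
Proof.
move=> d1 e0 G1 hS; set A := [set l : 'Z_d | _]%SET.
rewrite (sum_ord_Zp (fun l => nsq (G l)) d1) in hS.
have : \sum_(l : 'Z_d) nsq (G (val l)) <= \sum_(l : 'Z_d) ((l \in A)%:R + eta ^+ 2).
  apply: ler_sum => l _; rewrite inE -normc_sqr.
  have n0 := normc_ge0 (G (val l)); have e2 := sqr_ge0 eta.
  case: (leP eta (normc (G (val l)))) => h.
    have : normc (G (val l)) ^+ 2 <= 1 by rewrite expr_le1.
    by rewrite /=; lra.
  rewrite add0r ler_sqr ?nnegrE ?(ltW e0) //; exact: ltW.
have Ec : \sum_(l : 'Z_d) eta ^+ 2 = eta ^+ 2 * d%:R.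
  by have := sum_ord_Zp (fun=> eta ^+ 2) d1; rewrite sumr_const card_ord => <-; rewrite mulr_natr.
have EA : \sum_(l : 'Z_d) ((l \in A)%:R + eta ^+ 2) = #|A|%:R + eta ^+ 2 * d%:R.
  rewrite big_split; congr (_ + _); last exact: Ec.
  by rewrite -sum1_card natr_sum [RHS]big_mkcond; apply: eq_bigr => l _; case: (l \in A).
rewrite EA.
move=> h; have := le_trans hS h; move: (#|A|%:R : R) => c; lra.
Qed.

Lemma ln_pow2_le (R : realType) (J : nat) : ln (4 * 2 ^+ J) <= 2 + J%:R :> R.
Proof.
have l2 : ln 2 <= 1 :> R by rewrite -[X in ln X]/(1 + 1); apply: le_ln1Dx; lra.
have -> : 4 * 2 ^+ J = 2 ^+ J.+2 :> R by rewrite !exprS mulrA -natrM.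
have JJ : J.+2%:R = J%:R + 2 :> R by rewrite -(addn2 J) natrD.
rewrite lnXn // -[_ *+ _]mulr_natr JJ mulrC.
have J0 : (0 : R) <= J%:R by rewrite ler0n.
have J2 : 0 <= J%:R + 2 :> R by lra.
by have := ler_wpM2l J2 l2; rewrite mulr1; lra.
Qed.

Lemma nontrivial_mass_main (R : realType) (d : nat) (f : nat -> R[i]) (X eta : R) :
  (1 < d)%N -> completely_multiplicative f -> values_in_mu0 d f ->
  0 < eta -> eta <= 1 -> (eta ^+ 2)^-1 < (pdiv d)%:R ->
  2 * eta ^+ 2 * d%:R <= \sum_(l < d) nsq (mean (chi f l) (expR X)) ->
  \sum_(p <- upto (expR X) | prime p && (f p != 0) && (f p != 1)) (p%:R)^-1 <= mass_K R / eta ^+ 8.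
Proof.
move=> d1 fM hv e0 e1 hpd hS; have d0 : (0 < d)%N by exact: ltnW.
pose P p := prime p && (f p != 0) && (f p != 1).
have Pp p : P p -> prime p by move=> /andP[/andP[]].
have inv0 (p : nat) : 0 <= (p%:R)^-1 :> R by rewrite invr_ge0 ler0n.
have K1 := halasz_K_ge1 R; set K := halasz_K R in K1.
have K0 : 0 <= K := le_trans ler01 K1.
pose e := eta^-1; have e1' : 1 <= e by rewrite /e invf_ge1.
have ege0 : 0 <= e := le_trans ler01 e1'.
have ee : e * eta = 1 by rewrite mulVf // gt_eqF.
set E := e ^+ 8; have -> : mass_K R / eta ^+ 8 = mass_K R * E by rewrite /E /e exprVn.
have E1 : 1 <= E by exact: exprn_ege1.
have E2 : e ^+ 2 <= E by exact: ler_weXn2l.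
have Ee : e <= E by rewrite -[e]expr1; exact: ler_weXn2l.
have E7 : e ^+ 7 <= E by exact: ler_weXn2l.
have KE : K <= K * E by rewrite -[leLHS]mulr1 ler_wpM2l.
have K2E : K ^+ 2 <= K ^+ 2 * E by rewrite -[leLHS]mulr1 ler_wpM2l // sqr_ge0.
have K20 : 0 <= K ^+ 2 by exact: sqr_ge0.
have massK : mass_K R * E = 150 * (K * E) + 316 * E + 288 * (18 * 75 * (K * E) + 54 * E + 10 * 73 * 73 * (K ^+ 2 * E))
   + 22 * 196 * E + 36 * 296 * E by rewrite /mass_K -/K; ring.
have E0 : 0 <= E := le_trans ler01 E1.
have KE0 : 0 <= K * E by rewrite mulr_ge0.
have K2E0 : 0 <= K ^+ 2 * E by rewrite mulr_ge0.
pose J := (Num.truncn (192 / eta ^+ 2)).+1.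
have j0 : 0 <= 192 / eta ^+ 2 by rewrite divr_ge0 ?sqr_ge0.
have /andP[j1 j2] := truncn_itv j0; rewrite -/J in j2.
have JE : 2 + J%:R <= 195 * E.
  rewrite /J -natr1; have : 192 / eta ^+ 2 = 192 * e ^+ 2 by rewrite /e exprVn.
  clear -j1 E2 E1; lra.
have l4 := ln_pow2_le R J.
have W0 : 0 < 4 * 2 ^+ J :> R by rewrite mulr_gt0 // exprn_gt0.
have W2 : 1 <= 2 ^+ J :> R by rewrite exprn_ege1 // ler1n.
have W1 : 1 <= 4 * 2 ^+ J :> R by clear -W2; lra.
set W := 4 * 2 ^+ J in l4 W0 W1.
clear W2.
pose Y := X / W.
(* If Y is too short for a window, then X <= 100 W / eta, and the mass of all primes up to e^X is
   small enough. *)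
have [hY|hY] := ltP Y (100 / eta).
  have [X1|X1] := leP X 1.
    apply: le_trans (_ : \sum_(p <- upto (expR 1) | prime p) (p%:R)^-1 <= _).
      by apply: ler_sum_upto => //; rewrite ler_expR.
    apply: le_trans (prime_mass_all_le (lexx 1)) _; rewrite ln1 massK; clear -E1 KE0 K2E0; lra.
  apply: le_trans (_ : \sum_(p <- upto (expR X) | prime p) (p%:R)^-1 <= _).
    by apply: ler_sum_upto.
  apply: le_trans (prime_mass_all_le (ltW X1)) _.
  have XW : X <= W * (100 * e).
    by move: hY; rewrite /Y ltr_pdivrMr // -/e => h; rewrite mulrC ltW.
  have lX : ln X <= ln W + 100 * e.
    have e100 : 0 < 100 * e by rewrite mulr_gt0 // invr_gt0.
    apply: le_trans (_ : ln (W * (100 * e)) <= _).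
      by rewrite ler_ln ?posrE //; [exact: lt_le_trans ltr01 (ltW X1) | rewrite mulr_gt0].
    by rewrite lnM ?posrE // lerD2l ltW // ln_sublinear.
  rewrite massK; clear -lX l4 JE Ee E1 KE0 K2E0; lra.
have U100 : 100 <= Y by apply: le_trans hY; rewrite ler_pdivlMr //; clear -e1; lra.
have Y1 : 1 <= Y by apply: le_trans U100; rewrite ler1n.
have Y0 : 0 < Y := lt_le_trans ltr01 Y1.
have XE : X = Y * W by rewrite /Y divfK // gt_eqF.
have YX : Y <= X by rewrite XE -[leLHS]mulr1 ler_wpM2l // ltW.
pose G l := mean (chi f l) (expR X).
have G1 l : normc (G l) <= 1.
  by apply: normc_mean_le1; [exact: expR_gt0 | move=> n; exact: nsq_chi_le1 d0 hv].
have card := large_set_card d1 e0 G1 hS.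
set A := [set l : 'Z_d | _]%SET in card.
(* As m + 1 > eta^(-2), the set A has more than d / (m + 1) elements, while m < [pdiv d]. *)
pose m := Num.truncn ((eta ^+ 2)^-1).
have e2 : 0 < eta ^+ 2 by rewrite exprn_gt0.
have m0 : 0 <= (eta ^+ 2)^-1 by rewrite invr_ge0 ltW.
have /andP[m1 m2] := truncn_itv m0; rewrite -/m in m1 m2.
have dR : (0 : R) < d%:R by rewrite ltr0n.
have hA : (d < m.+1 * #|A|)%N.
  rewrite -(ltr_nat R) natrM; apply: lt_le_trans (_ : m.+1%:R * (eta ^+ 2 * d%:R) <= _); last by rewrite ler_wpM2l.
  rewrite mulrA -[ltLHS]mul1r ltr_pM2r //; move: m2; rewrite -[ltLHS]div1r ltr_pdivrMr //.
have hm : (m < pdiv d)%N by rewrite -(ltr_nat R); exact: le_lt_trans hpd.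
have full := diff_layer_full d1 hA hm.
pose T := 6 * K / eta ^+ 2; pose M := 3 * K / eta ^+ 3.
have T0 : 0 <= T by rewrite divr_ge0 ?sqr_ge0 // mulr_ge0.
have A0 : A != finset.set0 by apply: contraTneq hA => ->; rewrite cards0 muln0.
have hal l : l \in A -> exists2 tau : R, `|tau| <= T &
      dist2 Y (fun p => chi f (val l) p * cis (tau * ln p%:R)) <= M.
  rewrite inE => hl.
  have [tau t1 t2] := halasz_weak (chi_mult (val l) fM) (fun n => nsq_chi_le1 (val l) n d0 hv) e0 e1 hl j2 hY.
  exists tau => //; rewrite -(ler_sqr _ T0) ?nnegrE ?normr_ge0 // real_normK ?num_real //.
  apply: le_trans t1 _; rewrite -/K.
  have -> : T ^+ 2 = 36 * K ^+ 2 / eta ^+ 4 by rewrite /T; field; rewrite gt_eqF.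
  rewrite ler_wpM2r ?invr_ge0 ?exprn_ge0 ?(ltW e0) //; clear -K1; nra.
have me : m%:R <= e ^+ 2 by rewrite /e exprVn.
have m0' : (0 : R) <= m%:R by rewrite ler0n.
(* With 2 m differences the twist is at most 4 m T and the distance at most (4 m + 1)^2 M, where 4 m
   + 1 <= 5 e^2. *)
pose T1 := 24 * K * e ^+ 4; pose Mt := 75 * K * e ^+ 7.
have T10 : 0 <= T1 by rewrite !mulr_ge0 ?exprn_ge0.
have Mt0 : 0 <= Mt by rewrite !mulr_ge0 ?exprn_ge0.
have all_l (l : 'Z_d) : exists2 tau : R, `|tau| <= T1 &
      dist2 Y (fun p => chi f (val l) p * cis (tau * ln p%:R)) <= Mt.
  have [tau t1 t2] := approx_character_layers d1 hv T0 A0 hal (full l).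
  exists tau.
    apply: le_trans t1 _.
    have -> : T1 = (4 * e ^+ 2) * T by rewrite /T1 /T /e; field; rewrite gt_eqF.
    rewrite ler_wpM2r // mulnA natrM; clear -me; lra.
  apply: le_trans t2 _.
  have -> : Mt = (5 * e ^+ 2) ^+ 2 * M by rewrite /Mt /M /e; field; rewrite gt_eqF.
  have M0 : 0 <= M by rewrite divr_ge0 ?exprn_ge0 ?(ltW e0) // mulr_ge0.
  have e21 : 1 <= e ^+ 2 by exact: exprn_ege1.
  rewrite ler_wpM2r // ler_sqr ?nnegrE ?ler0n //; last by rewrite mulr_ge0 ?exprn_ge0.
  rewrite mulnA -natr1 natrM; clear -me e21; lra.
have triv := approx_character_trivial d1 hv Y1 T10 Mt0 all_l.
set D := 2 * Mt + _ in triv.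
have hD l : (l < d)%N -> dist2 Y (chi f l) <= D.
  move=> ld; have h : (l < (Zp_trunc d).+2)%N by rewrite (Zp_cast d1).
  exact: (triv (Ordinal h)).
have SY := nontrivial_mass_le d0 hv hD.
have eYX : expR Y <= expR X by rewrite ler_expR.
rewrite (sum_upto_split _ _ eYX).
have tail : \sum_(n <- upto (expR X) | P n && (expR Y < n%:R)) (n%:R)^-1 <= 22 * (1 + 195 * E).
  apply: le_trans (_ : \sum_(p <- upto (expR X) | prime p && (expR Y < p%:R)) (p%:R)^-1 <= _).
    by apply: ler_sum_upto => // n /andP[/Pp -> ->].
  apply: le_trans (prime_mass_le _ YX) _; first by [].
  have -> : X / Y = W by rewrite XE mulrC mulKf // gt_eqF.
  clear -l4 JE; lra.
apply: le_trans (lerD (_ : _ <= D / 2) tail) _.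
  by rewrite ler_pdivlMr // mulrC.
(* The crude bound ln y < y gives a term of order e^8; the other costs are at most of order e^7. *)
have lT : ln (10 * (1 + 3 * T1) ^+ 2) <= 10 * 73 * 73 * (K ^+ 2 * E).
  have t10 : 0 < 10 * (1 + 3 * T1) ^+ 2 by rewrite mulr_gt0 // exprn_gt0 // addrC ltr_wpDl // mulr_ge0.
  apply: le_trans (ltW (ln_sublinear t10)) _.
  have h1 : 1 + 3 * T1 <= 73 * K * e ^+ 4.
    have : 1 <= K * e ^+ 4 by rewrite -[1]mulr1 ler_pM // exprn_ege1.
    rewrite /T1 -/K; clear; lra.
  have h2 : (1 + 3 * T1) ^+ 2 <= (73 * K * e ^+ 4) ^+ 2 by rewrite ler_sqr ?nnegrE ?(le_trans _ h1) ?addr_ge0 ?mulr_ge0.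
  have -> : 10 * 73 * 73 * (K ^+ 2 * E) = 10 * (73 * K * e ^+ 4) ^+ 2 by rewrite /E; ring.
  clear -h2; lra.
have MtE : Mt <= 75 * (K * E) by rewrite /Mt -mulrA ler_wpM2l // ler_wpM2l.
rewrite massK /D; clear -MtE lT KE0 K2E0 E1 Mt0; lra.
Qed.

Lemma mass_K_ge0 (R : realType) : 0 <= mass_K R.
Proof.
have K1 := halasz_K_ge1 R; rewrite /mass_K; have := sqr_ge0 (73 * halasz_K R).
move: (halasz_K R) K1 => K K1; move: ((73 * K) ^+ 2) => q q0; lra.
Qed.

(** With eta^2 = D / 2 an eleventh root gives the theorem. If [pdiv d] <= eta^(-2) the product is at
    most 1; otherwise the power 22 of eta outweighs eta^(-8). *)
Lemma Sigma_mul_le (R : realType) (d : nat) (f : nat -> R[i]) (x eta : R) :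
  (1 < d)%N -> completely_multiplicative f -> values_in_mu0 d f -> 1 <= x ->
  0 < eta -> eta <= 1 ->
  2 * eta ^+ 2 * d%:R <= \sum_(l < d) nsq (mean (chi f l) x) ->
  Sigma d f x * (eta ^+ 2) ^+ 11 <= 2 + mass_K R.
Proof.
move=> d1 fM hv x1 e0 e1 hS; have K0 := mass_K_ge0 R.
have e2 : 0 < eta ^+ 2 by rewrite exprn_gt0.
have e21 : eta ^+ 2 <= 1 by rewrite exprn_ile1 // ltW.
have E0 : 0 <= (eta ^+ 2) ^+ 11 by rewrite exprn_ge0 // ltW.
have [hp|hp] := leP (pdiv d)%:R ((eta ^+ 2)^-1).
  have hs : Sigma d f x <= (eta ^+ 2)^-1 by apply: le_trans hp; rewrite ge_min lexx.
  apply: le_trans (ler_wpM2r E0 hs) _; rewrite exprS mulKf ?gt_eqF //.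
  have : (eta ^+ 2) ^+ 10 <= 1 by rewrite exprn_ile1 // ltW.
  lra.
have xX : expR (ln x) = x by rewrite lnK // posrE; lra.
rewrite -xX in hS; have := nontrivial_mass_main d1 fM hv e0 e1 hp hS; rewrite xX => hm.
have hs : Sigma d f x <= 2 + mass_K R / eta ^+ 8.
  by rewrite ge_min; apply/orP; right; rewrite lerD2l.
apply: le_trans (ler_wpM2r E0 hs) _.
have -> : (2 + mass_K R / eta ^+ 8) * (eta ^+ 2) ^+ 11 = 2 * (eta ^+ 2) ^+ 11 + mass_K R * (eta ^+ 2) ^+ 7.
  by field; rewrite gt_eqF.
have h1 : (eta ^+ 2) ^+ 11 <= 1 by rewrite exprn_ile1 // ltW.
have h2 : (eta ^+ 2) ^+ 7 <= 1 by rewrite exprn_ile1 // ltW.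
have := ler_wpM2l K0 h2; lra.
Qed.

Theorem theorem1p2 (R : realType) :
  exists C : R, 0 < C /\
  forall (d : nat) (x0 x : R) (f : nat -> R[i]),
    (2 <= d)%N -> 3 <= x0 -> classM x0 d f -> 1 <= x -> x <= x0 ->
    (d%:R)^-1 * \sum_(l < d) (ComplexField.Normc.normc (\sum_(n <- upto x) fpow f l n)) ^+ 2
      <= C * x ^+ 2 * (ln (Sigma d f x)) ^+ 2 / (Sigma d f x `^ (11%:R^-1)).
Proof.
have K0 := mass_K_ge0 R; set B := 2 + mass_K R.
have B0 : 0 < B by rewrite /B; lra.
exists (8 * B `^ (11%:R^-1)); split; first by rewrite mulr_gt0 // powR_gt0.
move=> d x0 x f d1 _ [fM hv _] x1 _.
have d0 : (0 < d)%N by exact: ltnW.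
have dR : (0 : R) < d%:R by rewrite ltr0n.
have x00 : 0 < x by lra.
set Sg := Sigma d f x.
have Sg2 : 2 <= Sg.
  rewrite /Sg /Sigma le_min ler_nat prime_gt1 ?pdiv_prime //= lerDl.
  by apply: sumr_ge0 => p _; rewrite invr_ge0 ler0n.
have Sg0 : 0 < Sg by lra.
pose D := (d%:R)^-1 * \sum_(l < d) nsq (mean (chi f l) x).
have -> : (d%:R)^-1 * \sum_(l < d) (ComplexField.Normc.normc (\sum_(n <- upto x) fpow f l n)) ^+ 2 = x ^+ 2 * D.
  rewrite /D mulrCA; congr (_ * _); rewrite mulr_sumr; apply: eq_bigr => l _.
  rewrite normc_sqr sum_fpow_chi /mean nsqM nsq_real mulrA -exprMn divff ?expr1n ?mul1r //.
  by rewrite gt_eqF.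
have D0 : 0 <= D.
  by rewrite mulr_ge0 ?invr_ge0 ?ler0n // sumr_ge0 // => l _; exact: nsq_ge0.
have D1 : D <= 1.
  rewrite /D mulrC ler_pdivrMr // mul1r.
  apply: le_trans (_ : \sum_(l < d) 1 <= _); last by rewrite sumr_const card_ord.
  by apply: ler_sum => l _; apply: nsq_mean_le1 => // n; exact: nsq_chi_le1 d0 hv.
have P0 : 0 < Sg `^ (11%:R^-1) by rewrite powR_gt0.
have DB : D / 2 <= B `^ (11%:R^-1) / Sg `^ (11%:R^-1).
  (* eta must be positive below, so D = 0 is treated apart. *)
  have [->|Dn0] := eqVneq D 0; first by rewrite mul0r divr_ge0 ?powR_ge0.
  have Dp : 0 < D by rewrite lt_neqAle eq_sym Dn0.
  pose eta := Num.sqrt (D / 2).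
  have eE : eta ^+ 2 = D / 2 by rewrite sqr_sqrtr //; lra.
  have e0 : 0 < eta by rewrite sqrtr_gt0; lra.
  have e1 : eta <= 1 by rewrite -(@expr_le1 _ 2) ?(ltW e0) // eE; lra.
  have hS : 2 * eta ^+ 2 * d%:R <= \sum_(l < d) nsq (mean (chi f l) x).
    by rewrite eE [2 * _]mulrC divfK ?pnatr_eq0 // /D [leLHS]mulrC mulrA mulfV ?mul1r // gt_eqF.
  have h := Sigma_mul_le d1 fM hv x1 e0 e1 hS; rewrite -/Sg eE -/B in h.
  rewrite ler_pdivlMr //.
  have D20 : 0 <= D / 2 by lra.
  have -> : D / 2 = ((D / 2) ^+ 11) `^ (11%:R^-1).
    by rewrite -powR_mulrn // -powRrM mulfV ?pnatr_eq0 // powRr1.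
  rewrite -powRM ?exprn_ge0 ?(ltW Sg0) //.
  apply: ge0_ler_powR; rewrite ?nnegrE ?invr_ge0 ?ler0n ?(ltW B0) //.
    by rewrite mulr_ge0 ?exprn_ge0 ?(ltW Sg0).
  by rewrite mulrC.
(* As Sigma >= 2 the logarithmic factor is at least 1/4; together with D / 2 this explains the 8 in
   the constant. *)
have l2 : 1 / 4 <= ln Sg ^+ 2.
  have : 1 / 2 <= ln Sg by apply: le_trans (half_le_ln2 R) _; rewrite ler_ln ?posrE.
  nra.
have x2 : 0 <= x ^+ 2 by rewrite sqr_ge0.
have -> : 8 * B `^ (11%:R^-1) * x ^+ 2 * ln Sg ^+ 2 / Sg `^ (11%:R^-1) =
  x ^+ 2 * (8 * (B `^ (11%:R^-1) / Sg `^ (11%:R^-1)) * ln Sg ^+ 2) by ring.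
rewrite ler_wpM2l //.
set q := B `^ _ / _ in DB *; have q0 : 0 <= q by rewrite divr_ge0 ?powR_ge0.
have := ler_wpM2l q0 l2; lra.
Qed.
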